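(* Let $X,U,W,A,S(t),X_1,X_{-1},A_{-1},S_{-1}(t),J$ be as in the context, let $B\in\mathcal L(U,X_{-1})$ and $C\in\mathcal L(W,U)$, and let ${}_X(BC)=P_{\mathfrak X}BC$ for a fixed choice of subspaces $\mathfrak X,\mathfrak X_{-1}$ as in the context. Assume that there are constants $T,M>0$ such that the following hold. (h1) There exists $\alpha_1>0$ such that for every $\mu\in(0,\alpha_1)$ the operator $A_{BC}:=(A_{-1}-\mu BC)|_X$ with domain $D:=D(A)\cap\{y\in W:\ BCy\in X\}$ generates a $C_0$-semigroup $(\mathcal T_\mu(t))_{t\ge0}$ on $X$. (h2) $\int_0^T S_{-1}(T-s)Bu(s)\,ds\in X$ for all $u\in L^1(0,T;U)$. (h3) $\int_0^T\|CS(t)y\|_U\,dt\le M\|y\|_X$ for all $y\in D(A)$. (h4) For all $u\in L^1(0,T;U)$, $\int_0^T\big\|C\int_0^r S_{-1}(r-s)Bu(s)\,ds\big\|_U\,dr\le M\|u\|_1$, where $\|u\|_1=\int_0^T\|u(\tau)\|_U\,d\tau$ (this includes the requirement that the inner integral lies in $W$ for a.e. $r\in(0,T)$, so that the expression makes sense). (h5) There is $\delta>0$ such that for every $y\in D(A)$ and every selection $\phi(t)\in J(S(t)y)$, $t\in[0,T]$, $$\int_0^T \mathrm{Re}\,\langle {}_X(BC)S(t)y,\phi(t)\rangle\,dt\ \ge\ \delta\|S(T)y\|_X^2 .$$ (h6) There are constants $k_1,k_2\ge0$ such that for all $y,z\in D(A)$ there exists $(y^*,z^* )\in J(y)\times J(z)$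 with $$|\langle {}_X(BC)y,y^*\rangle-\langle {}_X(BC)z,z^*\rangle|\le k_1\big(\|y\|_{D(C)}+\|z\|_{D(C)}\big)\|y-z\|_X+k_2\big(\|y\|_X+\|z\|_X\big)\|C(y-z)\|_U,$$ where $\|y\|_{D(C)}:=\|y\|_X+\|Cy\|_U$. Then there exists $\alpha>0$ such that for every $\mu\in(0,\alpha)$ the closed-loop system $$\dot y(t)=Ay(t)-\mu BCy(t),\quad t>0,\qquad y(0)=y_0\in X,$$ is exponentially stable, i.e. there are constants $M',\sigma>0$ such that $\|\mathcal T_\mu(t)y_0\|_X\le M'e^{-\sigma t}\|y_0\|_X$ for all $t\ge0$ and all $y_0\in X$.
   Context: $X$ and $U$ are Banach spaces. $A:D(A)\subset X\to X$ generates a $C_0$-semigroup of contractions $S(t)$ on $X$. $X_1$ is $D(A)$ with the graph norm. $X_{-1}$ is the completion of $X$ for the norm $\|x\|_{-1}=\|(A-\eta I)^{-1}x\|_X$, for some (equivalently any) $\eta\in\rho(A)$. $S_{-1}(t)$ is the extension of $S(t)$ to a $C_0$-semigroup on $X_{-1}$, with generator $A_{-1}:X\subset X_{-1}\to X_{-1}$, which extends $A$. $W$ is a Banach space with continuous injections $X_1\hookrightarrow W\hookrightarrow X$. For an operator $K$ with values in $X_{-1}$, $K|_X$ denotes its part in $X$ (restriction to elements whose image lies in $X$). Duality map: for $y\in X$, $J(y)$ is the nonempty set of all $\phi\in X^*$ with $\langle y,\phi\rangle=\|y\|_X^2=\|\phi\|^2$. The operator ${}_X(BC)$: fix two linear subspaces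 $\mathfrak X,\mathfrak X_{-1}$ of $X_{-1}$ with $\mathfrak X\subset X$ and $X\cap\mathfrak X_{-1}=\{0\}$ (so that their sum is a direct algebraic sum), and such that $\mathrm{Range}(BC)\subset\mathfrak X\oplus\mathfrak X_{-1}$. Let $P_{\mathfrak X}$ be the projection of $\mathfrak X\oplus\mathfrak X_{-1}$ onto $\mathfrak X$ along $\mathfrak X_{-1}$, and set ${}_X(BC):=P_{\mathfrak X}BC$. Convention on integrals involving selections of $J$: the inequality is required for every selection $\phi$; if the integrand is not measurable, the integral is read as the upper Lebesgue integral (infimum of $\int g$ over integrable $g$ dominating the integrand a.e.). *)

(* Defs.v *)
From HB Require Import structures.
From mathcomp Require Import all_boot all_order all_algebra.
From mathcomp Require Import complex.
From mathcomp Require Import all_classical all_reals all_analysis.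

Set Implicit Arguments.
Unset Strict Implicit.
Unset Printing Implicit Defensive.

Import Order.TTheory GRing.Theory Num.Theory.
Import numFieldNormedType.Exports.

Local Open Scope classical_set_scope.
Local Open Scope ring_scope.

(* The scalar field: the complex numbers if [cplx], the real numbers otherwise,
   so that Banach spaces over both fields are treated at once. *)
Definition scalars (R : realType) (cplx : bool) : numFieldType :=
  if cplx then (R[i] : numFieldType) else (R : numFieldType).

Definition sre (R : realType) (cplx : bool) : scalars R cplx -> R :=
  if cplx as b return scalars R b -> R then @complex.Re R else id.

Definition sofr (R : realType) (cplx : bool) : R -> scalars R cplx :=
  if cplx as b return R -> scalars R b
  then (fun x => Complex x 0) else id.
Arguments sofr {R} cplx.

(* The library norm of a normed module over [scalars R cplx] takes its values in
   [scalars R cplx]; it is nonnegative there, and [rnorm] reads it in [R]. *)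
Definition rnorm (R : realType) (cplx : bool)
    (V : normedModType (scalars R cplx)) (x : V) : R := sre `|x|.

Definition rscale (R : realType) (cplx : bool)
    (V : normedModType (scalars R cplx)) (a : R) (x : V) : V :=
  sofr cplx a *: x.

(* For an injection [i], read as an inclusion of V1 in V2: the element [y] of V2
   seen as an element of V1 (a dummy value if [y] is not in V1). *)
Definition emb_inv (V1 : pointedType) (V2 : Type) (i : V1 -> V2) (y : V2) : V1 :=
  xget point [set x | i x = y].

Section Bochner.
Variables (R : realType) (cplx : bool).
Implicit Type V : normedModType (scalars R cplx).

Record step_fun V := StepFun {
  sf_size : nat;
  sf_set : 'I_sf_size -> set R;
  sf_val : 'I_sf_size -> V;
  sf_measurable : forall i, measurable (sf_set i);
  sf_finite : forall i, (lebesgue_measure (sf_set i) < +oo)%E }.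

Definition step_eval V (s : step_fun V) (x : R) : V :=
  \sum_i rscale (\1_(@sf_set V s i) x) (sf_val i).

Definition step_int V (D : set R) (s : step_fun V) : V :=
  \sum_i rscale (fine (lebesgue_measure (@sf_set V s i `&` D))) (sf_val i).

Definition strongly_measurable V (D : set R) (f : R -> V) : Prop :=
  exists s : nat -> step_fun V,
    {ae lebesgue_measure, forall x, D x ->
       step_eval (s n) x @[n --> \oo] --> f x}.

Definition norm_L1 V (D : set R) (f : R -> V) : \bar R :=
  (\int[lebesgue_measure]_(x in D) (rnorm (f x))%:E)%E.

Definition in_L1 V (D : set R) (f : R -> V) : Prop :=
  strongly_measurable D f /\ (norm_L1 D f < +oo)%E.

Definition is_bochner_int V (D : set R) (f : R -> V) (v : V) : Prop :=
  strongly_measurable D f /\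
  exists s : nat -> step_fun V,
    norm_L1 D (fun x => f x - step_eval (s n) x) @[n --> \oo] --> 0%:E /\
    step_int D (s n) @[n --> \oo] --> v.

(* The Bochner integral of [f] over [D] (0 if [f] is not Bochner integrable). *)
Definition bochner_int V (D : set R) (f : R -> V) : V :=
  xget 0 [set v | is_bochner_int D f v].

End Bochner.

(* Upper Lebesgue integral. It is the Lebesgue integral of [f] whenever [f] is
   measurable and has an integral; it is +oo if no integrable function
   dominates [f]. *)
Definition upper_int (R : realType) (D : set R) (f : R -> R) : \bar R :=
  ereal_inf [set (\int[lebesgue_measure]_(x in D) (g x)%:E)%E | g in
    [set g : R -> R | lebesgue_measure.-integrable D (EFin \o g) /\
       {ae lebesgue_measure, forall x, D x -> f x <= g x}]].

Section Semigroups.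
Variables (R : realType) (cplx : bool).
Implicit Type V : normedModType (scalars R cplx).

(* Only the values at times t >= 0 are meaningful. *)
Definition C0_semigroup V (S : R -> {linear V -> V}) : Prop :=
  [/\ forall t : R, 0 <= t -> continuous (S t),
      forall x, S 0 x = x,
      forall (s t : R) (x : V), 0 <= s -> 0 <= t -> S (s + t) x = S s (S t x) &
      forall x, S t x @[t --> 0^'+] --> x].

(* The operator [A] with domain [D] (values outside [D] are irrelevant) is the
   infinitesimal generator of the C0-semigroup [S]. *)
Definition generates V (D : set V) (A : V -> V) (S : R -> {linear V -> V}) :
    Prop :=
  C0_semigroup S /\
  forall x y : V, (rscale h^-1 (S h x - x) @[h --> 0^'+] --> y) <->
                  (D x /\ y = A x).

Definition contractive V (S : R -> {linear V -> V}) : Prop :=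
  forall (t : R) (x : V), 0 <= t -> rnorm (S t x) <= rnorm x.

Definition exp_stable V (S : R -> {linear V -> V}) : Prop :=
  exists M sigma : R, [/\ 0 < M, 0 < sigma &
    forall (t : R) (x : V), 0 <= t -> rnorm (S t x) <= M * expR (- sigma * t) * rnorm x].

(* [eta] is in the resolvent set of (D, A), with [Q] = (A - eta I)^-1. *)
Definition is_resolvent V (D : set V) (A : V -> V) (eta : scalars R cplx)
    (Q : {linear V -> V}) : Prop :=
  [/\ continuous Q,
      forall x, D (Q x) /\ A (Q x) - eta *: Q x = x &
      forall x, D x -> Q (A x - eta *: x) = x].

(* [j] presents the complete space V1 as the completion of V for the norm
   x |-> |(A - eta I)^-1 x|. *)
Definition extrapolation_space V (D : set V) (A : V -> V)
    (V1 : completeNormedModType (scalars R cplx)) (j : {linear V -> V1}) : Prop :=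
  exists (eta : scalars R cplx) (Q : {linear V -> V}),
    [/\ is_resolvent D A eta Q,
        forall x, rnorm (j x) = rnorm (Q x) &
        dense (range j)].

(* Continuous injections (D with the graph norm of A) -> W -> V, the second one
   being [i] and their composite being the inclusion of D in V. *)
Definition between_domain_and_space V (D : set V) (A : V -> V)
    (W : completeNormedModType (scalars R cplx)) (i : {linear W -> V}) : Prop :=
  [/\ injective i, continuous i, D `<=` range i &
      exists c : R, forall w, D (i w) ->
        rnorm w <= c * (rnorm (i w) + rnorm (A (i w)))].

End Semigroups.

Section Duality.
Variables (R : realType) (cplx : bool).
Variable V : normedModType (scalars R cplx).

Definition dual_norm (phi : {linear V -> (scalars R cplx)^o}) : R :=
  sup [set rnorm (phi x) | x in [set x : V | rnorm x <= 1]].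

Definition duality_map (y : V) : set {linear V -> (scalars R cplx)^o} :=
  [set phi : {linear V -> (scalars R cplx)^o} |
    [/\ continuous phi, phi y = sofr cplx (rnorm y ^+ 2) &
        dual_norm phi ^+ 2 = rnorm y ^+ 2]].

End Duality.

Section Subspaces.
Variables (K : numFieldType) (V : normedModType K).

Definition linear_subspace (F : set V) : Prop :=
  F 0 /\ forall (a : K) x y, F x -> F y -> F (a *: x + y).

(* Projection of F (+) G onto F along G (0 outside F (+) G). *)
Definition proj_along (F G : set V) (z : V) : V :=
  xget 0 [set p | F p /\ G (z - p)].

End Subspaces.

Section ClosedLoop.
Variables (R : realType) (cplx : bool).
Variables (X Xm U W : completeNormedModType (scalars R cplx)).
Variables (j : {linear X -> Xm}) (i : {linear W -> X}).
Variables (B : {linear U -> Xm}) (C : {linear W -> U}).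

(* C as an operator on the subspace W of X. *)
Definition C_on (y : X) : U := C (emb_inv i y).

(* The operator _X(BC) = P_F B C, with values in F, hence in X. *)
Definition XBC (F G : set Xm) (y : X) : X :=
  emb_inv j (proj_along F G (B (C_on y))).

Definition norm_DC (y : X) : R := rnorm y + rnorm (C_on y).

Definition dom_ABC (DA : set X) : set X :=
  DA `&` [set i w | w in [set w | range j (B (C w))]].

(* (A_{-1} - m BC)|_X, where [Am] is A_{-1}, with domain [range j]. On
   [dom_ABC DA] the values of A_{-1} - m BC lie in [range j]. *)
Definition ABC (Am : Xm -> Xm) (m : R) (y : X) : X :=
  emb_inv j (Am (j y) - rscale m (B (C_on y))).

End ClosedLoop.

(* Main.v *)
Require Import Defs.
From HB Require Import structures.
From mathcomp Require Import all_boot all_order all_algebra.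
From mathcomp Require Import complex.
From mathcomp Require Import all_classical all_reals all_analysis.
From mathcomp Require Import measurable_realfun.
From mathcomp Require Import ring lra.

Set Implicit Arguments.
Unset Strict Implicit.
Unset Printing Implicit Defensive.

Import Order.TTheory GRing.Theory Num.Theory.
Import numFieldNormedType.Exports.

Local Open Scope classical_set_scope.
Local Open Scope ring_scope.

(** Fix a small gain [m] and compare, over the period [0, T], the closed-loop orbit
    [y] of an initial state [y0] with its free orbit [z]. The proof shows

      rnorm (y T) ^+ 2 * (1 + m * d) <= rnorm y0 ^+ 2 * (1 + m ^+ 2 * c),

    where [d] is the constant of [h5] and [c] does not depend on [m] or [y0]
    ([closed_loop_estimate]). For small [m] the gain, of first order, beats the
    loss, of second order, so that the closed-loop semigroup contracts at time
    [T]; a semigroup that does so decays exponentially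
    ([exp_stable_of_contraction]).

    Four estimates give this inequality. Let [u] be the observation C y.

    (1) The closed-loop orbit solves y' = A y - m BC y, hence [y t - z t] is [- m]
    times the convolution over [0, t] of the extrapolated semigroup with B u
    ([variation_of_constants]). By [h4], observing it costs at most [m * M] times
    the L1 norm of [u]; by [h3] the observation of [z] has L1 norm at most
    [M * rnorm y0]. When [m * M <= 1 / 2] the term in [u] is absorbed, and the L1
    norm of [u] is at most [2 * M * rnorm y0].

    (2) The convolution takes values in X at time [T] by [h2], and a uniform
    boundedness argument turns this qualitative fact into a bound by the L1 norm
    of the control ([admissible_bound]). As delaying the control reduces an
    earlier time to time [T], [y] and [z] stay at distance of order
    [m * rnorm y0] on the whole period ([perturbed_orbit_dist]).

    (3) As A is dissipative and A y = y' + m BC y, the integral of the pairing of y with its image under the projected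
    operator is at most [(rnorm y0 ^+ 2 - rnorm (y T) ^+ 2) / (2 * m)]. The norm of
    a general Banach space is not differentiable, and the functionals are given
    pointwise, without measurability in time; [energy_estimate] therefore
    integrates backward difference quotients and concludes for upper integrals.

    (4) By [h6], (1) and (2), the pairings along [y] and along [z] differ, after
    integration, by a term of order [m * rnorm y0 ^+ 2], and the integral of the
    latter is at least [d * rnorm (z T) ^+ 2] by [h5]. Multiplying by [2 * m] and
    replacing [z T] by [y T] with (2) gives the inequality
    ([contraction_arith]).

    These steps need C y to be continuous in time, hence y to be continuous for
    the graph norm of A and not only for that of the closed-loop generator. One
    starts from mean values of closed-loop orbits over short times ([smoothing]).
    They are images of a bounded operator Phi that commutes with the closed-loop
    semigroup and maps into the domain of A, and A Phi is bounded by the uniform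
    boundedness principle ([generator_comp_bounded]). Such states are dense, and
    the inequality passes to the limit.

    All differential calculus is done with derivatives from the right, for which
    a mean value inequality holds ([mean_value_le]); the Bochner integrals of
    convolutions follow from a fundamental theorem of calculus for uniform limits
    of step functions ([bochner_ftc]). *)

(** * Real scalars and the real-valued norm *)
Section Scalars.
Variables (R : realType) (cplx : bool).
Local Notation K := (scalars R cplx).
Implicit Types (a b : R) (z w : K).

Lemma sreD z w : sre (z + w) = sre z + sre w.
Proof. by move: z w; rewrite /sre; case: cplx => //= -[? ?] [? ?]. Qed.

Lemma sreN z : sre (- z) = - sre z.
Proof. by move: z; rewrite /sre; case: cplx => //= -[? ?]. Qed.

Lemma sreB z w : sre (z - w) = sre z - sre w.
Proof. by rewrite sreD sreN. Qed.

Lemma sofrK a : sre (sofr cplx a) = a.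
Proof. by rewrite /sre /sofr; case: cplx. Qed.

Lemma sre0 : sre (0 : K) = 0.
Proof. by rewrite /sre; case: cplx. Qed.

Lemma sofr0 : sofr cplx 0 = 0 :> K.
Proof. by rewrite /sofr; case: cplx. Qed.

Lemma sofr1 : sofr cplx 1 = 1 :> K.
Proof. by rewrite /sofr; case: cplx. Qed.

Lemma sofrD a b : sofr cplx (a + b) = sofr cplx a + sofr cplx b.
Proof.
by rewrite /sofr; case: cplx => //; apply/eqP; rewrite eq_complex /= addr0 !eqxx.
Qed.

Lemma sofrN a : sofr cplx (- a) = - sofr cplx a.
Proof.
by rewrite /sofr; case: cplx => //; apply/eqP; rewrite eq_complex /= oppr0 !eqxx.
Qed.

Lemma sofrM a b : sofr cplx (a * b) = sofr cplx a * sofr cplx b.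
Proof.
rewrite /sofr; case: cplx => //; apply/eqP; rewrite eq_complex /=.
by rewrite !mulr0 !mul0r subr0 addr0 !eqxx.
Qed.

Lemma sre_sofrM a z : sre (sofr cplx a * z) = a * sre z.
Proof.
move: z; rewrite /sre /sofr; case: cplx => //= -[x y] /=.
by rewrite mul0r subr0.
Qed.

Lemma ltr_sofr a b : (sofr cplx a < sofr cplx b) = (a < b).
Proof. by rewrite /sofr; case: cplx => //; rewrite ltcR. Qed.

Lemma norm_sofr a : `|sofr cplx a| = sofr cplx `|a|.
Proof.
rewrite /sofr; case: cplx => //.
by rewrite normc_def /= expr0n /= addr0 sqrtr_sqr.
Qed.

Lemma sreK z : 0 <= z -> sofr cplx (sre z) = z.
Proof.
move: z; rewrite /sre /sofr; case: cplx => //= -[x y].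
by rewrite lecE /= => /andP[/eqP-> _].
Qed.

Lemma ler_sre z w : z <= w -> sre z <= sre w.
Proof.
move: z w; rewrite /sre; case: cplx => //= -[x y] [x' y'].
by rewrite lecE /= => /andP[].
Qed.

Lemma ltr_sre z w : z < w -> sre z < sre w.
Proof.
move: z w; rewrite /sre; case: cplx => //= -[x y] [x' y'].
by rewrite ltcE /= => /andP[].
Qed.

Lemma ler_sre_norm z : sre z <= sre `|z|.
Proof.
move: z; rewrite /sre; case: cplx => [z|z] /=; last exact: ler_norm.
by have := normc_ge_Re z; rewrite lecE /= => /andP[_]; apply: le_trans; exact: ler_norm.
Qed.

End Scalars.

Section Rnorm.
Variables (R : realType) (cplx : bool).
Local Notation K := (scalars R cplx).
Variable V : normedModType K.
Implicit Types (x y : V) (a : R).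

Lemma rnormK x : sofr cplx (rnorm x) = `|x|.
Proof. exact: sreK. Qed.

Lemma rnorm_ge0 x : 0 <= rnorm x.
Proof. by rewrite -(@sre0 R cplx); exact: ler_sre. Qed.

Lemma rnorm0 : rnorm (0 : V) = 0.
Proof. by rewrite /rnorm normr0 sre0. Qed.

Lemma rnorm_eq0 x : rnorm x = 0 -> x = 0.
Proof. by move=> x0; apply: normr0_eq0; rewrite -rnormK x0 sofr0. Qed.

Lemma ler_rnormD x y : rnorm (x + y) <= rnorm x + rnorm y.
Proof. by rewrite /rnorm -sreD; apply: ler_sre; exact: ler_normD. Qed.

Lemma rnormN x : rnorm (- x) = rnorm x.
Proof. by rewrite /rnorm normrN. Qed.

Lemma rnormBC x y : rnorm (x - y) = rnorm (y - x).
Proof. by rewrite -rnormN opprB. Qed.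

Lemma ler_rnormB x y : rnorm (x - y) <= rnorm x + rnorm y.
Proof. by rewrite -(rnormN y); exact: ler_rnormD. Qed.

Lemma rnorm_triangle z x y : rnorm (x - y) <= rnorm (x - z) + rnorm (z - y).
Proof. by rewrite -[x - y](subrKA z); exact: ler_rnormD. Qed.

Lemma lerB_rnorm x y : rnorm x - rnorm y <= rnorm (x - y).
Proof. by rewrite lerBlDr -{1}(subrK y x); exact: ler_rnormD. Qed.

Lemma ler_dist_rnorm x y : `|rnorm x - rnorm y| <= rnorm (x - y).
Proof. by rewrite ler_norml lerB_rnorm lerNl opprB rnormBC lerB_rnorm. Qed.

Lemma rnormZ (k : K) x : rnorm (k *: x) = sre `|k| * rnorm x.
Proof. by rewrite /rnorm normrZ -{1}(@sreK R cplx `|k|)// sre_sofrM. Qed.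

Lemma rnorm_scale a x : rnorm (rscale a x) = `|a| * rnorm x.
Proof. by rewrite rnormZ norm_sofr sofrK. Qed.

Lemma rscale0r x : rscale 0 x = 0.
Proof. by rewrite /rscale sofr0 scale0r. Qed.

Lemma rscaler0 a : rscale a (0 : V) = 0.
Proof. exact: scaler0. Qed.

Lemma rscale1r x : rscale 1 x = x.
Proof. by rewrite /rscale sofr1 scale1r. Qed.

Lemma rscaleDl a b x : rscale (a + b) x = rscale a x + rscale b x.
Proof. by rewrite /rscale sofrD scalerDl. Qed.

Lemma rscaleNl a x : rscale (- a) x = - rscale a x.
Proof. by rewrite /rscale sofrN scaleNr. Qed.

Lemma rscaleBl a b x : rscale (a - b) x = rscale a x - rscale b x.
Proof. by rewrite rscaleDl rscaleNl. Qed.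

Lemma rscaleDr a x y : rscale a (x + y) = rscale a x + rscale a y.
Proof. exact: scalerDr. Qed.

Lemma rscaleNr a x : rscale a (- x) = - rscale a x.
Proof. exact: scalerN. Qed.

Lemma rscaleBr a x y : rscale a (x - y) = rscale a x - rscale a y.
Proof. exact: scalerBr. Qed.

Lemma rscaleA a b x : rscale a (rscale b x) = rscale (a * b) x.
Proof. by rewrite /rscale scalerA sofrM. Qed.

Lemma rscaleK a x : a != 0 -> rscale a (rscale a^-1 x) = x.
Proof. by move=> a0; rewrite rscaleA divff// rscale1r. Qed.

Lemma rscaleVK a x : a != 0 -> rscale a^-1 (rscale a x) = x.
Proof. by move=> a0; rewrite rscaleA mulVf// rscale1r. Qed.

(** Convergence is defined with radii in the scalar field, which may be complex;
    this reduces all limits below to inequalities between real numbers. *)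
Lemma rcvgP {T : Type} {F : set_system T} {FF : Filter F} (f : T -> V) y :
  f x @[x --> F] --> y <->
  forall e : R, 0 < e -> \forall x \near F, rnorm (f x - y) < e.
Proof.
split=> [/cvgrPdistC_lt fy e e0|fy].
  have := fy (sofr cplx e); rewrite -(sofr0 R) ltr_sofr => /(_ e0).
  by apply: filterS => x /ltr_sre; rewrite sofrK.
apply/cvgrPdistC_lt => e e0.
have /fy : 0 < sre e by rewrite -(@sre0 R cplx); exact: ltr_sre.
by apply: filterS => x; rewrite -(@ltr_sofr R cplx) rnormK (sreK (ltW e0)).
Qed.

Lemma cvg_sofr {T : Type} {F : set_system T} {FF : Filter F} (f : T -> R) (l : R) :
  f x @[x --> F] --> l -> sofr cplx (f x) @[x --> F] --> (sofr cplx l : K).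
Proof.
move=> /cvgrPdistC_lt fl; apply/cvgrPdistC_lt => e e0.
have /fl : 0 < sre e by rewrite -(@sre0 R cplx); exact: ltr_sre.
apply: filterS => x.
by rewrite -sofrN -sofrD norm_sofr -(@ltr_sofr R cplx) (sreK (ltW e0)).
Qed.

Lemma cvg_rscale {T : Type} {F : set_system T} {FF : Filter F}
    (a : T -> R) (f : T -> V) (l : R) y :
  a x @[x --> F] --> l -> f x @[x --> F] --> y ->
  rscale (a x) (f x) @[x --> F] --> rscale l y.
Proof. by move=> al fy; apply: cvgZ => //; exact: cvg_sofr. Qed.

Lemma cvg_rnorm {T : Type} {F : set_system T} {FF : Filter F} (f : T -> V) y :
  f x @[x --> F] --> y -> rnorm (f x) @[x --> F] --> rnorm y.
Proof.
move=> /rcvgP fy; apply/cvgrPdistC_lt => e /fy; apply: filterS => x.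
by apply: le_lt_trans; exact: ler_dist_rnorm.
Qed.

End Rnorm.

Section LinearBound.
Variables (R : realType) (cplx : bool).
Local Notation K := (scalars R cplx).

Lemma linear_rscale (V W : normedModType K) (f : {linear V -> W}) (a : R) x :
  f (rscale a x) = rscale a (f x).
Proof. by rewrite /rscale linearZ. Qed.

Lemma linear_cont_bound (V W : normedModType K) (f : {linear V -> W}) :
  continuous f -> exists2 c : R, 0 < c & forall x, rnorm (f x) <= c * rnorm x.
Proof.
move=> /(_ 0) /rcvgP /(_ 1 ltr01).
rewrite linear0 => /nbhs_ballP[e /= e0 he].
have se0 : 0 < sre e by rewrite -(@sre0 R cplx); exact: ltr_sre.
exists (2 / sre e) => [|x]; first by rewrite divr_gt0.
have [/rnorm_eq0->|x0] := eqVneq (rnorm x) 0.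
  by rewrite linear0 !rnorm0 mulr0.
have {}x0 : 0 < rnorm x by rewrite lt_neqAle eq_sym x0 rnorm_ge0.
have c0 : 0 < sre e / (2 * rnorm x) by rewrite divr_gt0// mulr_gt0.
have := he (rscale (sre e / (2 * rnorm x)) x).
rewrite /= -ball_normE /= sub0r normrN -rnormK rnorm_scale gtr0_norm//.
have e2 : sre e / (2 * rnorm x) * rnorm x = sre e / 2.
  by field; rewrite gt_eqF.
rewrite -[X in _ < X -> _](sreK (ltW e0)) ltr_sofr e2.
have -> : sre e / 2 < sre e by rewrite ltr_pdivrMr// ltr_pMr// ltr1n.
move=> /(_ isT).
rewrite -[X in X < 1]/(rnorm (f (rscale _ x) - 0)) subr0 linear_rscale rnorm_scale gtr0_norm// => /ltW.
rewrite mulrC -ler_pdivlMr// => /le_trans; apply.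
by rewrite div1r invf_div mulrAC.
Qed.

Lemma linear_bound_cont (V W : normedModType K) (f : {linear V -> W}) (c : R) :
  (forall x, rnorm (f x) <= c * rnorm x) -> continuous f.
Proof.
move=> fc x; apply/rcvgP => e e0.
have c0 : 0 < `|c| + 1 by rewrite ltr_wpDl.
have /rcvgP/(_ (e / (`|c| + 1))) : y @[y --> x] --> x by [].
rewrite divr_gt0// => /(_ isT); apply: filterS => y yx.
rewrite -linearB (le_lt_trans (fc _))//.
rewrite ltr_pdivlMr// mulrC in yx; apply: le_lt_trans yx.
rewrite ler_wpM2r ?rnorm_ge0// (le_trans (ler_norm _))// lerDl.
exact: ler01.
Qed.

End LinearBound.

(** * Uniform boundedness by a gliding hump *)
Section GlidingHump.
Variables (R : realType) (E : zmodType) (P : E -> Prop) (p : E -> R).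
Variables (I : Type) (Lam : I -> E -> R) (c : I -> R).
Hypothesis P0 : P 0.
Hypothesis PD : forall a b, P a -> P b -> P (a + b).
Hypothesis PN : forall a, P a -> P (- a).
Hypothesis p0 : p 0 = 0.
Hypothesis c_ge0 : forall i, 0 <= c i.
Hypothesis LamD : forall i a b, P a -> P b -> Lam i (a + b) <= Lam i a + Lam i b.
Hypothesis LamN : forall i a, P a -> Lam i (- a) = Lam i a.
Hypothesis Lam_le : forall i a, P a -> Lam i a <= c i * p a.

(** A uniform boundedness principle in which completeness is replaced by the only
    consequence of it that matters: the [Lam i] stay bounded along the partial
    sums of geometrically small series. If no bound held near zero, one could
    choose the terms one after the other so that [Lam (i k)] exceeds [k] at the
    sum of the first [k] terms, each later term being so small compared with
    [c (i k)] that all of them together do not spoil this. It is applied to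
    vectors of a Banach space and, with an L1 norm for [p], to controls. *)
Lemma gliding_hump :
  (forall a : nat -> E, (forall k, P (a k)) -> (forall k, p (a k) <= 3^-1 ^+ k) ->
     exists b : R, forall i, exists m0 : nat, forall m, (m0 <= m)%N ->
       Lam i (\sum_(k < m) a k) <= b) ->
  exists r b : R, 0 < r /\ forall i a, P a -> p a <= r -> Lam i a <= b.
Proof.
move=> H; apply: contrapT => nH.
have big (r b : R) : 0 < r -> exists ia : I * E, [/\ P ia.2, p ia.2 <= r & b < Lam ia.1 ia.2].
  move=> r0; apply: contrapT => nex; apply: nH; exists r, b; split => // i a Pa par.
  by rewrite leNgt; apply/negP => ba; apply: nex; exists (i, a).
have step (s : E * R * R) : exists ia : I * E, P s.1.1 -> 0 < s.1.2 ->
    [/\ P ia.2, p ia.2 <= s.1.2 & s.2 < Lam ia.1 (s.1.1 + ia.2)].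
  case: s => -[x r] b /=.
  have [r0|nr0] := pselect (0 < r); last first.
    by have [ia _] := big 1 0 ltr01; exists ia => _ /nr0.
  have [[i a] /= [Pa par bLa]] := big r (b + b) r0.
  have [bx|xb] := ltP b (Lam i x).
    by exists (i, 0) => Px _ /=; rewrite addr0 p0; split => //; exact: ltW.
  exists (i, a) => Px _ /=; split => //.
  have := LamD i (PD Px Pa) (PN Px); rewrite LamN// addrAC subrr add0r => aL.
  by have := lt_le_trans bLa (le_trans aL (lerD (lexx _) xb)); rewrite ltrD2r.
have [F HF] := choice step.
(* The state is the partial sum together with the size allowed for its next
   term; after the index i is used, sizes shrink by 3 (1 + |c i|), so that all
   later terms together change Lam i by at most 1. *)
pose next (k : nat) (s : E * R) : E * R :=
  let ia := F (s, k%:R) in (s.1 + ia.2, s.2 / (3 * (1 + c ia.1))).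
pose st := fix st k := if k is k'.+1 then next k' (st k') else ((0 : E), (1 : R)).
pose ia k := F (st k, k%:R).
have cpos i : 0 < 3 * (1 + c i) :> R by rewrite mulr_gt0// ltr_wpDr.
have inv k : [/\ P (st k).1, 0 < (st k).2 & (st k).2 <= 3^-1 ^+ k].
  elim: k => [|k [Pk rk rk3]]; first by split => //=; rewrite expr0.
  have [Pa _ _] := HF (st k, k%:R) Pk rk.
  split => /=; first exact: PD.
    by rewrite divr_gt0.
  rewrite exprSr ler_pM// ?invr_ge0 ?(ltW (cpos _)) ?(ltW rk)//.
  by rewrite lef_pV2 ?posrE// ler_pMr// lerDl.
have step_ia k : [/\ P (ia k).2, p (ia k).2 <= (st k).2 &
    k%:R < Lam (ia k).1 (st k.+1).1].
  by have [Pk rk _] := inv k; have [? ? ?] := HF (st k, k%:R) Pk rk; split.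
have sumE m : \sum_(k < m) (ia k).2 = (st m).1.
  by elim: m => [|m IH]; rewrite ?big_ord0// big_ord_recr /= IH.
have [|k|b Hb] := H (fun k => (ia k).2).
- by move=> k; have [] := step_ia k.
- by have [_ pk _] := step_ia k; have [_ _ rk] := inv k; apply: le_trans pk rk.
pose k := (Num.truncn (`|b| + 1)).+1.
have kb : b + 1 < k%:R.
  by apply: le_lt_trans (truncnS_gt _); rewrite lerD2r ler_norm.
have [m0 Hm] := Hb (ia k).1.
have tail m : Lam (ia k).1 ((st (k.+1 + m)%N).1 - (st k.+1).1) <=
    c (ia k).1 * (3 / 2 * ((st k.+1).2 - (st (k.+1 + m)%N).2)).
  elim: m => [|m IH].
    rewrite addn0 !subrr !mulr0; have := Lam_le (ia k).1 P0.
    by rewrite p0 mulr0.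
  rewrite addnS; set q := (k.+1 + m)%N in IH *.
  have [Pq rq _] := inv q; have [Pa pa _] := step_ia q.
  have [Pk1 _ _] := inv k.+1.
  have -> : (st q.+1).1 - (st k.+1).1 = ((st q).1 - (st k.+1).1) + (ia q).2.
    by rewrite /= addrAC.
  apply: (le_trans (LamD _ _ Pa)); first exact: (PD _ (PN _)).
  have rq1 : (st q.+1).2 <= (st q).2 / 3.
    rewrite /= ler_pM2l// lef_pV2 ?posrE// ler_pMr// lerDl//.
  apply: (le_trans (lerD IH (Lam_le _ Pa))).
  have pa' : p (ia q).2 <= 3 / 2 * ((st q).2 - (st q.+1).2) by lra.
  have := ler_wpM2l (c_ge0 (ia k).1) pa'.
  lra.
have m0k : (m0 <= k.+1 + m0)%N by rewrite leq_addl.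
have [_ _ kL] := step_ia k.
have [Pk _ _] := inv k.+1; have [Pm _ _] := inv (k.+1 + m0)%N.
have [_ rk rk3] := inv k; have [_ rm _] := inv (k.+1 + m0)%N.
have := Hm _ m0k; rewrite sumE => Lb.
have tail1 : Lam (ia k).1 ((st (k.+1 + m0)%N).1 - (st k.+1).1) <= 1.
  apply: (le_trans (tail m0)).
  have rk1 : (st k).2 <= 1.
    by apply: (le_trans rk3); rewrite exprn_ile1// invf_le1// ler1n.
  have : c (ia k).1 * (st k.+1).2 <= 3^-1.
    have -> : c (ia k).1 * (st k.+1).2 =
        (st k).2 * (c (ia k).1 / (3 * (1 + c (ia k).1))) by rewrite mulrCA.
    apply: (@le_trans _ _ (1 * 3^-1)); last by rewrite mul1r.
    apply: ler_pM => //; first exact: ltW.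
      by rewrite divr_ge0// ltW.
    by rewrite ler_pdivrMr// mulrA mulVf ?mul1r ?lerDr// pnatr_eq0.
  have : 0 <= c (ia k).1 * (st (k.+1 + m0)%N).2 by rewrite mulr_ge0// ltW.
  lra.
have Pmk := PD Pm (PN Pk); have := LamD (ia k).1 Pm (PN Pmk).
rewrite LamN// opprB addrCA subrr addr0.
lra.
Qed.
End GlidingHump.

(** * Derivatives from the right and the mean value inequality *)
Section RightDerivative.
Variables (R : realType) (cplx : bool).
Local Notation K := (scalars R cplx).
Variable V : normedModType K.

(** Derivatives from the right are all that a semigroup provides directly, and by
    the mean value inequality below they determine a continuous function up to a
    constant. *)
Definition rderiv (f : R -> V) (t : R) (v : V) : Prop :=
  rscale h^-1 (f (t + h) - f t) @[h --> 0^'+] --> v.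

Lemma rderivP (f : R -> V) t v : rderiv f t v <-> forall e : R, 0 < e ->
  exists2 d : R, 0 < d & forall h, 0 < h < d ->
    rnorm (f (t + h) - f t - rscale h v) <= e * h.
Proof.
split=> [/rcvgP fv e /fv|fv].
  move=> /nbhs_ballP[d /= d0 hd]; exists d => // h /andP[h0 hd'].
  have := hd h; rewrite /ball /= sub0r normrN gtr0_norm// => /(_ hd' h0) /ltW.
  have -> : f (t + h) - f t - rscale h v =
      rscale h (rscale h^-1 (f (t + h) - f t) - v).
    by rewrite rscaleBr rscaleK// gt_eqF.
  by rewrite rnorm_scale gtr0_norm// mulrC ler_pM2r.
apply/rcvgP => e e0; have e20 : 0 < e / 2 by rewrite divr_gt0.
have [d d0 hd] := fv _ e20.
apply/nbhs_ballP; exists d => //= h; rewrite /ball /= sub0r normrN => hd' h0.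
rewrite gtr0_norm// in hd'.
have -> : rscale h^-1 (f (t + h) - f t) - v =
    rscale h^-1 (f (t + h) - f t - rscale h v).
  by rewrite [in RHS]rscaleBr rscaleVK// gt_eqF.
rewrite rnorm_scale gtr0_norm ?invr_gt0// mulrC.
rewrite ltr_pdivrMr// (le_lt_trans (hd _ _)) ?h0//.
by rewrite ltr_pM2r// ltr_pdivrMr// ltr_pMr// ltr1n.
Qed.

Lemma rderivB (f g : R -> V) t v w :
  rderiv f t v -> rderiv g t w -> rderiv (fun s => f s - g s) t (v - w).
Proof.
move=> fv gw; rewrite /rderiv.
under eq_fun do rewrite opprD addrACA -opprD rscaleBr.
exact: cvgB.
Qed.

Lemma rderiv_lin (a : V) t : rderiv (fun s => rscale s a) t a.
Proof.
apply/rderivP => e e0; exists 1 => // h /andP[h0 _].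
by rewrite -rscaleBl addrAC subrr add0r subrr rnorm0 mulr_ge0// ltW.
Qed.

(** A continuous function with right derivatives bounded by [L] is
    [L]-Lipschitz. The set of [t] such that the bound with slope [L + e] holds
    up to [t] contains its supremum by continuity, and the right derivative at
    the supremum would push it further if it were less than [b]. *)
Lemma mean_value_le (f : R -> V) (a b L : R) : a <= b ->
  continuous f ->
  (forall t, a <= t < b -> exists2 v, rderiv f t v & rnorm v <= L) ->
  rnorm (f b - f a) <= L * (b - a).
Proof.
move=> ab cf df.
have [->|aNb] := eqVneq a b; first by rewrite !subrr rnorm0 mulr0.
have {aNb}ab' : a < b by rewrite lt_neqAle aNb.
apply/ler_addgt0Pr => e0 e00.
have ba0 : 0 < b - a by rewrite subr_gt0.
pose e := e0 / (b - a); have e_gt0 : 0 < e by rewrite divr_gt0.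
have -> : L * (b - a) + e0 = (L + e) * (b - a).
  by rewrite mulrDl /e divfK// gt_eqF.
pose g t := rnorm (f t - f a) - (L + e) * (t - a).
have cg : continuous g.
  move=> t; apply: cvgB; first by apply: cvg_rnorm; apply: cvgB; [exact: cf|exact: cvg_cst].
  apply: cvgM; first exact: cvg_cst.
  by apply: cvgB; [exact: cvg_id|exact: cvg_cst].
pose E := [set t | a <= t <= b /\ forall s, a <= s <= t -> g s <= 0].
have Ea : E a.
  split; first by rewrite lexx ltW.
  by move=> s; rewrite -eq_le => /eqP <-; rewrite /g !subrr rnorm0 mulr0 subrr.
have supE : has_sup E.
  by split; [exists a|exists b => t [/andP[]]].
pose c := sup E.
have ac : a <= c by exact: (ub_le_sup supE.2 Ea).
have cb : c <= b by apply: ge_sup; [exists a|move=> t [/andP[]]].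
have lt_c s : a <= s -> s < c -> g s <= 0.
  move=> as_ sc; have cs0 : 0 < c - s by rewrite subr_gt0.
  have [t [_ Et]] := sup_adherent cs0 supE.
  by rewrite -/c opprB addrCA subrr addr0 => st; apply: Et; rewrite as_ ltW.
have gc : g c <= 0.
  rewrite leNgt; apply/negP => gc0.
  have [ca|ac'] := eqVneq c a.
    by move: gc0; rewrite ca /g !subrr rnorm0 mulr0 subrr ltxx.
  have {}ac' : a < c by rewrite lt_neqAle eq_sym ac' ac.
  have := cg c; move=> /cvgrPdist_lt /(_ _ gc0) /nbhs_ballP[d /= d0 hd].
  pose s := Num.max a (c - d / 2).
  have d20 : 0 < d / 2 by rewrite divr_gt0.
  have sc : s < c by rewrite gt_max ac' ltrBlDr ltrDl.
  have := hd s; rewrite /ball /= gtr0_norm ?subr_gt0//.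
  have -> : c - s < d.
    rewrite ltrBlDl -ltrBlDr lt_max; apply/orP; right.
    by rewrite ltrD2l ltrN2 ltr_pdivrMr// ltr_pMr// ltr1n.
  move=> /(_ isT); have := lt_c s; rewrite le_max lexx sc => /(_ isT isT) gs.
  by rewrite gtr0_norm ?subr_gt0 ?(le_lt_trans gs)// ltrBlDr ltrDl ltNge gs.
have E_c s : a <= s <= c -> g s <= 0.
  by move=> /andP[as_]; rewrite le_eqVlt => /predU1P[->//|]; exact: lt_c.
have [cb'|cb'] := eqVneq c b.
  by have := gc; rewrite cb' /g subr_le0.
have {}cb' : c < b by rewrite lt_neqAle cb' cb.
have [|v /rderivP dv vL] := df c; first by rewrite ac cb'.
have [d d0 hd] := dv _ e_gt0.
pose h0 := Num.min (d / 2) (b - c).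
have h00 : 0 < h0 by rewrite lt_min divr_gt0//= subr_gt0.
have h0d : h0 < d.
  by rewrite gt_min; apply/orP; left; rewrite ltr_pdivrMr// ltr_pMr// ltr1n.
have Ech : E (c + h0).
  split.
    rewrite (le_trans ac) ?lerDl ?(ltW h00)//= addrC -lerBrDr.
    by rewrite ge_min lexx orbT.
  move=> s /andP[as_ sch].
  have [sc|cs] := leP s c; first by apply: E_c; rewrite as_.
  have hs : 0 < s - c < d.
    by rewrite subr_gt0 cs /= (le_lt_trans _ h0d)// lerBlDl.
  have := hd _ hs; rewrite subrKC => fs.
  have := rnorm_triangle (f c) (f s) (f a).
  have : rnorm (f s - f c) <= rnorm (f s - f c - rscale (s - c) v) + rnorm (rscale (s - c) v).
    by rewrite -{1}[f s - f c](subrK (rscale (s - c) v)); exact: ler_rnormD.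
  rewrite rnorm_scale gtr0_norm ?subr_gt0//.
  have : (s - c) * rnorm v <= (s - c) * L by rewrite ler_pM2l// subr_gt0.
  by move: gc fs; rewrite /g; lra.
have := ub_le_sup supE.2 Ech; rewrite -/c gerDl leNgt h00 //.
Qed.

Lemma rderiv0_const (f : R -> V) (a b : R) : a <= b -> continuous f ->
  (forall t, a <= t < b -> rderiv f t 0) -> f b = f a.
Proof.
move=> ab cf df; apply/eqP; rewrite -subr_eq0; apply/eqP/rnorm_eq0/eqP.
rewrite eq_le rnorm_ge0 andbT -(mul0r (b - a)).
by apply: mean_value_le => // t /df d0; exists 0; rewrite ?rnorm0.
Qed.

(** Heine's theorem on a segment, by contradiction: bad pairs at distances that
    tend to zero cluster at a point of the segment, where [f] is continuous. *)
Lemma unif_cont_segment (f : R -> V) (a b e : R) : continuous f -> 0 < e ->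
  exists2 d : R, 0 < d & forall s t, a <= s <= b -> a <= t <= b ->
    `|s - t| < d -> rnorm (f s - f t) < e.
Proof.
move=> cf e0; have := @segment_compact R a b; rewrite compact_near_coveringP.
move=> /(_ _ (0^'+ : set_system R) (fun d t => forall s, `|s - t| < d ->
   rnorm (f s - f t) < e) _).
case.
- move=> t _; have e20 : 0 < e / 2 by rewrite divr_gt0.
  have /rcvgP/(_ _ e20) := cf t.
  move=> /nbhs_ballP[r /= r0 hr].
  have r20 : 0 < r / 2 by rewrite divr_gt0.
  exists (ball t (r / 2), [set d | d < r / 2]) => /=.
    split; first by apply: nbhsx_ballx.
    by apply: nbhs_right_lt.
  move=> [x d] [/= tx dr] s sx.
  have h1 : rnorm (f s - f t) < e / 2.
    apply: hr; apply: (@le_ball _ _ t (r / 2 + r / 2)); first by rewrite -splitr.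
    by apply: ball_triangle tx _; rewrite /ball /= distrC (lt_trans sx).
  have h2 : rnorm (f x - f t) < e / 2.
    by apply: hr; apply: le_ball tx; rewrite ler_pdivrMr// ler_pMr// ler1n.
  rewrite (le_lt_trans (rnorm_triangle (f t) _ _))// [ltRHS]splitr ltrD//.
  by rewrite rnormBC.
- move=> d [/= d0 hd].
  exists (d / 2) => [|s t _ tab st]; first by rewrite divr_gt0.
  apply: (hd (d / 2)) => //=; last by rewrite divr_gt0.
  by rewrite sub0r normrN gtr0_norm ?divr_gt0// ltr_pdivrMr// ltr_pMr// ltr1n.
Qed.

Lemma bounded_segment (f : R -> V) (a b : R) : continuous f ->
  exists2 c : R, 0 < c & forall t, a <= t <= b -> rnorm (f t) <= c.
Proof.
move=> cf; have [ab|ba] := leP a b; last first.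
  by exists 1 => // t /andP[/le_trans h /h]; rewrite leNgt ba.
have crf : {within `[a, b], continuous (fun t => rnorm (f t))}.
  by apply: continuous_subspaceT => t; apply: cvg_rnorm; exact: cf.
have [c _ hc] := EVT_max ab crf.
exists (rnorm (f c) + 1) => [|t tab]; first by rewrite ltr_wpDl ?rnorm_ge0.
by rewrite ler_wpDr// hc// in_itv.
Qed.

End RightDerivative.

(** * Integrals of nonnegative functions without measurability *)
Section LowerIntegral.
Import HBNNSimple.
Context d (T : measurableType d) (R : realType).
Variable mu : {measure set T -> \bar R}.
Implicit Types (D N : set T) (f g : T -> \bar R).

(** The integral of a nonnegative function is a supremum over simple functions
    below it, hence monotone even without measurability. *)
Lemma ge0_le_integral_nomeas D f g : (forall x, D x -> (0 <= f x)%E) ->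
  (forall x, D x -> (f x <= g x)%E) ->
  (\int[mu]_(x in D) f x <= \int[mu]_(x in D) g x)%E.
Proof.
move=> f0 fg; rewrite integral_mkcond [leRHS]integral_mkcond.
have f0' x : (0 <= (f \_ D) x)%E by apply: erestrict_ge0.
have fg' x : ((f \_ D) x <= (g \_ D) x)%E by apply: lee_restrict.
rewrite ge0_integralTE// ge0_integralTE; last by move=> x; exact: le_trans (fg' x).
apply: ge_ereal_sup => _ /= [h hf <-]; apply: ereal_sup_ubound.
by exists h => //= x; exact: le_trans (hf x) (fg' x).
Qed.

Lemma ge0_subset_integral_nomeas D D' f : D' `<=` D ->
  (forall x, D x -> (0 <= f x)%E) ->
  (\int[mu]_(x in D') f x <= \int[mu]_(x in D) f x)%E.
Proof.
move=> DD f0; rewrite integral_mkcond [leRHS]integral_mkcond.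
apply: ge0_le_integral_nomeas => x _.
  by apply: erestrict_ge0 => y /DD /f0.
rewrite !patchE; case: ifPn => [/set_mem/DD xD|_]; first by rewrite mem_set.
by case: ifPn => // /set_mem /f0.
Qed.

(** The simple functions below [f] are measurable, so a null set can be removed
    from the domain of each of them. *)
Lemma ge0_integral_setD_null D N f : measurable N -> mu N = 0%E ->
  (forall x, D x -> (0 <= f x)%E) ->
  (\int[mu]_(x in D) f x = \int[mu]_(x in D `\` N) f x)%E.
Proof.
move=> mN N0 f0; apply/eqP; rewrite eq_le; apply/andP; split; last first.
  by apply: ge0_subset_integral_nomeas => // x [].
rewrite integral_mkcond ge0_integralTE; last by move=> x; exact: erestrict_ge0.
apply: ge_ereal_sup => _ /= [h hf <-].
rewrite -integralT_nnsfun.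
pose h' : T -> R := h.
have mh : measurable_fun setT (EFin \o h') by exact/measurable_EFinP.
have h0 x : setT x -> (0 <= (EFin \o h') x)%E by rewrite lee_fin fun_ge0.
rewrite -[leLHS]/(\int[mu]_x (EFin \o h') x)%E.
rewrite (ge0_negligible_integral mN measurableT mh h0 N0).
rewrite integral_mkcond [leRHS]integral_mkcond.
apply: ge0_le_integral_nomeas => x _.
  by apply: erestrict_ge0 => y _; rewrite lee_fin.
have := hf x; rewrite !patchE.
have [/set_mem xD|/negP xD] := boolP (x \in D).
  have [/set_mem[_ xN]|xN _] := boolP (x \in setT `\` N).
    by rewrite mem_set.
  by case: ifPn => // _; exact: f0.
move=> hx; case: ifPn => [_|_]; last first.
  by case: ifPn => // /set_mem[/f0].
by rewrite ifF//; apply/negP => /set_mem[/mem_set].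
Qed.

End LowerIntegral.

(** * Step functions *)
Section StepFunctions.
Variables (R : realType) (cplx : bool).
Local Notation K := (scalars R cplx).
Local Notation mu := (@lebesgue_measure R).
Variable V : normedModType K.
Implicit Types (D : set R) (s : step_fun V).

Let Ssum n (E : 'I_n -> set R) (v : 'I_n -> V) x := \sum_i rscale (\1_(E i) x) (v i).

Lemma rnorm_sum_indic_measurable n (E : 'I_n -> set R) (v : 'I_n -> V) c D :
  measurable D -> (forall i, measurable (E i)) ->
  measurable_fun D (fun x => rnorm (c + Ssum E v x)).
Proof.
elim: n E v c D => [|n IH] E v c D mD mE.
  by apply: eq_measurable_fun (measurable_cst (rnorm c)) => x _; rewrite /Ssum big_ord0 addr0.
have mDE : measurable (D `&` E ord0) by exact: measurableI.
have mDE' : measurable (D `\` E ord0) by exact: measurableD.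
rewrite -(setUIDK D (E ord0)); apply/measurable_funU => //; split.
  apply: eq_measurable_fun (IH (E \o lift ord0) (v \o lift ord0) (c + v ord0) _ mDE _) => [x|i].
    move=> /set_mem[_ xE]; rewrite /Ssum big_ord_recl indicE mem_set//.
    by rewrite rscale1r addrA.
  exact: mE.
apply: eq_measurable_fun (IH (E \o lift ord0) (v \o lift ord0) c _ mDE' _) => [x|i].
  move=> /set_mem[_ xE]; rewrite /Ssum big_ord_recl indicE memNset//.
  by rewrite rscale0r add0r.
exact: mE.
Qed.

(** The sets of a step function may overlap. Splitting [D] along the first of
    them, and adding its value to the constant [c] on one of the two parts,
    removes one set from the sum without rewriting it on disjoint sets. *)
Lemma rnorm_sum_indic_integral n (E : 'I_n -> set R) (v : 'I_n -> V) c D :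
  measurable D -> (mu D < +oo)%E -> (forall i, measurable (E i)) ->
  ((rnorm (rscale (fine (mu D)) c + \sum_i rscale (fine (mu (E i `&` D))) (v i)))%:E
   <= \int[mu]_(x in D) (rnorm (c + Ssum E v x))%:E)%E.
Proof.
elim: n E v c D => [|n IH] E v c D mD finD mE.
  rewrite big_ord0 addr0 rnorm_scale ger0_norm ?fine_ge0//.
  under eq_integral do rewrite /Ssum big_ord0 addr0.
  rewrite (_ : (fun=> _) = cst (rnorm c)%:E)// integral_cst//.
  by rewrite muleC EFinM fineK// ge0_fin_numE.
have mDE : measurable (D `&` E ord0) by exact: measurableI.
have mDE' : measurable (D `\` E ord0) by exact: measurableD.
have finS D' : D' `<=` D -> measurable D' -> (mu D' < +oo)%E.
  by move=> DD mD'; apply: le_lt_trans finD; apply: le_measure; rewrite ?inE.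
have finDE := finS _ (@subIsetl _ D (E ord0)) mDE.
have finDE' := finS _ (@subDsetl _ D (E ord0)) mDE'.
have fnum D' : measurable D' -> (mu D' < +oo)%E -> mu D' \is a fin_num.
  by move=> _ ?; rewrite ge0_fin_numE.
rewrite -[in leRHS](setUIDK D (E ord0)) ge0_integral_setU//; last 3 first.
- apply/measurable_EFinP; rewrite setUIDK.
  exact: rnorm_sum_indic_measurable.
- by move=> x _; rewrite lee_fin rnorm_ge0.
- by apply/disj_setPS => x [[_ ?] [_]].
have I1 := IH (E \o lift ord0) (v \o lift ord0) (c + v ord0) _ mDE finDE (fun i => mE _).
have I2 := IH (E \o lift ord0) (v \o lift ord0) c _ mDE' finDE' (fun i => mE _).
have -> : (\int[mu]_(x in D `&` E ord0) (rnorm (c + Ssum E v x))%:E =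
  \int[mu]_(x in D `&` E ord0) (rnorm (c + v ord0 + Ssum (E \o lift ord0) (v \o lift ord0) x))%:E)%E.
  apply: eq_integral => x /set_mem[_ xE].
  by rewrite /Ssum big_ord_recl indicE mem_set// rscale1r addrA.
have -> : (\int[mu]_(x in D `\` E ord0) (rnorm (c + Ssum E v x))%:E =
  \int[mu]_(x in D `\` E ord0) (rnorm (c + Ssum (E \o lift ord0) (v \o lift ord0) x))%:E)%E.
  apply: eq_integral => x /set_mem[_ xE].
  by rewrite /Ssum big_ord_recl indicE memNset// rscale0r add0r.
apply: le_trans (leeD I1 I2); rewrite -EFinD lee_fin.
apply: le_trans (ler_rnormD _ _); rewrite le_eqVlt; apply/orP; left; apply/eqP.
congr rnorm; rewrite addrACA -big_split /= big_ord_recl addrA; congr (_ + _).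
  have -> : fine (mu D) = fine (mu (D `\` E ord0)) + fine (mu (D `&` E ord0)).
    rewrite -fineD ?fnum//; congr fine.
    exact: (@measureDI _ _ _ mu D (E ord0) mD (mE _)).
  by rewrite (setIC (E ord0)) rscaleDl rscaleDr -addrA addrC.
apply: eq_bigr => i _; rewrite -rscaleDl; congr (rscale _ _).
have finE D' : D' `<=` D -> measurable D' -> mu (E (lift ord0 i) `&` D') \is a fin_num.
  move=> DD mD'; apply: fnum; first exact: measurableI.
  by apply: finS; [move=> x [_ /DD]|exact: measurableI].
rewrite -fineD; [|exact: finE|exact: finE].
have m1 : measurable (E (lift ord0 i) `&` (D `&` E ord0)) by exact: measurableI.
have m2 : measurable (E (lift ord0 i) `&` (D `\` E ord0)) by exact: measurableI.
have uni : (E (lift ord0 i) `&` (D `&` E ord0)) `|` (E (lift ord0 i) `&` (D `\` E ord0)) = E (lift ord0 i) `&` D.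
  by rewrite -setIUr setUIDK.
have dis : (E (lift ord0 i) `&` (D `&` E ord0)) `&` (E (lift ord0 i) `&` (D `\` E ord0)) = set0.
  by rewrite -subset0 => x [[_ [_ ?]] [_ []]].
congr fine; rewrite -uni; exact: (measureU mu m1 m2 dis).
Qed.

Lemma rnorm_step_measurable D s : measurable D ->
  measurable_fun D (fun x => rnorm (step_eval s x)).
Proof.
move=> mD.
have := @rnorm_sum_indic_measurable _ (@sf_set _ _ _ s) (@sf_val _ _ _ s) 0 D mD
  (@sf_measurable _ _ _ s).
by under eq_fun do rewrite add0r.
Qed.

Lemma rnorm_step_int D s : measurable D -> (mu D < +oo)%E ->
  ((rnorm (step_int D s))%:E <= norm_L1 D (step_eval s))%E.
Proof.
move=> mD finD.
have := @rnorm_sum_indic_integral _ (@sf_set _ _ _ s) (@sf_val _ _ _ s) 0 D mD finD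
  (@sf_measurable _ _ _ s).
by rewrite rscaler0 add0r; under eq_integral do rewrite add0r.
Qed.

Lemma step_sub s s' : exists2 t : step_fun V,
  forall x, step_eval t x = step_eval s x - step_eval s' x &
  forall D, step_int D t = step_int D s - step_int D s'.
Proof.
pose E i := match fintype.split i with inl a => @sf_set _ _ _ s a | inr b => @sf_set _ _ _ s' b end.
pose v i := match fintype.split i with inl a => @sf_val _ _ _ s a | inr b => - @sf_val _ _ _ s' b end.
have mE i : measurable (E i).
  by rewrite /E; case: fintype.split => a; exact: sf_measurable.
have fE i : (mu (E i) < +oo)%E.
  by rewrite /E; case: fintype.split => a; exact: sf_finite.
have splitl m n (i : 'I_m) : fintype.split (lshift n i) = inl i by rewrite -(unsplitK (inl i)).
have splitr m n (i : 'I_n) : fintype.split (rshift m i) = inr i by rewrite -(unsplitK (inr i)).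
exists (StepFun v mE fE) => [x|D]; rewrite /step_eval /step_int /= big_split_ord /=;
  congr (_ + _); rewrite -?sumrN; apply: eq_bigr => i _;
  by rewrite /E /v ?splitl ?splitr ?rscaleNr.
Qed.

Lemma step_restrict (E : set R) s : measurable E -> exists2 t : step_fun V,
  forall x, step_eval t x = rscale (\1_E x) (step_eval s x) &
  forall D, E `<=` D -> step_int E t = step_int D t.
Proof.
move=> mE.
have mE' i : measurable (@sf_set _ _ _ s i `&` E) by apply: measurableI => //; exact: sf_measurable.
have fE i : (mu (@sf_set _ _ _ s i `&` E) < +oo)%E.
  apply: le_lt_trans (sf_finite i); apply: le_measure.
  - by rewrite inE; exact: mE'.
  - by rewrite inE; exact: sf_measurable.
  - exact: subIsetl.
exists (StepFun (@sf_val _ _ _ s) mE' fE) => [x|D ED]; last first.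
  by apply: eq_bigr => i _ /=; rewrite -!setIA setIid (setIidl ED).
rewrite /step_eval /rscale scaler_sumr; apply: eq_bigr => i _ /=.
by rewrite [RHS]rscaleA indicI /= mulrC.
Qed.

Lemma step_indic (E : set R) (v : V) : measurable E -> (mu E < +oo)%E ->
  exists2 t : step_fun V, forall x, step_eval t x = rscale (\1_E x) v &
  forall D, step_int D t = rscale (fine (mu (E `&` D))) v.
Proof.
move=> mE fE; exists (@StepFun R cplx V 1 (fun=> E) (fun=> v) (fun=> mE) (fun=> fE)).
  by move=> x; rewrite /step_eval big_ord1.
by move=> D; rewrite /step_int big_ord1.
Qed.

Lemma step_zero : exists t : step_fun V, forall x, step_eval t x = 0.
Proof.
have f0 : (mu set0 < +oo)%E by rewrite measure0.
have [t tE _] := step_indic 0 measurable0 f0.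
by exists t => x; rewrite tE rscaler0.
Qed.

End StepFunctions.

(** * Bochner integrals *)
Section RealSequences.
Variable R : realType.

Lemma cvge0P (u : nat -> \bar R) : (forall n, (0 <= u n)%E) ->
  u n @[n --> \oo] --> 0%:E <->
  forall e : R, 0 < e -> \forall n \near \oo, (u n <= e%:E)%E.
Proof.
move=> u0; split=> [/fine_cvgP[finu /cvgrPdist_le uc] e /uc|uc].
  apply: filterS2 finu => n finu; rewrite sub0r normrN => ue.
  by rewrite -(fineK finu) lee_fin (le_trans (ler_norm _)).
have finu : \forall n \near \oo, u n \is a fin_num.
  by apply: filterS (uc 1 ltr01) => n un; rewrite ge0_fin_numE// (le_lt_trans un)// ltry.
apply/fine_cvgP; split => //; apply/cvgrPdist_le => e /uc.
apply: filterS2 finu => n finu une.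
by rewrite sub0r normrN /= ger0_norm ?fine_ge0// -lee_fin fineK.
Qed.

Lemma cvg_invS : (fun n : nat => n.+1%:R^-1 : R) n @[n --> \oo] --> 0.
Proof. exact: (@cvg_harmonic R). Qed.

End RealSequences.

Section AlmostEverywhere.
Variable R : realType.
Implicit Types P Q : R -> Prop.

Lemma ae_impl P Q : (forall x, P x -> Q x) ->
  {ae @lebesgue_measure R, forall x, P x} -> {ae @lebesgue_measure R, forall x, Q x}.
Proof.
move=> PQ [N [mN N0 PN]]; exists N; split => //; apply: subset_trans PN => x /= nQ Px.
by apply: nQ; exact: PQ.
Qed.

Lemma ae_and P Q : {ae @lebesgue_measure R, forall x, P x} ->
  {ae @lebesgue_measure R, forall x, Q x} ->
  {ae @lebesgue_measure R, forall x, P x /\ Q x}.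
Proof.
move=> [N1 [m1 N10 PN1]] [N2 [m2 N20 QN2]]; exists (N1 `|` N2); split.
- exact: measurableU.
- by apply/eqP; rewrite measureU0//; exact/eqP.
move=> x /= nPQ; have [Px|nPx] := pselect (P x); last by left; apply: PN1.
by right; apply: QN2 => /= Qx; apply: nPQ.
Qed.

End AlmostEverywhere.

Section Completeness.
Variables (R : realType) (cplx : bool).
Variable V : completeNormedModType (scalars R cplx).

Lemma rcauchy_cvg (v : nat -> V) (e : nat -> R) : e n @[n --> \oo] --> 0 ->
  (forall k l, rnorm (v k - v l) <= e k + e l) -> exists l : V, v n @[n --> \oo] --> l.
Proof.
move=> /cvgrPdist_lt e0 ve.
have : cauchy (v n @[n --> \oo]).
  apply: cauchy_exP => r r0.
  have sr0 : 0 < sre r by rewrite -(@sre0 R cplx); exact: ltr_sre.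
  have sr20 : 0 < sre r / 2 by rewrite divr_gt0.
  have [N _ hN] := e0 _ sr20.
  exists (v N); exists N => // n /= Nn.
  rewrite -ball_normE /= -rnormK -(sreK (ltW r0)) ltr_sofr.
  apply: le_lt_trans (ve _ _) _; rewrite [ltRHS]splitr ltrD//.
    by apply: le_lt_trans (hN N (leqnn _)); rewrite sub0r normrN ler_norm.
  by apply: le_lt_trans (hN n Nn); rewrite sub0r normrN ler_norm.
by move=> /cauchy_cvgP /cvg_ex.
Qed.

End Completeness.

Section NormL1.
Variables (R : realType) (cplx : bool).
Local Notation K := (scalars R cplx).
Local Notation mu := (@lebesgue_measure R).
Variable V : normedModType K.
Implicit Types (D : set R) (f g h : R -> V) (s : step_fun V).

Lemma norm_L1_ge0 D f : (0 <= norm_L1 D f)%E.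
Proof. by apply: integral_ge0 => x _; rewrite lee_fin rnorm_ge0. Qed.

Lemma norm_L1_subset D' D f : D' `<=` D -> (norm_L1 D' f <= norm_L1 D f)%E.
Proof.
move=> DD; apply: ge0_subset_integral_nomeas => // x _.
by rewrite lee_fin rnorm_ge0.
Qed.

Lemma norm_L1_bound D f (k : R) : measurable D -> 0 <= k ->
  (forall x, D x -> rnorm (f x) <= k) -> (norm_L1 D f <= k%:E * mu D)%E.
Proof.
move=> mD k0 fk; rewrite -integral_cst//.
by apply: ge0_le_integral_nomeas => x Dx /=; rewrite lee_fin ?rnorm_ge0//; exact: fk.
Qed.

Lemma step_strongly_measurable D s : strongly_measurable D (step_eval s).
Proof. by exists (fun=> s); apply: aeW => x _; exact: cvg_cst. Qed.

Lemma strongly_measurableB D f g : strongly_measurable D f ->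
  strongly_measurable D g -> strongly_measurable D (fun x => f x - g x).
Proof.
move=> [s hs] [t ht].
have /choice[r hr] n : exists r : step_fun V,
    forall x, step_eval r x = step_eval (s n) x - step_eval (t n) x.
  by have [r rE _] := step_sub (s n) (t n); exists r.
exists r; apply: ae_impl (ae_and hs ht) => x [sx tx] Dx.
under eq_fun do rewrite hr.
by apply: cvgB; [exact: sx|exact: tx].
Qed.

(** A function equal almost everywhere to a measurable one need not be
    measurable. Off a null set containing the points of divergence, the norm of
    [f] is a limit of measurable functions; removing this set first is what makes
    the integral of the norm additive and homogeneous. *)
Lemma strongly_measurable_null D f : measurable D -> strongly_measurable D f ->
  exists N, [/\ measurable N, mu N = 0%E &
    measurable_fun (D `\` N) (fun x => rnorm (f x))].
Proof.
move=> mD [s [N [mN N0 sN]]]; exists N; split => //.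
have mDN : measurable (D `\` N) by exact: measurableD.
apply: (@measurable_fun_cvg _ _ _ _ (fun n x => rnorm (step_eval (s n) x))).
  by move=> n; exact: rnorm_step_measurable.
move=> x [Dx Nx]; apply: cvg_rnorm.
by apply: contrapT => sx; apply: Nx; apply: sN => /(_ Dx).
Qed.

Lemma norm_L1D_le D f g h : measurable D ->
  strongly_measurable D g -> strongly_measurable D h ->
  (forall x, D x -> rnorm (f x) <= rnorm (g x) + rnorm (h x)) ->
  (norm_L1 D f <= norm_L1 D g + norm_L1 D h)%E.
Proof.
move=> mD mg mh fgh.
have [N1 [mN1 N10 mgN]] := strongly_measurable_null mD mg.
have [N2 [mN2 N20 mhN]] := strongly_measurable_null mD mh.
pose N := N1 `|` N2; have mN : measurable N by exact: measurableU.
have N0 : mu N = 0%E by apply/eqP; rewrite measureU0//; exact/eqP.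
have mDN : measurable (D `\` N) by exact: measurableD.
have sub1 : D `\` N `<=` D `\` N1 by move=> x [Dx Nx]; split => // ?; apply: Nx; left.
have sub2 : D `\` N `<=` D `\` N2 by move=> x [Dx Nx]; split => // ?; apply: Nx; right.
have restr (k : R -> V) : norm_L1 D k = (\int[mu]_(x in D `\` N) (rnorm (k x))%:E)%E.
  by apply: ge0_integral_setD_null => // x _; rewrite lee_fin rnorm_ge0.
rewrite !restr -ge0_integralD//; last 4 first.
- by move=> x _; rewrite lee_fin rnorm_ge0.
- apply/measurable_EFinP; apply: measurable_funS sub1 mgN; exact: measurableD.
- by move=> x _; rewrite lee_fin rnorm_ge0.
- apply/measurable_EFinP; apply: measurable_funS sub2 mhN; exact: measurableD.
apply: ge0_le_integral_nomeas => x [Dx _]; first by rewrite lee_fin rnorm_ge0.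
by rewrite -EFinD lee_fin fgh.
Qed.

Lemma norm_L1Z_le (W : normedModType K) D (f : R -> V) (g : R -> W) (k : R) : measurable D ->
  strongly_measurable D f -> 0 <= k ->
  (forall x, D x -> rnorm (g x) <= k * rnorm (f x)) ->
  (norm_L1 D g <= k%:E * norm_L1 D f)%E.
Proof.
move=> mD mf k0 gf.
have [N [mN N0 mfN]] := strongly_measurable_null mD mf.
have mDN : measurable (D `\` N) by exact: measurableD.
have restr (W' : normedModType K) (h : R -> W') :
    norm_L1 D h = (\int[mu]_(x in D `\` N) (rnorm (h x))%:E)%E.
  by apply: ge0_integral_setD_null => // x _; rewrite lee_fin rnorm_ge0.
rewrite !restr.
rewrite -ge0_integralZl//; last 2 first.
- exact/measurable_EFinP.
- by move=> x _; rewrite lee_fin rnorm_ge0.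
apply: ge0_le_integral_nomeas => x [Dx _]; first by rewrite lee_fin rnorm_ge0.
by rewrite -EFinM lee_fin gf.
Qed.

Lemma step_int_dist D s t f : measurable D -> (mu D < +oo)%E ->
  strongly_measurable D f ->
  ((rnorm (step_int D s - step_int D t))%:E <=
   norm_L1 D (fun x => f x - step_eval s x)%R
   + norm_L1 D (fun x => f x - step_eval t x)%R)%E.
Proof.
move=> mD fD mf; have [r rE rI] := step_sub s t; rewrite -rI.
apply: le_trans (rnorm_step_int r mD fD) _.
apply: norm_L1D_le => //; try by apply: strongly_measurableB => //; exact: step_strongly_measurable.
by move=> x _; rewrite rE (le_trans (rnorm_triangle (f x) _ _))// lerD// rnormBC.
Qed.

Lemma is_bochner_approx D f v (e : R) : 0 < e -> is_bochner_int D f v ->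
  exists s, (norm_L1 D (fun x => f x - step_eval s x)%R <= e%:E)%E /\
    rnorm (step_int D s - v) <= e.
Proof.
move=> e0 [_ [s [/(cvge0P (fun n => norm_L1_ge0 _ _)) sf /rcvgP sv]]].
have [n [h1 /ltW h2]] := filter_ex (filterI (sf e e0) (sv e e0)).
by exists (s n).
Qed.

Lemma is_bochner_intP D f v : strongly_measurable D f ->
  (forall e : R, 0 < e -> exists s,
     (norm_L1 D (fun x => f x - step_eval s x)%R <= e%:E)%E /\
     rnorm (step_int D s - v) <= e) ->
  is_bochner_int D f v.
Proof.
move=> mf fv; split => //.
have /choice[s hs] (n : nat) : exists s,
    (norm_L1 D (fun x => f x - step_eval s x)%R <= (n.+1%:R^-1)%:E)%E /\
    rnorm (step_int D s - v) <= n.+1%:R^-1.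
  by apply: fv; rewrite invr_gt0.
have small (e : R) : 0 < e -> \forall n \near \oo, n.+1%:R^-1 < e.
  by move=> e0; exact: (cvgr_lt _ (@cvg_invS R) _ e0).
exists s; split.
  apply/(cvge0P (fun n => norm_L1_ge0 _ _)) => e /small; apply: filterS => n ne.
  by apply: le_trans (hs n).1 _; rewrite lee_fin ltW.
apply/rcvgP => e /small; apply: filterS => n; apply: le_lt_trans.
exact: (hs n).2.
Qed.

Lemma is_bochner_unique D f v w : measurable D -> (mu D < +oo)%E ->
  is_bochner_int D f v -> is_bochner_int D f w -> v = w.
Proof.
move=> mD fD fv fw; have mf := fv.1.
apply/eqP; rewrite -subr_eq0; apply/eqP/rnorm_eq0/eqP.
rewrite eq_le rnorm_ge0 andbT; apply/ler_addgt0Pr => e e0.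
have e40 : 0 < e / 4 by rewrite divr_gt0.
have [s [fs sv]] := is_bochner_approx e40 fv.
have [t [ft tw]] := is_bochner_approx e40 fw.
have := step_int_dist s t mD fD mf.
move=> /le_trans /(_ (leeD fs ft)); rewrite -EFinD lee_fin => st.
have h1 := rnorm_triangle (step_int D s) v w.
have h2 := rnorm_triangle (step_int D t) (step_int D s) w.
rewrite rnormBC in sv; lra.
Qed.

Lemma bochner_intE D f v : measurable D -> (mu D < +oo)%E ->
  is_bochner_int D f v -> bochner_int D f = v.
Proof.
move=> mD fD fv; rewrite /bochner_int; case: xgetP => [w _ fw|/(_ v)//].
exact: is_bochner_unique fw fv.
Qed.

Lemma is_bochner_step D s : is_bochner_int D (step_eval s) (step_int D s).
Proof.
apply: is_bochner_intP; first exact: step_strongly_measurable.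
move=> e e0; exists s; rewrite subrr rnorm0 (ltW e0); split => //.
rewrite /norm_L1 integral0_eq ?lee_fin ?(ltW e0)// => x _.
by rewrite subrr rnorm0.
Qed.

Lemma is_bochnerB D f g v w : measurable D ->
  is_bochner_int D f v -> is_bochner_int D g w ->
  is_bochner_int D (fun x => f x - g x) (v - w).
Proof.
move=> mD fv gw; apply: is_bochner_intP; first exact: strongly_measurableB fv.1 gw.1.
move=> e e0; have e20 : 0 < e / 2 by rewrite divr_gt0.
have [s [fs sv]] := is_bochner_approx e20 fv.
have [t [gt tw]] := is_bochner_approx e20 gw.
have [r rE rI] := step_sub s t; exists r; rewrite rI; split.
  apply: (@le_trans _ _ ((e / 2)%:E + (e / 2)%:E)%E); last by rewrite -EFinD -splitr.
  apply: le_trans (leeD fs gt).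
  apply: norm_L1D_le => //.
  - by apply: strongly_measurableB fv.1 _; exact: step_strongly_measurable.
  - by apply: strongly_measurableB gw.1 _; exact: step_strongly_measurable.
  move=> x _; rewrite rE opprD addrACA -opprD; exact: ler_rnormB.
rewrite [leRHS]splitr; apply: le_trans (lerD sv tw).
by rewrite opprD addrACA -opprD; apply: ler_rnormB.
Qed.

Lemma is_bochner_norm D f v : measurable D -> (mu D < +oo)%E ->
  is_bochner_int D f v -> ((rnorm v)%:E <= norm_L1 D f)%E.
Proof.
move=> mD fD fv; apply/lee_addgt0Pr => e e0.
have e20 : 0 < e / 2 by rewrite divr_gt0.
have [s [fs sv]] := is_bochner_approx e20 fv.
have ms := step_strongly_measurable D s.
apply: (@le_trans _ _ ((rnorm (step_int D s))%:E + (e / 2)%:E)%E).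
  rewrite -EFinD lee_fin -lerBlDl (le_trans (lerB_rnorm _ _))//.
  by rewrite rnormBC.
apply: (@le_trans _ _ ((norm_L1 D f + (e / 2)%:E) + (e / 2)%:E)%E); last first.
  by rewrite -addeA -EFinD -splitr.
rewrite leeD2r// (le_trans (rnorm_step_int s mD fD))//.
apply: le_trans (leeD2l _ fs).
apply: norm_L1D_le => //; first exact: fv.1.
  exact: strongly_measurableB fv.1 _.
move=> x _; rewrite -{1}[step_eval s x](subKr (f x)).
exact: ler_rnormB.
Qed.

(** The approximating step functions are restricted to [E]; this brings them no
    further from the integrand, which vanishes off [E]. *)
Lemma is_bochner_restrict D E f v : measurable D -> measurable E -> E `<=` D ->
  (mu D < +oo)%E ->
  is_bochner_int D (fun x => rscale (\1_E x) (f x)) v -> is_bochner_int E f v.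
Proof.
move=> mD mE ED fD fv.
have fE : {in E, forall x, rscale (\1_E x) (f x) = f x}.
  by move=> x xE; rewrite indicE xE rscale1r.
apply: is_bochner_intP.
  have [s hs] := fv.1; exists s; apply: ae_impl hs => x hx Ex.
  by rewrite -fE ?inE//; apply: hx; exact: ED.
move=> e e0; have e40 : 0 < e / 4 by rewrite divr_gt0.
have [s [fs sv]] := is_bochner_approx e40 fv.
have [t tE tI] := step_restrict s mE.
have ft : (norm_L1 D (fun x => rscale (\1_E x) (f x) - step_eval t x)%R <= (e / 4)%:E)%E.
  apply: le_trans fs; rewrite -[leRHS]mul1e; apply: norm_L1Z_le => //.
    by apply: strongly_measurableB fv.1 _; exact: step_strongly_measurable.
  move=> x _; rewrite mul1r tE indicE; case: (x \in E); rewrite ?rscale1r// !rscale0r.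
  by rewrite subrr rnorm0 rnorm_ge0.
exists t; split.
  apply: (@le_trans _ _ (e / 4)%:E); last first.
    by rewrite lee_fin ler_pdivrMr// ler_pMr// ler1n.
  apply: le_trans (le_trans (norm_L1_subset _ ED) ft).
  rewrite /norm_L1 le_eqVlt; apply/orP; left; apply/eqP; apply: eq_integral => x xE.
  by rewrite fE.
rewrite (tI D ED).
have := step_int_dist t s mD fD fv.1.
move=> /le_trans /(_ (leeD ft fs)); rewrite -EFinD lee_fin => ts.
have := rnorm_triangle (step_int D s) (step_int D t) v; lra.
Qed.

(** Needed because integrals over half-open intervals are the additive ones,
    whereas controls act on open intervals. *)
Lemma is_bochner_null D D' f v : measurable D -> measurable D' -> D' `<=` D ->
  mu (D `\` D') = 0%E -> is_bochner_int D f v -> is_bochner_int D' f v.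
Proof.
move=> mD mD' DD DD0 fv; apply: is_bochner_intP.
  have [s hs] := fv.1; exists s; apply: ae_impl hs => x hx D'x.
  by apply: hx; exact: DD.
move=> e e0; have [s [fs sv]] := is_bochner_approx e0 fv; exists s; split.
  exact: le_trans (norm_L1_subset _ DD) fs.
rewrite (_ : step_int D' s = step_int D s)//; apply: eq_bigr => i _.
congr (rscale (fine _) _); set S := sf_set i.
have mS : measurable S by exact: sf_measurable.
apply/eqP; rewrite eq_le le_measure ?inE//=; [|exact: measurableI|exact: measurableI|exact: setIS].
have -> : S `&` D = (S `&` D') `|` (S `&` (D `\` D')).
  by rewrite -setIUr setDUK.
have m1 : measurable (S `&` D') by exact: measurableI.
have m2 : measurable (S `&` (D `\` D')) by apply: measurableI => //; exact: measurableD.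
apply: le_trans (measureU2 mu m1 m2) _; rewrite -[leRHS]adde0; apply: leeD2l.
rewrite -DD0; apply: le_measure; [by rewrite inE|rewrite inE; exact: measurableD|].
exact: subIsetr.
Qed.

End NormL1.

Section BochnerLimit.
Variables (R : realType) (cplx : bool).
Local Notation mu := (@lebesgue_measure R).
Variable V : completeNormedModType (scalars R cplx).
Implicit Types (D : set R) (f g : R -> V).

(** The integrals of the approximations form a Cauchy sequence because the norm
    of an integral is at most the integral of the norm. *)
Lemma is_bochner_limit D f (fk : nat -> R -> V) (vk : nat -> V) (e : nat -> R) :
  measurable D -> (mu D < +oo)%E -> strongly_measurable D f ->
  (forall k, is_bochner_int D (fk k) (vk k)) ->
  (forall k, norm_L1 D (fun x => f x - fk k x)%R <= (e k)%:E)%E ->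
  e k @[k --> \oo] --> 0 ->
  exists2 v, is_bochner_int D f v & vk k @[k --> \oo] --> v.
Proof.
move=> mD fD mf fkv fe e0.
have cau k l : rnorm (vk k - vk l) <= e k + e l.
  rewrite -lee_fin EFinD; apply: le_trans (leeD (fe k) (fe l)).
  apply: le_trans (is_bochner_norm mD fD (is_bochnerB mD (fkv k) (fkv l))) _.
  apply: norm_L1D_le => //; try by apply: strongly_measurableB mf _; have [] := fkv k; have [] := fkv l.
  by move=> x _; rewrite (le_trans (rnorm_triangle (f x) _ _))// lerD// rnormBC.
have [v vkv] := rcauchy_cvg e0 cau.
exists v => //; apply: is_bochner_intP => // r r0.
have r20 : 0 < r / 2 by rewrite divr_gt0.
have [k [ek vkr]] := filter_ex (filterI (cvgr_lt _ e0 _ r20) ((rcvgP _ _).1 vkv _ r20)).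
have [s [fs sv]] := is_bochner_approx r20 (fkv k).
exists s; split.
  apply: (@le_trans _ _ ((r / 2)%:E + (r / 2)%:E)%E); last by rewrite -EFinD -splitr.
  apply: le_trans (leeD (le_trans (fe k) _) fs); last by rewrite lee_fin ltW.
  apply: norm_L1D_le => //.
  - by apply: strongly_measurableB mf _; have [] := fkv k.
  - by have [mk _] := fkv k; apply: strongly_measurableB mk _; exact: step_strongly_measurable.
  by move=> x _; exact: rnorm_triangle.
rewrite [leRHS]splitr (le_trans (rnorm_triangle (vk k) _ _))// lerD// ltW//.
Qed.

End BochnerLimit.

Section BochnerExtensionality.
Variables (R : realType) (cplx : bool).
Local Notation mu := (@lebesgue_measure R).
Variable V : normedModType (scalars R cplx).

Lemma eq_is_bochner (D : set R) (f g : R -> V) v : (forall x, D x -> f x = g x) ->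
  is_bochner_int D f v -> is_bochner_int D g v.
Proof.
move=> fg fv; apply: is_bochner_intP.
  by have [s hs] := fv.1; exists s; apply: ae_impl hs => x hx Dx; rewrite -fg//; exact: hx.
move=> e e0; have [s [fs sv]] := is_bochner_approx e0 fv; exists s; split => //.
apply: le_trans fs; rewrite /norm_L1 le_eqVlt; apply/orP; left; apply/eqP.
by apply: eq_integral => x /set_mem Dx; rewrite fg.
Qed.

End BochnerExtensionality.

(** * Uniform limits of step functions and their primitives *)
Section UniformApproximation.
Variables (R : realType) (cplx : bool).
Local Notation K := (scalars R cplx).
Local Notation mu := (@lebesgue_measure R).
Variable V : normedModType K.
Implicit Types (D E : set R) (f g : R -> V) (s : step_fun V).

Definition step_close (e : R) D f : Prop :=
  exists s, forall x, D x -> rnorm (f x - step_eval s x) <= e.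

(** The regulated functions: a class that contains the continuous functions and
    their products with indicators of intervals, is stable under sums, and on
    which Bochner integrability and integrability of the norm are immediate. *)
Definition uapprox D f : Prop := forall e : R, 0 < e -> step_close e D f.

Lemma uapprox_subset D D' f : D' `<=` D -> uapprox D f -> uapprox D' f.
Proof. by move=> DD fD e /fD[s hs]; exists s => x /DD; exact: hs. Qed.

Lemma eq_uapprox D f g : (forall x, D x -> f x = g x) -> uapprox D f -> uapprox D g.
Proof. by move=> fg fD e /fD[s hs]; exists s => x Dx; rewrite -fg//; exact: hs. Qed.

Lemma uapproxB D f g : uapprox D f -> uapprox D g -> uapprox D (fun x => f x - g x).
Proof.
move=> fD gD e e0; have e20 : 0 < e / 2 by rewrite divr_gt0.
have [s hs] := fD _ e20; have [t ht] := gD _ e20.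
have [r rE _] := step_sub s t; exists r => x Dx.
rewrite rE opprD addrACA -opprD (le_trans (ler_rnormB _ _))// [leRHS]splitr.
by rewrite lerD ?hs ?ht.
Qed.

Lemma uapprox0 D : uapprox D (fun=> 0).
Proof.
by move=> e /ltW e0; have [t tE] := @step_zero R cplx V; exists t => x _; rewrite tE subrr rnorm0.
Qed.

Lemma uapproxN D f : uapprox D f -> uapprox D (fun x => - f x).
Proof.
by move=> fD; apply: eq_uapprox (uapproxB (uapprox0 D) fD) => x _; rewrite sub0r.
Qed.

Lemma uapproxD D f g : uapprox D f -> uapprox D g -> uapprox D (fun x => f x + g x).
Proof.
move=> fD gD; apply: eq_uapprox (uapproxB fD (uapproxN gD)) => x _.
by rewrite opprK.
Qed.

Lemma uapprox_sum D n (f : 'I_n -> R -> V) : (forall i, uapprox D (f i)) ->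
  uapprox D (fun x => \sum_i f i x).
Proof.
elim: n f => [|n IH] f fD.
  by apply: eq_uapprox (uapprox0 D) => x _; rewrite big_ord0.
apply: eq_uapprox (uapproxD (fD ord0) (IH (fun i => f (lift ord0 i)) _)) => [x _|i].
  by rewrite big_ord_recl.
exact: fD.
Qed.

Lemma uapprox_indic D E f : measurable E -> uapprox D f ->
  uapprox D (fun x => rscale (\1_E x) (f x)).
Proof.
move=> mE fD e /[dup] /ltW e0 /fD[s hs].
have [t tE _] := step_restrict s mE; exists t => x Dx; rewrite tE indicE.
case: (x \in E); rewrite ?rscale1r ?rscale0r ?subrr ?rnorm0//.
exact: hs.
Qed.

Lemma uapprox_close D f : (forall e : R, 0 < e -> exists2 g, uapprox D g &
  forall x, D x -> rnorm (f x - g x) <= e) -> uapprox D f.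
Proof.
move=> fD e e0; have e20 : 0 < e / 2 by rewrite divr_gt0.
have [g gD fg] := fD _ e20; have [s hs] := gD _ e20; exists s => x Dx.
by rewrite (le_trans (rnorm_triangle (g x) _ _))// [leRHS]splitr lerD ?fg ?hs.
Qed.

Lemma step_close_setU e D E f : measurable D -> measurable E ->
  step_close e D f -> step_close e E f -> step_close e (D `|` E) f.
Proof.
move=> mD mE [s hs] [t ht].
have [s' sE _] := step_restrict s mD.
have [t' tE _] := step_restrict t (measurableD mE mD).
have [z zE] := @step_zero R cplx V.
have [u uE _] := step_sub z t'; have [r rE _] := step_sub s' u.
exists r => x DEx; rewrite rE sE uE zE sub0r opprK tE !indicE.
have [/set_mem Dx|/negP nDx] := boolP (x \in D).
  rewrite memNset; last by move=> -[].
  by rewrite rscale0r addr0 rscale1r; exact: hs.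
case: DEx => [/mem_set//|Ex].
rewrite mem_set; last by split => // /mem_set.
by rewrite rscale0r add0r rscale1r; exact: ht.
Qed.

(** The approximating step function is built from left to right on intervals of
    length [d / 2], where [d] is a modulus of uniform continuity for [e]. *)
Lemma uapprox_cont (a b : R) f : continuous f -> uapprox `[a, b] f.
Proof.
move=> cf e e0.
have [d d0 hd] := unif_cont_segment a b cf e0.
have d20 : 0 < d / 2 by rewrite divr_gt0.
have dd : d / 2 < d by rewrite ltr_pdivrMr// ltr_pMr// ltr1n.
have close c c' : c' - c <= d / 2 -> a <= c -> step_close e (`[c, c'] `&` `[a, b]) f.
  move=> cc' ac.
  have [|t tE _] := step_indic (f c) (@measurable_itv R `[c, c']) _.
    by rewrite lebesgue_measure_itv /=; case: ifP => _; rewrite ?ltry// -EFinB ltry.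
  exists t => x []; rewrite /= !in_itv /= => /andP[cx xc'] /andP[ax xb].
  rewrite tE indicE mem_set ?rscale1r; last by rewrite /= in_itv /= cx.
  apply/ltW/hd; rewrite ?ax ?ac ?(le_trans cx)//.
  rewrite ger0_norm ?subr_ge0//; apply: le_lt_trans dd; apply: le_trans cc'.
  by rewrite lerD2r.
have main n : step_close e (`[a, a + n%:R * (d / 2)] `&` `[a, b]) f.
  elim: n => [|n IH]; first by apply: close => //; rewrite mul0r addr0 subrr ltW.
  have -> : `[a, a + n.+1%:R * (d / 2)] `&` `[a, b] =
     (`[a, a + n%:R * (d / 2)] `&` `[a, b]) `|`
     (`[a + n%:R * (d / 2), a + n.+1%:R * (d / 2)] `&` `[a, b]) :> set R.
    rewrite -setIUl; congr (_ `&` _); apply/seteqP; split => x /=; rewrite !in_itv /=.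
      move=> /andP[ax xn].
      by have [h|/ltW h] := leP x (a + n%:R * (d / 2)); [left; rewrite ax|right; rewrite xn andbT].
    move=> [/andP[-> h]|/andP[h ->]] /=.
      by rewrite (le_trans h)// lerD2l ler_pM2r// ler_nat.
    by rewrite andbT (le_trans _ h)// lerDl mulr_ge0// ltW.
  apply: step_close_setU => //.
  - by apply: measurableI; exact: measurable_itv.
  - by apply: measurableI; exact: measurable_itv.
  apply: close; last by rewrite lerDl mulr_ge0// ltW.
  by rewrite opprD addrACA subrr add0r -mulrBl -natrB// subSnn mul1r.
pose n := (Num.truncn ((b - a) / (d / 2))).+1.
have [s hs] := main n; exists s => x Dx; apply: hs; split => //.
move: Dx; rewrite /= !in_itv /= => /andP[-> xb] /=.
rewrite (le_trans xb)// -lerBlDl -ler_pdivrMr//.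
exact/ltW/truncnS_gt.
Qed.

Lemma step_bounded s : exists2 c : R, 0 <= c & forall x, rnorm (step_eval s x) <= c.
Proof.
exists (\sum_i rnorm (@sf_val _ _ _ s i)) => [|x].
  by apply: sumr_ge0 => i _; exact: rnorm_ge0.
rewrite /step_eval.
apply: (@le_trans _ _ (\sum_i rnorm (rscale (\1_(@sf_set _ _ _ s i) x) (@sf_val _ _ _ s i)))).
  elim/big_ind2: _ => [|x1 x2 y1 y2 h1 h2|//]; first by rewrite rnorm0.
  by rewrite (le_trans (ler_rnormD _ _))// lerD.
apply: ler_sum => i _; rewrite indicE; case: (x \in _); rewrite ?rscale1r// rscale0r.
by rewrite rnorm0 rnorm_ge0.
Qed.

Lemma uapprox_bounded D f : uapprox D f ->
  exists2 c : R, 0 <= c & forall x, D x -> rnorm (f x) <= c.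
Proof.
move=> /(_ 1 ltr01)[s hs]; have [c c0 hc] := step_bounded s.
exists (1 + c) => [|x /hs h]; first by rewrite addr_ge0.
by rewrite -(subrK (step_eval s x) (f x)) (le_trans (ler_rnormD _ _))// lerD.
Qed.

Lemma uapprox_seq D f : uapprox D f -> exists s : nat -> step_fun V,
  forall n x, D x -> rnorm (f x - step_eval (s n) x) <= n.+1%:R^-1.
Proof.
move=> fD; have /choice[s hs] n : exists s,
    forall x, D x -> rnorm (f x - step_eval s x) <= n.+1%:R^-1.
  by apply: fD; rewrite invr_gt0.
by exists s.
Qed.

Lemma uapprox_strongly_measurable D f : uapprox D f -> strongly_measurable D f.
Proof.
move=> /uapprox_seq[s hs]; exists s; apply: aeW => x Dx; apply/rcvgP => e e0.
apply: filterS (cvgr_lt _ (@cvg_invS R) _ e0) => n; apply: le_lt_trans.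
by rewrite rnormBC; exact: hs.
Qed.

Lemma uapprox_in_L1 D f : measurable D -> (mu D < +oo)%E -> uapprox D f -> in_L1 D f.
Proof.
move=> mD fD ua; split; first exact: uapprox_strongly_measurable.
have [c c0 hc] := uapprox_bounded ua.
apply: le_lt_trans (norm_L1_bound mD c0 hc) _.
by rewrite lte_mul_pinfty ?lee_fin.
Qed.

End UniformApproximation.

Section Antiderivative.
Variables (R : realType) (cplx : bool).
Local Notation K := (scalars R cplx).
Local Notation mu := (@lebesgue_measure R).
Variable V : completeNormedModType K.
Implicit Types (D E : set R) (f g : R -> V).

Lemma uapprox_bochner D f : measurable D -> (mu D < +oo)%E -> uapprox D f ->
  exists v, is_bochner_int D f v.
Proof.
move=> mD fD ua; have [s hs] := uapprox_seq ua.
have [] := @is_bochner_limit R cplx V D f (fun n => step_eval (s n))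
  (fun n => step_int D (s n)) (fun n => n.+1%:R^-1 * fine (mu D)) mD fD
  (uapprox_strongly_measurable ua) (fun n => is_bochner_step D (s n)).
- move=> n; have n0 : 0 <= n.+1%:R^-1 :> R by rewrite invr_ge0.
  apply: le_trans (norm_L1_bound mD n0 (hs n)) _.
  by rewrite EFinM fineK// ge0_fin_numE.
- rewrite -(mul0r (fine (mu D))); apply: cvgM; [exact: cvg_invS|exact: cvg_cst].
by move=> v fv _; exists v.
Qed.

(** Right continuity is what an indefinite integral needs to be differentiable
    from the right; unlike continuity, it survives multiplication by the
    indicator of the times not less than a given one. *)
Definition rcont f (t : R) : Prop := forall e : R, 0 < e ->
  exists2 d : R, 0 < d & forall s, t <= s < t + d -> rnorm (f s - f t) <= e.

Definition clip (a b t : R) := Num.min b (Num.max a t).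

Lemma clip_id a b t : a <= t <= b -> clip a b t = t.
Proof. by move=> /andP[ta tb]; rewrite /clip (max_idPr ta) (min_idPr tb). Qed.

Lemma clip_in a b t : a <= b -> a <= clip a b t <= b.
Proof. by move=> ab; rewrite /clip le_min ab le_max lexx ge_min lexx. Qed.

Lemma clip_lip a b s t : `|clip a b s - clip a b t| <= `|s - t|.
Proof.
apply: (@le_trans _ _ `|Num.max a s - Num.max a t|).
  rewrite /clip; move: (Num.max a s) (Num.max a t) => x y.
  have h1 := ler_norm (x - y); have h2 := ler_norm (y - x); rewrite distrC in h2.
  by rewrite ler_norml; case: (leP b x) => ?; case: (leP b y) => ?; apply/andP; split; lra.
have h1 := ler_norm (s - t); have h2 := ler_norm (t - s); rewrite distrC in h2.
by rewrite ler_norml; case: (leP a s) => ?; case: (leP a t) => ?; apply/andP; split; lra.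
Qed.

(** The indefinite integral of a uniform limit of step functions. Working with
    the integrals of [f] times indicators over one fixed segment makes
    additivity over adjacent intervals a matter of linearity. *)
Lemma uapprox_antiderivative (a b : R) f : a <= b -> uapprox `[a, b] f ->
  exists I : R -> V, [/\ continuous I, I a = 0,
    forall t, a <= t <= b -> is_bochner_int `]a, t[ f (I t) &
    forall t, a <= t < b -> rcont f t -> rderiv I t (f t)].
Proof.
move=> ab ua.
pose D := `]a, b]%classic : set R.
have mD : measurable D by exact: measurable_itv.
have fin_itv c d : (mu `]c, d] < +oo)%E.
  by rewrite lebesgue_measure_itv /=; case: ifP => _; rewrite ?ltry// -EFinB ltry.
have fD := fin_itv a b : (mu D < +oo)%E.
pose E t := `]a, t]%classic : set R.
have mE t : measurable (E t) by exact: measurable_itv.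
have uaD : uapprox D f by apply: uapprox_subset ua; exact: subset_itv_oc_cc.
have /choice[J hJ] t : exists v, is_bochner_int D (fun x => rscale (\1_(E t) x) (f x)) v.
  by apply: uapprox_bochner => //; exact: uapprox_indic.
have ED t : t <= b -> E t `<=` D by move=> tb; apply: subset_itvl; rewrite bnd_simp.
(* The increment of the integral over [s, t] differs from (t - s) c by at most
   (t - s) e as soon as f stays within e of c between s and t. *)
have incr s t c e : a <= s <= t -> t <= b -> 0 <= e ->
    (forall x, s < x <= t -> rnorm (f x - c) <= e) ->
    rnorm (J t - J s - rscale (t - s) c) <= e * (t - s).
  move=> /andP[as_ st] tb e0 fc.
  pose G := `]s, t]%classic : set R.
  have mG : measurable G by exact: measurable_itv.
  have GD : G `&` D = G.
    by apply: setIidl; apply: subset_itv; rewrite bnd_simp.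
  have GE : mu G = (t - s)%:E.
    rewrite lebesgue_measure_itv /= lte_fin; case: ltP => // ts.
    have -> : t = s by apply/eqP; rewrite eq_le ts.
    by rewrite subrr.
  have [|u uE uI] := step_indic c mG _; first by rewrite GE ltry.
  have := is_bochnerB mD (is_bochnerB mD (hJ t) (hJ s)) (is_bochner_step D u).
  move=> /(is_bochner_norm mD fD); rewrite uI GD GE /= -lee_fin => /le_trans; apply.
  have -> : (e * (t - s))%:E = (\int[mu]_(x in D) (e%:E * (\1_G x)%:E))%E.
    rewrite ge0_integralZl//; last by apply/measurable_EFinP.
    by rewrite integral_indic// GD EFinM; congr (_ * _)%E; exact/esym/GE.
  apply: ge0_le_integral_nomeas => x; first by rewrite lee_fin rnorm_ge0.
  rewrite /D /= in_itv /= => /andP[ax xb]; rewrite -EFinM lee_fin uE !indicE.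
  have [/set_mem|/negP] := boolP (x \in G).
    rewrite /G /= in_itv /= => /andP[sx xt].
    rewrite mem_set ?memNset /E /= ?in_itv /= ?ax ?xt//; last first.
      by rewrite leNgt sx.
    by rewrite !rscale1r rscale0r subr0 mulr1; apply: fc; rewrite sx.
  move=> xG; have -> : (x \in E t) = (x \in E s).
    apply/idP/idP => /set_mem; rewrite /E /= in_itv /= ax => xt; rewrite inE /= in_itv /= ax /=.
      rewrite leNgt; apply/negP => sx; apply: xG.
      by rewrite inE /G /= in_itv /= sx.
    exact: le_trans xt st.
  by rewrite subrr rscale0r subrr rnorm0 mulr0.
have Ja : J a = 0.
  apply/rnorm_eq0/eqP; rewrite eq_le rnorm_ge0 andbT -lee_fin.
  apply: le_trans (is_bochner_norm mD fD (hJ a)) _.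
  apply: le_trans (norm_L1_bound mD (lexx 0) _) _; last by rewrite mul0e.
  move=> x; rewrite /D /= in_itv /= => /andP[ax _].
  rewrite indicE memNset ?rscale0r ?rnorm0// /E /= in_itv /= => /andP[_].
  by rewrite leNgt ax.
have [c c0 hc] := uapprox_bounded ua.
have Jlip s t : a <= s <= t -> t <= b -> rnorm (J t - J s) <= c * (t - s).
  move=> /[dup] ast /andP[as_ st] tb.
  have := incr s t 0 c ast tb c0; rewrite rscaler0 subr0; apply => x /andP[sx xt].
  rewrite subr0; apply: hc; rewrite /= in_itv /= (le_trans xt tb) andbT.
  exact: le_trans as_ (ltW sx).
exists (J \o clip a b); split.
- have Jlip' s t : a <= s <= b -> a <= t <= b -> rnorm (J t - J s) <= c * `|t - s|.
    move=> /andP[as_ sb] /andP[at_ tb]; have [st|/ltW ts] := leP s t.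
      by rewrite ger0_norm ?subr_ge0//; apply: Jlip; rewrite ?as_.
    by rewrite rnormBC distrC ger0_norm ?subr_ge0//; apply: Jlip; rewrite ?at_.
  move=> t; apply/rcvgP => e e0.
  have c10 : 0 < c + 1 by rewrite ltr_wpDl.
  have ec : 0 < e / (c + 1) by rewrite divr_gt0.
  apply/nbhs_ballP; exists (e / (c + 1)) => //= s; rewrite /ball /= ltr_pdivlMr// => ts.
  apply: le_lt_trans ts; apply: le_trans (Jlip' _ _ (clip_in t ab) (clip_in s ab)) _.
  rewrite mulrC ler_pM// ?lerDl// (le_trans (clip_lip _ _ _ _))// distrC//.
- by rewrite /= clip_id ?Ja ?lexx.
- move=> t atb; rewrite /= clip_id//; have /andP[at_ tb] := atb.
  apply: (@is_bochner_null _ _ _ (E t)) => //.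
  + exact: subset_itv_oo_oc.
  + apply: (subset_measure0 _ _ _ (lebesgue_measure_set1 t)) => //.
      by apply: measurableD => //; exact: measurable_itv.
    move=> x []; rewrite /E /= !in_itv /= => /andP[ax xt] /negP; rewrite ax /=.
    by rewrite -leNgt => tx; apply/eqP; rewrite eq_le xt.
  exact: (is_bochner_restrict mD (mE t) (ED t tb) fD (hJ t)).
- move=> t /andP[at_ tb] ft; apply/rderivP => e e0.
  have [d d0 hd] := ft e e0.
  exists (Num.min d (b - t)) => [|h]; first by rewrite lt_min d0 subr_gt0.
  rewrite lt_min => /and3P[h0 hd' hb].
  have tht : t <= t + h by rewrite lerDl ltW.
  have thb : t + h <= b by rewrite addrC -lerBrDr ltW.
  rewrite /= !clip_id ?at_ ?(ltW tb) ?thb ?(le_trans at_)//.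
  have thK : t + h - t = h by rewrite addrAC subrr add0r.
  have := @incr t (t + h) (f t) e; rewrite at_ tht thb (ltW e0) thK.
  apply => // x /andP[tx xth]; apply: hd; rewrite (ltW tx) /=.
  by apply: le_lt_trans xth _; rewrite ltrD2l.
Qed.

(** [F] and the indefinite integral of [f] have the same derivative from the
    right, so they differ by a constant. *)
Lemma bochner_ftc (a b : R) f (F : R -> V) : a <= b -> uapprox `[a, b] f ->
  (forall t, a <= t < b -> rcont f t) -> continuous F ->
  (forall t, a <= t < b -> rderiv F t (f t)) ->
  is_bochner_int `]a, b[ f (F b - F a).
Proof.
move=> ab ua rf cF dF.
have [I [cI Ia iI dI]] := uapprox_antiderivative ab ua.
have : F b - I b = F a - I a.
  apply: (@rderiv0_const _ _ _ (fun t => F t - I t)) => //.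
    by move=> t; apply: cvgB; [exact: cF|exact: cI].
  move=> t tab; rewrite -(subrr (f t)); apply: rderivB; first exact: dF.
  by apply: dI => //; exact: rf.
rewrite Ia subr0 => <-; rewrite subKr; apply: iI.
by rewrite ab lexx.
Qed.

Lemma cont_rcont f : continuous f -> forall t, rcont f t.
Proof.
move=> cf t e e0; have /rcvgP/(_ _ e0) := cf t.
move=> /nbhs_ballP[d /= d0 hd]; exists d => // s /andP[ts std]; apply/ltW/hd.
by rewrite /ball /= distrC ger0_norm ?subr_ge0// ltrBlDl.
Qed.

End Antiderivative.

(** * Uniform boundedness and strongly continuous semigroups *)
Section BanachSteinhaus.
Variables (R : realType) (cplx : bool).
Local Notation K := (scalars R cplx).

(** Geometrically small series converge in [V], and the [f i] are bounded at
    their sum. The maps are not bundled, and only real-linear, because the lemma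
    is applied to difference quotients of a semigroup. *)
Lemma banach_steinhaus (V : completeNormedModType K) (W : normedModType K) (I : Type)
    (f : I -> V -> W) :
  (forall i x y, f i (x - y) = f i x - f i y) ->
  (forall i a x, f i (rscale a x) = rscale a (f i x)) ->
  (forall i, exists c : R, forall x, rnorm (f i x) <= c * rnorm x) ->
  (forall x, exists b : R, forall i, rnorm (f i x) <= b) ->
  exists2 c : R, 0 < c & forall i x, rnorm (f i x) <= c * rnorm x.
Proof.
move=> fB fZ fbd fpt.
have f0 i : f i 0 = 0 by rewrite -(subrr 0) fB subrr.
have fN i x : f i (- x) = - f i x by rewrite -sub0r fB f0 sub0r.
have fD i x y : f i (x + y) = f i x + f i y by rewrite -{1}(opprK y) fB fN opprK.
have /choice[c hc] i : exists c : R, 0 <= c /\ forall x, rnorm (f i x) <= c * rnorm x.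
  have [c hc] := fbd i; exists `|c|; split => // x.
  by rewrite (le_trans (hc x))// ler_wpM2r ?rnorm_ge0// ler_norm.
have [|||||||||r [b [r0 hr]]] := @gliding_hump R V (fun=> True) (@rnorm R cplx V) I
   (fun i x => rnorm (f i x)) c.
- by [].
- by [].
- by [].
- exact: rnorm0.
- by move=> i; have [] := hc i.
- by move=> i x y _ _; rewrite fD ler_rnormD.
- by move=> i x _; rewrite fN rnormN.
- by move=> i x _; have [_] := hc i; exact.
- move=> a _ ha; pose s n := \sum_(k < n) a k.
  pose e (n : nat) : R := 3 / 2 * 3^-1 ^+ n.
  have e0 : e n @[n --> \oo] --> 0.
    rewrite -(mulr0 (3 / 2)); apply: cvgM; first exact: cvg_cst.
    by apply: cvg_expr; rewrite ger0_norm ?invr_ge0// invf_lt1// ltr1n.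
  have tail k m : rnorm (s (k + m)%N - s k) <= e k - e (k + m)%N.
    elim: m => [|m IH]; first by rewrite addn0 !subrr rnorm0.
    rewrite addnS /s big_ord_recr /= addrAC (le_trans (ler_rnormD _ _))//.
    have := lerD IH (ha (k + m)%N); rewrite /e exprS /s.
    by move: (3^-1 ^+ (k + m)) => q; lra.
  have eps k : 0 <= e k by rewrite mulr_ge0// exprn_ge0// invr_ge0.
  have cau k l : rnorm (s k - s l) <= e k + e l.
    wlog kl : k l / (k <= l)%N.
      move=> H; case: (leqP k l) => [|/ltnW] kl; first exact: H.
      by rewrite rnormBC [leRHS]addrC; exact: H.
    rewrite rnormBC -(subnKC kl) (le_trans (tail _ _))//.
    by have := eps (k + (l - k))%N; lra.
  have [x sx] := rcauchy_cvg e0 cau.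
  have [b hb] := fpt x; exists (b + 1) => i.
  have [ci fi] := hc i.
  have ci1 : 0 < 1 / (c i + 1) by rewrite divr_gt0// ltr_wpDl.
  have /rcvgP/(_ _ ci1)[m0 _ hm] := sx; exists m0 => m /hm sm.
  rewrite -/(s m) -(subrK x (s m)) fD (le_trans (ler_rnormD _ _))// addrC lerD//.
  rewrite (le_trans (fi _))//.
  move: sm; rewrite /= ltr_pdivlMr ?ltr_wpDl// => /ltW; apply: le_trans.
  by rewrite mulrC ler_wpM2l ?rnorm_ge0// lerDl.
exists (`|b| / r + 1) => [|i x]; first by rewrite ltr_wpDl// divr_ge0// ltW.
have [/rnorm_eq0->|x0] := eqVneq (rnorm x) 0; first by rewrite f0 !rnorm0 mulr0.
have {}x0 : 0 < rnorm x by rewrite lt_neqAle eq_sym x0 rnorm_ge0.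
have rx : 0 < r / rnorm x by rewrite divr_gt0.
have := hr i (rscale (r / rnorm x) x) Logic.I.
rewrite fZ !rnorm_scale gtr0_norm// divfK ?gt_eqF// => /(_ (lexx _)).
rewrite mulrC -ler_pdivlMr// invf_div mulrA mulrAC => /le_trans; apply.
rewrite ler_wpM2r ?rnorm_ge0// ler_wpDr// ler_wpM2r ?invr_ge0 ?(ltW r0)//.
exact: ler_norm.
Qed.

End BanachSteinhaus.

Section Semigroup.
Variables (R : realType) (cplx : bool).
Local Notation K := (scalars R cplx).

Lemma rderiv_linear (V W : normedModType K) (T : {linear V -> W}) (f : R -> V) t v :
  continuous T -> rderiv f t v -> rderiv (T \o f) t (T v).
Proof.
move=> cT fv; rewrite /rderiv /=.
under eq_fun do rewrite -linearB -linear_rscale.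
by apply: (@cvg_comp _ _ _ _ T _ (nbhs v) _ fv); exact: cT.
Qed.

Lemma rderiv_rscale (V : normedModType K) (f : R -> V) t v a :
  rderiv f t v -> rderiv (fun s => rscale a (f s)) t (rscale a v).
Proof.
move=> fv; rewrite /rderiv.
under eq_fun do rewrite -rscaleBr rscaleA mulrC -rscaleA.
by apply: cvg_rscale => //; exact: cvg_cst.
Qed.

Variable V : completeNormedModType K.
Variable S : R -> {linear V -> V}.
Hypothesis S_C0 : C0_semigroup S.

Let Scont (t : R) : 0 <= t -> continuous (S t). Proof. by case: S_C0 => h _ _ _; exact: h. Qed.
Let S0 x : S 0 x = x. Proof. by case: S_C0 => _ h _ _; exact: h. Qed.
Let SD (s t : R) x : 0 <= s -> 0 <= t -> S (s + t) x = S s (S t x).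
Proof. by case: S_C0 => _ _ h _; exact: h. Qed.
Let Sright x : S t x @[t --> 0^'+] --> x. Proof. by case: S_C0 => _ _ _ h; exact: h. Qed.

(** Were the operators unbounded near time zero, the uniform boundedness
    principle along a sequence of times tending to zero would contradict the
    strong continuity; the semigroup law spreads the bound to [0, T]. *)
Lemma semigroup_bound (T : R) : exists2 M : R, 0 < M &
  forall (t : R) x, 0 <= t <= T -> rnorm (S t x) <= M * rnorm x.
Proof.
have [N [M0 hM0]] : exists N : nat, exists M : R, forall (t : R) x, 0 <= t <= N.+1%:R^-1 ->
    rnorm (S t x) <= M * rnorm x.
  apply: contrapT => nN.
  have /choice[tx htx] (n : nat) : exists tx : R * V, 0 <= tx.1 <= n.+1%:R^-1 /\
      n%:R * rnorm tx.2 < rnorm (S tx.1 tx.2).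
    apply: contrapT => ntx; apply: nN; exists n, n%:R => t x tn.
    by rewrite leNgt; apply/negP => h; apply: ntx; exists (t, x).
  have tx0 n : 0 <= (tx n).1 by have [/andP[]] := htx n.
  have [||||c c0 hc] := @banach_steinhaus R cplx V V nat (fun n x => S (tx n).1 x).
  - by move=> n x y; rewrite linearB.
  - by move=> n a x; rewrite linear_rscale.
  - by move=> n; have [c _ hc] := linear_cont_bound (Scont (tx0 n)); exists c.
  - move=> x; have /rcvgP/(_ 1 ltr01) := @Sright x.
    move=> /nbhs_ballP[d /= d0 hd].
    have [N _ hN] := cvgr_lt _ (@cvg_invS R) _ d0.
    have [b hb] : exists b : R, forall n, (n < N)%N -> rnorm (S (tx n).1 x) <= b.
      exists (\sum_(n < N) rnorm (S (tx n).1 x)) => n nN'.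
      rewrite (bigD1 (Ordinal nN'))//= lerDl; apply: sumr_ge0 => i _.
      exact: rnorm_ge0.
    exists (Num.max b (rnorm x + 1)) => n; rewrite le_max.
    have [nN'|Nn] := ltnP n N; first by rewrite hb.
    apply/orP; right; have [/andP[_ tn] _] := htx n.
    have [->|t0] := eqVneq (tx n).1 0; first by rewrite S0 lerDl.
    have := hd (tx n).1; rewrite /ball /= sub0r normrN ger0_norm//.
    rewrite (le_lt_trans tn (hN _ Nn)) => /(_ isT).
    rewrite lt_neqAle eq_sym t0 tx0 => /(_ isT) /ltW h.
    by rewrite -(subrK x (S _ x)) (le_trans (ler_rnormD _ _))// addrC lerD2l.
  pose n := (Num.truncn c).+1; have cn : c < n%:R by exact: truncnS_gt.
  have [_] := htx n; apply/negP; rewrite -leNgt (le_trans (hc n _))//.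
  by rewrite ler_wpM2r ?rnorm_ge0// ltW.
pose M := Num.max M0 1.
have M1 : 1 <= M by rewrite le_max lexx orbT.
have hM t x : 0 <= t <= N.+1%:R^-1 -> rnorm (S t x) <= M * rnorm x.
  move=> tN; apply: (le_trans (hM0 t x tN)).
  by rewrite ler_wpM2r ?rnorm_ge0// le_max lexx.
have main k t x : 0 <= t <= k%:R * N.+1%:R^-1 -> rnorm (S t x) <= M ^+ k * rnorm x.
  elim: k t x => [|k IH] t x.
    rewrite mul0r => t0; have -> : t = 0 by apply/eqP; rewrite eq_le andbC.
    by rewrite S0 expr0 mul1r.
  move=> /andP[t0 tk]; pose d : R := N.+1%:R^-1.
  have d0 : 0 <= d by rewrite invr_ge0.
  have [td|dt] := leP t d.
    apply: (le_trans (hM t x _)); first by rewrite t0.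
    rewrite ler_wpM2r ?rnorm_ge0// exprSr ler_peMl//; first exact: le_trans M1.
    exact: exprn_ege1.
  rewrite -(subrK d t) SD// ?subr_ge0 ?(ltW dt)//.
  apply: (le_trans (IH _ _ _)).
    by rewrite subr_ge0 (ltW dt) lerBlDr -[X in _ + X]mul1r -mulrDl natr1.
  rewrite exprSr -mulrA ler_wpM2l//; first by rewrite exprn_ge0// (le_trans _ M1).
  by apply: hM; rewrite d0 lexx.
pose k := (Num.truncn (T * N.+1%:R)).+1.
exists (M ^+ k) => [|t x /andP[t0 tT]]; first by rewrite exprn_gt0// (lt_le_trans _ M1).
apply: main; rewrite t0 (le_trans tT)// ler_pdivlMr//.
exact/ltW/truncnS_gt.
Qed.

(** A semigroup has no meaning at negative times. Evaluating it at [pos t]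
    extends its orbits to functions that are continuous on the whole line. *)
Definition pos (t : R) := Num.max t 0.

Lemma pos_ge0 t : 0 <= pos t. Proof. by rewrite le_max lexx orbT. Qed.

Lemma posE t : 0 <= t -> pos t = t. Proof. by move=> t0; exact/max_idPl. Qed.

Lemma pos_lip s t : `|pos s - pos t| <= `|s - t|.
Proof.
have h1 := ler_norm (s - t); have h2 := ler_norm (t - s); rewrite distrC in h2.
by rewrite ler_norml /pos; case: (leP s 0) => ?; case: (leP t 0) => ?; apply/andP; split; lra.
Qed.

Lemma semigroup_cont (a : R -> R) (u : R -> V) : continuous a -> continuous u ->
  continuous (fun s => S (pos (a s)) (u s)).
Proof.
move=> ca cu t.
have [M M0 hM] := semigroup_bound (pos (a t) + 1).
apply/rcvgP => e e0.
have eM : 0 < e / (2 * M) by rewrite divr_gt0// mulr_gt0.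
have /rcvgP/(_ _ eM) := @Sright (u t).
move=> /nbhs_ballP[d /= d0 hd].
have near_a : \forall s \near t, `|pos (a s) - pos (a t)| < Num.min d 1.
  have d1 : 0 < Num.min d 1 by rewrite lt_min d0 ltr01.
  have /cvgrPdistC_lt/(_ _ d1) := ca t; apply: filterS => s.
  exact/le_lt_trans/pos_lip.
have /rcvgP/(_ _ eM) := cu t => near_u.
apply: filterS2 near_a near_u => s; rewrite lt_min => /andP[ad a1] us.
have pst : 0 <= pos (a s) <= pos (a t) + 1.
  by rewrite pos_ge0 /= -lerBlDl ltW// (le_lt_trans _ a1)// ler_norm.
have ptt : 0 <= pos (a t) <= pos (a t) + 1 by rewrite pos_ge0 lerDl ler01.
have Sd p q : 0 <= p <= q -> q <= pos (a t) + 1 -> q - p < d ->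
    rnorm (S q (u t) - S p (u t)) <= e / 2.
  move=> /andP[p0 pq] qt qpd.
  rewrite -(subrKC p q) SD ?subr_ge0// -linearB.
  apply: (le_trans (hM _ _ _)); first by rewrite p0 (le_trans pq).
  have [->|pNq] := eqVneq p q.
    by rewrite subrr S0 subrr rnorm0 mulr0 divr_ge0// ltW.
  have := hd (q - p); rewrite /ball /= sub0r normrN ger0_norm ?subr_ge0// => /(_ qpd).
  rewrite subr_gt0 lt_neqAle pNq pq => /(_ isT) /ltW.
  by rewrite ler_pdivlMr ?mulr_gt0//; lra.
have h2 : rnorm (S (pos (a s)) (u t) - S (pos (a t)) (u t)) <= e / 2.
  have [st|/ltW ts] := leP (pos (a s)) (pos (a t)).
    rewrite rnormBC; apply: Sd; rewrite ?pos_ge0//; first by have /andP[] := ptt.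
    by rewrite (le_lt_trans _ ad)// distrC ler_norm.
  apply: Sd; rewrite ?pos_ge0//; first by have /andP[] := pst.
  by rewrite (le_lt_trans _ ad)// ler_norm.
apply: le_lt_trans (rnorm_triangle (S (pos (a s)) (u t)) _ _) _.
rewrite [ltRHS]splitr; apply: ltr_leD => //.
rewrite -linearB (le_lt_trans (hM _ _ pst))// mulrC -ltr_pdivlMr//.
by rewrite -mulrA -invfM.
Qed.

Lemma orbit_cont x : continuous (fun t => S (pos t) x).
Proof. by apply: semigroup_cont => t; [exact: cvg_id|exact: cvg_cst]. Qed.

End Semigroup.

(** * Generators, smoothing and the product rule of Duhamel *)
Section Generator.
Variables (R : realType) (cplx : bool).
Local Notation K := (scalars R cplx).
Variable V : completeNormedModType K.
Variables (D : set V) (A : V -> V) (S : R -> {linear V -> V}).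
Hypothesis gen : generates D A S.

Let S_C0 : C0_semigroup S := gen.1.

Lemma generator_cvg x : D x -> rscale h^-1 (S h x - x) @[h --> 0^'+] --> A x.
Proof. by move=> Dx; apply/gen.2. Qed.

Lemma cvg_generator x y : rscale h^-1 (S h x - x) @[h --> 0^'+] --> y ->
  D x /\ A x = y.
Proof. by move=> /gen.2[Dx ->]. Qed.

Lemma orbit_rderiv (t : R) x : 0 <= t -> D x -> rderiv (fun s => S (pos s) x) t (S t (A x)).
Proof.
move=> t0 Dx; case: S_C0 => [Sc S0 SD _]; rewrite /rderiv.
have Sct : S t y @[y --> A x] --> S t (A x) by apply: Sc.
have := cvg_comp _ _ (generator_cvg Dx) Sct.
apply: cvg_trans; apply: near_eq_cvg.
near=> h; have h0 : 0 < h by near: h; exact: nbhs_right_gt.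
rewrite /= !posE ?addr_ge0 ?(ltW h0)// SD ?(ltW h0)//.
by rewrite linear_rscale linearB.
Unshelve. all: by end_near. Qed.

Lemma generator_semigroup (t : R) x : 0 <= t -> D x -> D (S t x) /\ A (S t x) = S t (A x).
Proof.
move=> t0 Dx; apply: cvg_generator; case: S_C0 => [Sc S0 SD _].
apply: cvg_trans (orbit_rderiv t0 Dx); apply: near_eq_cvg.
near=> h; have h0 : 0 < h by near: h; exact: nbhs_right_gt.
rewrite /= !posE ?addr_ge0 ?(ltW h0)//.
by rewrite (addrC t h) SD ?(ltW h0).
Unshelve. all: by end_near. Qed.

Lemma generatorB x y : D x -> D y -> D (x - y) /\ A (x - y) = A x - A y.
Proof.
move=> Dx Dy; apply: cvg_generator.
have -> : (fun h : R => rscale h^-1 (S h (x - y) - (x - y))) =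
    (fun h : R => rscale h^-1 (S h x - x) - rscale h^-1 (S h y - y)).
  by apply/funext => h; rewrite -rscaleBr linearB opprD addrACA -opprD.
by apply: cvgB; exact: generator_cvg.
Qed.

Lemma rderiv_shift (f : R -> V) (t h : R) v :
  rderiv f (t + h) v -> rderiv (fun s => f (s + h)) t v.
Proof.
rewrite /rderiv; have -> : (fun k => rscale k^-1 (f (t + k + h) - f (t + h))) =
    (fun k => rscale k^-1 (f (t + h + k) - f (t + h))) by apply/funext => k; rewrite addrAC.
by [].
Qed.

(** Integrating orbits over [0, b] gives a bounded operator into the domain,
    commuting with the semigroup; as [b] tends to 0, the mean values
    of the orbit of [x] tend to [x], so that such elements are dense. *)
Lemma smoothing (x : V) (e : R) : 0 < e -> exists (Phi : V -> V) (x' : V),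
  [/\ rnorm (Phi x' - x) < e, forall z, D (Phi z),
      (forall y z, Phi (y - z) = Phi y - Phi z) /\
      (forall a z, Phi (rscale a z) = rscale a (Phi z)),
      exists c : R, forall z, rnorm (Phi z) <= c * rnorm z &
      forall (t : R) z, 0 <= t -> S t (Phi z) = Phi (S t z)].
Proof.
move=> e0; case: S_C0 => [Sc S0 SD _].
have /choice[J hJ] z : exists I : R -> V, [/\ continuous I, I 0 = 0 &
    forall t, 0 <= t < 2 -> rderiv I t (S (pos t) z)].
  have cS := @orbit_cont _ _ _ _ S_C0 z.
  have [I [cI I0 _ dI]] := uapprox_antiderivative (ler0n R 2) (uapprox_cont 0 2 cS).
  by exists I; split => // t t2; apply: dI => //; exact: cont_rcont.
have cJ z : continuous (J z) by have [] := hJ z.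
have J0 z : J z 0 = 0 by have [] := hJ z.
have dJ z t : 0 <= t < 2 -> rderiv (J z) t (S (pos t) z) by have [_ _] := hJ z; exact.
have uniq z (G : R -> V) c : 0 <= c < 2 -> continuous G -> G 0 = 0 ->
    (forall t, 0 <= t < c -> rderiv G t (S (pos t) z)) -> G c = J z c.
  move=> /andP[c0 c2] cG G0 dG.
  have := @rderiv0_const _ _ _ (fun t => G t - J z t) 0 c c0.
  rewrite G0 J0 subrr => H; apply/eqP; rewrite -subr_eq0; apply/eqP/H.
    by move=> t; apply: cvgB; [exact: cG|exact: cJ].
  move=> t /andP[t0 tc]; rewrite -(subrr (S (pos t) z)); apply: rderivB.
    by apply: dG; rewrite t0.
  by apply: dJ; rewrite t0 (lt_trans tc).
have JB b y z : 0 <= b < 2 -> J (y - z) b = J y b - J z b.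
  move=> /andP[b0 b2]; apply/esym; rewrite -[LHS]/((fun s => J y s - J z s) b).
  apply: uniq; rewrite ?b0 ?J0 ?subrr//.
    by move=> t; apply: cvgB; exact: cJ.
  move=> t /andP[t0 tb]; rewrite linearB.
  by apply: rderivB; apply: dJ; rewrite t0 (lt_trans tb).
have JZ b a z : 0 <= b < 2 -> J (rscale a z) b = rscale a (J z b).
  move=> /andP[b0 b2]; apply/esym; rewrite -[LHS]/((fun s => rscale a (J z s)) b).
  apply: uniq; rewrite ?b0 ?J0 ?rscaler0//.
    by move=> t; apply: cvg_rscale; [exact: cvg_cst|exact: cJ].
  move=> t /andP[t0 tb]; rewrite linear_rscale.
  by apply: rderiv_rscale; apply: dJ; rewrite t0 (lt_trans tb).
have SJ b z t : 0 <= b < 2 -> 0 <= t -> S t (J z b) = J (S t z) b.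
  move=> /andP[b0 b2] t0; rewrite -[LHS]/((S t \o J z) b).
  apply: uniq; rewrite ?b0 /= ?J0 ?linear0//.
    by move=> s; apply: (@continuous_comp _ _ _ (J z) (S t)); [exact: cJ|exact: Sc].
  move=> s /andP[s0 sb]; rewrite posE// -SD// addrC SD// -{2}(posE s0).
  by apply: rderiv_linear; [exact: Sc|apply: dJ; rewrite s0 (lt_trans sb)].
have JD b z : 0 < b < 1 -> D (J z b).
  move=> /andP[b0 b1]; have b2 : b < 2 by rewrite (lt_trans b1)// ltr1n.
  suff h : rscale h^-1 (S h (J z b) - J z b) @[h --> 0^'+] --> S b z - z.
    by have [] := cvg_generator h.
  have hb : rderiv (J z) b (S b z) by rewrite -{2}(posE (ltW b0)); apply: dJ; rewrite ltW.
  have h0 : rderiv (J z) 0 z.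
    by have := dJ z 0; rewrite posE// S0 lexx ltr0n; exact.
  apply: cvg_trans (cvgB hb h0); apply: near_eq_cvg.
  near=> h; have hpos : 0 < h by near: h; exact: nbhs_right_gt.
  have h1 : h < 1 by near: h; exact: nbhs_right_lt.
  have -> : S h (J z b) = J z (b + h) - J z h.
    rewrite SJ ?(ltW b0) ?(ltW hpos)//; apply/esym.
    rewrite -[LHS]/((fun s => J z (s + h) - J z h) b).
    apply: uniq; rewrite ?(ltW b0) ?add0r ?subrr//.
      move=> t; apply: cvgB; last exact: cvg_cst.
      apply: (@continuous_comp _ _ _ (fun s => s + h) (J z)); last exact: cJ.
      by apply: cvgD; [exact: cvg_id|exact: cvg_cst].
    move=> t /andP[t0 tb]; rewrite -SD ?pos_ge0 ?(ltW hpos)// posE//.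
    rewrite -[S _ z]subr0; apply: rderivB.
      apply: rderiv_shift; rewrite -{2}(@posE R (t + h)) ?addr_ge0// ?(ltW hpos)//.
      apply: dJ; rewrite addr_ge0// ?(ltW hpos)//=.
      by rewrite (_ : 2 = 1 + 1)// ltrD// (lt_trans tb).
    apply/rderivP => r r0; exists 1 => // k /andP[k0 _].
    by rewrite subrr rscaler0 subrr rnorm0 mulr_ge0// ltW.
  rewrite -[LHS]/(rscale h^-1 (J z (b + h) - J z b) - rscale h^-1 (J z (0 + h) - J z 0)).
  by rewrite -rscaleBr add0r J0 subr0 addrAC.
have e20 : 0 < e / 2 by rewrite divr_gt0.
have h0 : rderiv (J x) 0 x by have := dJ x 0; rewrite posE// S0 lexx ltr0n; exact.
have [d d0 hd] := (rderivP _ _ _).1 h0 _ e20.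
pose b := Num.min (d / 2) (1 / 2).
have b0 : 0 < b by rewrite lt_min !divr_gt0.
have bd : b < d by rewrite gt_min ltr_pdivrMr// ltr_pMr// ltr1n.
have b1 : b < 1 by rewrite gt_min (_ : 1 / 2 < 1 = true) ?orbT// ltr_pdivrMr// mul1r ltr1n.
have b2 : 0 <= b < 2 by rewrite ltW//= (lt_trans b1)// ltr1n.
have [M M0 hM] := semigroup_bound S_C0 1.
exists (fun z => J z b), (rscale b^-1 x); split.
- rewrite JZ//; have := hd b; rewrite b0 bd add0r J0 subr0 => /(_ isT) h.
  have -> : rscale b^-1 (J x b) - x = rscale b^-1 (J x b - rscale b x).
    by rewrite rscaleBr rscaleVK// gt_eqF.
  rewrite rnorm_scale gtr0_norm ?invr_gt0// mulrC ltr_pdivrMr//.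
  apply: le_lt_trans h _; rewrite ltr_pM2r// ltr_pdivrMr// ltr_pMr// ltr1n//.
- by move=> z; apply: JD; rewrite b0.
- by split => *; [exact: JB|exact: JZ].
- exists (M * b) => z; have := @mean_value_le _ _ _ (J z) 0 b (M * rnorm z) (ltW b0) (cJ z).
  rewrite J0 !subr0 mulrAC; apply => t /andP[t0 tb].
  exists (S (pos t) z); first by apply: dJ; rewrite t0 (lt_trans tb (lt_trans b1 _))// ltr1n.
  by apply: hM; rewrite pos_ge0 posE// ltW// (lt_trans tb).
- by move=> t z t0; exact: SJ.
Unshelve. all: by end_near. Qed.

(** The product rule behind the variation of constants formula: the derivative
    [v] of the vector and the generator coming from the semigroup appear as a
    difference. The increment over [h] is [S (t - s - h)] applied to a difference
    of two forward quotients, so that no backward derivative is needed. *)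
Lemma duhamel_rderiv (y : R -> V) (t s : R) (v : V) : 0 <= s < t ->
  D (y s) -> rderiv y s v ->
  rderiv (fun r => S (pos (t - r)) (y r)) s (S (pos (t - s)) (v - A (y s))).
Proof.
move=> /andP[s0 st] Dy yv; case: S_C0 => [Sc S0 SD _].
pose w := v - A (y s); pose u h := rscale h^-1 (y (s + h) - y s) - rscale h^-1 (S h (y s) - y s).
have uw : u h @[h --> 0^'+] --> w by apply: cvgB => //; exact: generator_cvg.
have [M M0 hM] := semigroup_bound S_C0 t.
have cw := @orbit_cont _ _ _ _ S_C0 w; apply/rcvgP => e e0.
have e20 : 0 < e / 2 by rewrite divr_gt0.
have eM : 0 < e / (2 * M) by rewrite divr_gt0// mulr_gt0.
have [d d0 hd] : exists2 d : R, 0 < d & forall h, 0 < h < d ->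
    rnorm (S (pos (t - s - h)) w - S (pos (t - s)) w) < e / 2.
  have /rcvgP/(_ _ e20) := cw (t - s); move=> /nbhs_ballP[d /= d0 hd].
  exists d => // h /andP[h0 hd']; apply: hd.
  by rewrite /ball /= opprB addrCA subrr addr0 gtr0_norm.
near=> h; have h0 : 0 < h by near: h; exact: nbhs_right_gt.
have hts : h < t - s by near: h; apply: nbhs_right_lt; rewrite subr_gt0.
have hdd : h < d by near: h; exact: nbhs_right_lt.
have uh : rnorm (u h - w) < e / (2 * M) by near: h; exact/(rcvgP _ _).1.
have tsh : 0 <= t - s - h by rewrite subr_ge0 ltW.
have ts0 : 0 <= t - s by rewrite subr_ge0 ltW.
have -> : rscale h^-1 (S (pos (t - (s + h))) (y (s + h)) - S (pos (t - s)) (y s)) =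
    S (t - s - h) (u h).
  rewrite opprD addrA !posE// -{2}(subrK h (t - s)) (SD (t - s - h) h) ?(ltW h0)//.
  by rewrite -linearB -linear_rscale /u -rscaleBr opprB addrA subrK.
have := hd h; rewrite h0 hdd posE// => /(_ isT) h2.
apply: le_lt_trans (rnorm_triangle (S (t - s - h) w) _ _) _.
rewrite [ltRHS]splitr ltrD// -linearB (le_lt_trans (hM _ _ _))//.
  by rewrite tsh /= -addrA -opprD lerBlDr lerDl addr_ge0// ltW.
by rewrite mulrC -ltr_pdivlMr// -mulrA -invfM.
Unshelve. all: by end_near. Qed.

End Generator.

(** * Series in L1 *)
Section L1Completeness.
Variables (R : realType) (cplx : bool).
Local Notation K := (scalars R cplx).
Local Notation mu := (@lebesgue_measure R).

Lemma uapprox_rnorm_measurable (V : normedModType K) (D : set R) (f : R -> V) :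
  measurable D -> uapprox D f -> measurable_fun D (fun x => rnorm (f x)).
Proof.
move=> mD /uapprox_seq[s hs].
apply: (@measurable_fun_cvg _ _ _ _ (fun n x => rnorm (step_eval (s n) x))).
  by move=> n; exact: rnorm_step_measurable.
move=> x Dx; apply: cvg_rnorm; apply/rcvgP => e e0.
apply: filterS (cvgr_lt _ (@cvg_invS R) _ e0) => n; apply: le_lt_trans.
by rewrite rnormBC; exact: hs.
Qed.

Lemma strongly_measurable_limit (V : normedModType K) (D : set R) (fk : nat -> R -> V) f :
  (forall k, uapprox D (fk k)) ->
  {ae mu, forall x, D x -> fk k x @[k --> \oo] --> f x} -> strongly_measurable D f.
Proof.
move=> ufk fkf.
have /choice[s hs] k : exists s : step_fun V, forall x, D x ->
    rnorm (fk k x - step_eval s x) <= k.+1%:R^-1.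
  by apply: ufk; rewrite invr_gt0.
exists s; apply: ae_impl fkf => x fx Dx; apply/rcvgP => e e0.
have e20 : 0 < e / 2 by rewrite divr_gt0.
have /rcvgP/(_ _ e20) h1 := fx Dx.
have h2 := cvgr_lt _ (@cvg_invS R) _ e20.
near=> n.
apply: le_lt_trans (rnorm_triangle (fk n x) _ _) _.
have h1n : rnorm (fk n x - f x) < e / 2 by near: n.
have h2n : n.+1%:R^-1 < e / 2 by near: n; exact: h2.
rewrite [ltRHS]splitr; apply: ltrD h1n.
by rewrite rnormBC; exact: le_lt_trans (hs n x Dx) h2n.
Unshelve. all: by end_near. Qed.

Variable V : completeNormedModType K.

Lemma summable_cvg (a : nat -> V) (G : R) :
  (forall N, \sum_(k < N) rnorm (a k) <= G) ->
  exists l : V, (\sum_(k < n) a k) @[n --> \oo] --> l.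
Proof.
move=> aG; pose s n := \sum_(k < n) rnorm (a k).
have s_nd : {homo s : n m / (n <= m)%N >-> n <= m}.
  move=> n m nm; rewrite -(subnKC nm) /s big_split_ord /= lerDl.
  by apply: sumr_ge0 => i _; exact: rnorm_ge0.
have cs : cvgn s.
  apply: nondecreasing_is_cvgn => //; exists G => _ [n _ <-]; exact: aG.
pose e n := limn s - s n.
have e0 : e n @[n --> \oo] --> 0.
  by rewrite -(subrr (limn s)); apply: cvgB; [exact: cvg_cst|exact: cs].
have e_ge0 n : 0 <= e n by rewrite subr_ge0; exact: nondecreasing_cvgn_le.
apply: (rcauchy_cvg e0) => k l.
wlog kl : k l / (k <= l)%N.
  move=> H; case: (leqP k l) => [|/ltnW] kl; first exact: H.
  by rewrite rnormBC [leRHS]addrC; exact: H.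
have : rnorm (\sum_(k0 < l) a k0 - \sum_(k0 < k) a k0) <= s l - s k.
  rewrite -(subnKC kl) /s !big_split_ord /= !(addrC (\sum_(i < k) _)) !addrK.
  elim/big_ind2: _ => [|x1 x2 y1 y2 h1 h2|//]; first by rewrite rnorm0.
  by rewrite (le_trans (ler_rnormD _ _))// lerD.
rewrite rnormBC => /le_trans; apply.
by have := e_ge0 l; rewrite /e; lra.
Qed.

(** The Riesz-Fischer argument: the series of norms has a finite integral, so
    it is finite almost everywhere, and its tails dominate the remainders. *)
Lemma L1_series (D : set R) (a : nat -> R -> V) : measurable D -> (mu D < +oo)%E ->
  (forall k, uapprox D (a k)) ->
  (forall k, (norm_L1 D (a k) <= (3^-1 ^+ k)%:E)%E) ->
  exists u : R -> V, [/\ in_L1 D u,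
    {ae mu, forall x, D x -> (\sum_(k < n) a k x) @[n --> \oo] --> u x} &
    forall n, (norm_L1 D (fun x => u x - \sum_(k < n) a k x)%R <= (3 / 2 * 3^-1 ^+ n)%:E)%E].
Proof.
move=> mD fD ua na.
pose r n x : \bar R := (rnorm (a n x))%:E.
have r0 n x : (0 <= r n x)%E by rewrite lee_fin rnorm_ge0.
have mr n : measurable_fun D (r n).
  by apply/measurable_EFinP; exact: uapprox_rnorm_measurable.
pose g n x := (\sum_(0 <= k <oo) r (n + k)%N x)%E.
have g0 n x : (0 <= g n x)%E by apply: nneseries_ge0.
have mg n : measurable_fun D (g n) by apply: ge0_emeasurable_sum.
have Ig n : (\int[mu]_(x in D) g n x <= (3 / 2 * 3^-1 ^+ n)%:E)%E.
  rewrite integral_nneseries//; last by move=> k; exact: mr.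
  apply: lime_le; first by apply: is_cvg_nneseries => k _ _; exact: integral_ge0.
  apply: nearW => N.
  apply: (@le_trans _ _ (3 / 2 * (3^-1 ^+ n - 3^-1 ^+ (n + N)))%:E); last first.
    by rewrite lee_fin ler_pM2l// lerBlDr lerDl exprn_ge0// invr_ge0.
  elim: N => [|N IH]; first by rewrite big_geq// addn0 subrr mulr0.
  rewrite big_nat_recr//= (le_trans (leeD IH (na _)))//.
  rewrite -EFinD lee_fin addnS exprS; move: (3^-1 ^+ (n + N)) => q; lra.
have gfin : {ae mu, forall x, D x -> g 0%N x \is a fin_num}.
  apply: integrable_ae => //; apply/integrableP; split; first exact: mg.
  apply: (le_lt_trans _ (ltry (3 / 2 * 3^-1 ^+ 0 : R))); apply: le_trans (Ig 0%N).
  by apply: ge0_le_integral_nomeas => x _; rewrite ?abse_ge0// gee0_abs.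
have partial_le n N x : (\sum_(0 <= k < N) r (n + k)%N x <= g n x)%E.
  exact: nneseries_lim_ge.
have g_cvg n x : g n x \is a fin_num -> exists l : V, (\sum_(k < m) a (n + k)%N x) @[m --> \oo] --> l.
  move=> fg; apply: (@summable_cvg (fun k => a (n + k)%N x) (fine (g n x))) => N.
  by rewrite -lee_fin fineK// -sumEFin -(big_mkord xpredT (fun k => r (n + k)%N x)).
pose u x : V := xget 0 [set l | (\sum_(k < n) a k x) @[n --> \oo] --> l].
have uE x l : (\sum_(k < n) a k x) @[n --> \oo] --> l -> u x = l.
  move=> al; rewrite /u; case: xgetP => [l' _ /= al'|/(_ l)//].
  exact: (cvg_unique _ al' al).
have cvg_shift n x l : (\sum_(k < m) a (n + k)%N x) @[m --> \oo] --> l ->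
    (\sum_(k < m) a k x) @[m --> \oo] --> \sum_(k < n) a k x + l.
  move=> al; rewrite -(cvg_shiftn n).
  under eq_fun do rewrite addnC big_split_ord /=.
  by apply: cvgD => //; exact: cvg_cst.
have dom n x : ((rnorm (u x - \sum_(k < n) a k x))%:E <= g n x)%E.
  have [gf|] := boolP (g n x \is a fin_num); last first.
    by rewrite ge0_fin_numE// -leNgt leye_eq => /eqP ->; rewrite leey.
  have [l al] := g_cvg n x gf.
  rewrite (uE _ _ (cvg_shift _ _ _ al)) addrC addKr.
  rewrite -(fineK gf) lee_fin.
  apply: (cvgr_to_le (cvg_rnorm al)).
  apply: nearW => N; rewrite -lee_fin fineK//; apply: le_trans (partial_le n N x).
  rewrite /r sumEFin lee_fin big_mkord.
  elim/big_ind2: _ => [|x1 x2 y1 y2 h1 h2|//]; first by rewrite rnorm0.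
  by rewrite (le_trans (ler_rnormD _ _))// lerD.
have nL n : (norm_L1 D (fun x => u x - \sum_(k < n) a k x)%R <= (3 / 2 * 3^-1 ^+ n)%:E)%E.
  apply: le_trans (Ig n); apply: ge0_le_integral_nomeas => x Dx; last exact: dom.
  by rewrite lee_fin rnorm_ge0.
have ucv : {ae mu, forall x, D x -> (\sum_(k < n) a k x) @[n --> \oo] --> u x}.
  apply: ae_impl gfin => x gx Dx.
  have [l] := g_cvg 0%N x (gx Dx).
  under eq_fun do under eq_bigr do rewrite add0n.
  by move=> al; rewrite (uE _ _ al).
exists u; split => //; split.
  apply: (@strongly_measurable_limit _ _ (fun n x => \sum_(k < n) a k x)) => // n.
  by apply: uapprox_sum.
apply: (@le_lt_trans _ _ (3 / 2 * 3^-1 ^+ 0)%:E); last by rewrite ltry.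
have := nL 0%N; rewrite /norm_L1.
by under eq_integral do rewrite big_ord0 subr0.
Qed.

End L1Completeness.

(** * Scalar multiples of Bochner integrals *)
Section BochnerScale.
Variables (R : realType) (cplx : bool).
Local Notation K := (scalars R cplx).
Local Notation mu := (@lebesgue_measure R).
Variable V : normedModType K.

Lemma step_rscale (a : R) (s : step_fun V) : exists2 t : step_fun V,
  forall x, step_eval t x = rscale a (step_eval s x) &
  forall D, step_int D t = rscale a (step_int D s).
Proof.
exists (StepFun (fun i => rscale a (@sf_val _ _ _ s i)) (@sf_measurable _ _ _ s)
  (@sf_finite _ _ _ s)) => [x|E]; rewrite [RHS]scaler_sumr; apply: eq_bigr => i _;
  by rewrite /= rscaleA [RHS]rscaleA mulrC.
Qed.

Lemma uapprox_rscale (D : set R) (f : R -> V) (a : R) : uapprox D f ->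
  uapprox D (fun x => rscale a (f x)).
Proof.
move=> fD e e0; have a1 : 0 < `|a| + 1 by rewrite ltr_wpDl.
have ea : 0 < e / (`|a| + 1) by rewrite divr_gt0.
have [s hs] := fD _ ea; have [t tE _] := step_rscale a s; exists t => x /hs.
rewrite tE -rscaleBr rnorm_scale ler_pdivlMr// mulrC; apply: le_trans.
by rewrite ler_wpM2r ?rnorm_ge0// lerDl.
Qed.

Lemma cvg_rnorm_bounded (v : nat -> V) (l : V) : v n @[n --> \oo] --> l ->
  exists m : R, forall n, rnorm (v n) <= m.
Proof.
move=> /rcvgP/(_ 1 ltr01)[N _ hN].
exists (\sum_(n < N) rnorm (v n) + (rnorm l + 1)) => n.
have sum_ge0 : 0 <= \sum_(n < N) rnorm (v n).
  by apply: sumr_ge0 => i _; exact: rnorm_ge0.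
have [nN|Nn] := ltnP n N.
  rewrite (bigD1 (Ordinal nN))//= -addrA lerDl addr_ge0//.
    by apply: sumr_ge0 => i _; exact: rnorm_ge0.
  by rewrite addr_ge0// rnorm_ge0.
rewrite ler_wpDl// -{1}(subrK l (v n)) (le_trans (ler_rnormD _ _))// addrC lerD2l.
exact/ltW/(hN n Nn).
Qed.

Lemma is_bochner_rscale (D : set R) (f : R -> V) v (a : R) : measurable D ->
  is_bochner_int D f v -> is_bochner_int D (fun x => rscale a (f x)) (rscale a v).
Proof.
move=> mD fv.
apply: is_bochner_intP.
  have [s hs] := fv.1.
  have /choice[t ht] n : exists t : step_fun V, forall x, step_eval t x = rscale a (step_eval (s n) x).
    by have [t tE _] := step_rscale a (s n); exists t.
  exists t; apply: ae_impl hs => x hx Dx; under eq_fun do rewrite ht.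
  by apply: cvg_rscale; [exact: cvg_cst|exact: hx].
move=> e e0; have a1 : 0 < `|a| + 1 by rewrite ltr_wpDl.
have ea : 0 < e / (`|a| + 1) by rewrite divr_gt0.
have ale : `|a| * (e / (`|a| + 1)) <= e.
  by rewrite mulrA ler_pdivrMr// mulrC ler_wpM2l ?(ltW e0)// lerDl.
have [s [fs sv]] := is_bochner_approx ea fv.
have [t tE tI] := step_rscale a s; exists t; split.
  apply: (@le_trans _ _ (`|a|%:E * (e / (`|a| + 1))%:E)%E); last by rewrite -EFinM lee_fin.
  apply: le_trans (lee_wpmul2l _ fs); last by rewrite lee_fin.
  apply: norm_L1Z_le => //.
    by apply: strongly_measurableB fv.1 _; exact: step_strongly_measurable.
  by move=> x _; rewrite tE -rscaleBr rnorm_scale.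
rewrite tI -rscaleBr rnorm_scale; apply: le_trans ale.
by rewrite ler_wpM2l.
Qed.

End BochnerScale.

(** * Admissible control operators *)
Section Admissibility.
Variables (R : realType) (cplx : bool).
Local Notation K := (scalars R cplx).
Local Notation mu := (@lebesgue_measure R).

(** For a step function [u] the integrand is a finite sum of orbits multiplied by
    indicators; the local bound of the semigroup makes the passage to uniform
    limits possible. *)
Lemma uapprox_semigroup (U V : completeNormedModType K) (S : R -> {linear V -> V})
    (B : {linear U -> V}) (T : R) (u : R -> U) :
  C0_semigroup S -> continuous B -> uapprox `[0, T] u ->
  uapprox `[0, T] (fun s => S (T - s) (B (u s))).
Proof.
move=> SC cB uu.
have [M M0 hM] := semigroup_bound SC T.
have [c c0 hc] := linear_cont_bound cB.
apply: uapprox_close => e e0.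
have eMc : 0 < e / (M * c) by rewrite divr_gt0// mulr_gt0.
have [s hs] := uu _ eMc.
have ST x : `[0, T]%classic x -> 0 <= T - x <= T.
  by rewrite /= in_itv /= => /andP[x0 xT]; rewrite subr_ge0 xT lerBlDr lerDl.
exists (fun x => \sum_i rscale (\1_(@sf_set _ _ _ s i) x) (S (pos (T - x)) (B (@sf_val _ _ _ s i)))).
  apply: uapprox_sum => i; apply: uapprox_indic; first exact: sf_measurable.
  apply: uapprox_cont; apply: (semigroup_cont SC).
    by move=> x; apply: cvgB; [exact: cvg_cst|exact: cvg_id].
  by move=> x; exact: cvg_cst.
move=> x /[dup] Tx /ST Tx0; rewrite (@posE R (T - x)); last by case/andP: Tx0.
have -> : \sum_i rscale (\1_(@sf_set _ _ _ s i) x) (S (T - x) (B (@sf_val _ _ _ s i))) =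
    S (T - x) (B (step_eval s x)).
  rewrite /step_eval !linear_sum; apply: eq_bigr => i _.
  by rewrite !linear_rscale.
rewrite -!linearB (le_trans (hM _ _ Tx0))// -ler_pdivlMl//.
apply: le_trans (hc _) _; rewrite -ler_pdivlMl//.
have -> : c^-1 * (M^-1 * e) = e / (M * c) by field; rewrite !gt_eqF.
exact: hs.
Qed.

Variables (X Xm U : completeNormedModType K).
Variables (j : {linear X -> Xm}) (Sm : R -> {linear Xm -> Xm}) (B : {linear U -> Xm}).
Hypothesis Sm_C0 : C0_semigroup Sm.
Hypothesis B_cont : continuous B.
Hypothesis j_inj : injective j.
Variables (L : nat -> X -> X) (c : nat -> R).
Hypothesis L_additive : forall n x y, L n (x - y) = L n x - L n y.
Hypothesis c_ge0 : forall n, 0 <= c n.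
Hypothesis L_bound : forall n x, rnorm (L n x) <= c n * rnorm (j x).
Hypothesis L_cvg : forall x, L n x @[n --> \oo] --> x.
Variable T : R.

Let conv (u : R -> U) (s : R) : Xm := Sm (T - s) (B (u s)).

Hypothesis range_conv : forall u : R -> U, in_L1 `]0, T[ u ->
  range j (bochner_int `]0, T[ (conv u)).

Let D : set R := `]0, T[.

Let mD : measurable D. Proof. exact: measurable_itv. Qed.

Let fD : (mu D < +oo)%E.
Proof. by rewrite lebesgue_measure_itv /=; case: ifP => _; rewrite ?ltry// -EFinB ltry. Qed.

Let out (u : R -> U) : X := emb_inv j (bochner_int D (conv u)).

(** Admissibility: the control-to-state map, which takes values in [X] by
    hypothesis, is bounded from L1 to [X]. The operators [L n] are bounded for
    the weak norm and tend pointwise to the identity of [X], so the uniform boundedness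
    argument applies to their composites with the map; the sums it constructs
    converge in L1. *)
Lemma admissible_bound : exists2 k : R, 0 < k & forall (u : R -> U) (x : X),
  uapprox `[0, T] u -> is_bochner_int `]0, T[ (fun s => Sm (T - s) (B (u s))) (j x) ->
  ((rnorm x)%:E <= k%:E * norm_L1 `]0%R, T[ u)%E.
Proof.
have outE u x : is_bochner_int D (conv u) (j x) -> out u = x.
  move=> ux; rewrite /out (bochner_intE mD fD ux) /emb_inv.
  by case: xgetP => [y _ /= /j_inj ->//|/(_ x) nx]; case: nx.
have [M M0 hM] := semigroup_bound Sm_C0 T.
have [b b0 hb] := linear_cont_bound B_cont.
have D01 : D `<=` `[0, T] by exact: subset_itv_oo_cc.
have conv_le u x : D x -> rnorm (conv u x) <= M * b * rnorm (u x).
  rewrite /D /= in_itv /= => /andP[x0 xT]; rewrite -mulrA /conv.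
  apply: le_trans (hM _ _ _) _; last by rewrite ler_pM2l.
  by rewrite subr_ge0 (ltW xT) lerBlDr lerDl ltW.
have convB u w x : conv u x - conv w x = conv (fun x => u x - w x) x.
  by rewrite /conv !linearB.
have Mb0 : 0 <= M * b by rewrite mulr_ge0// ltW.
have convL1 u : strongly_measurable D u ->
    (norm_L1 D (conv u) <= (M * b)%:E * norm_L1 D u)%E.
  by move=> mu_; apply: norm_L1Z_le => // x; exact: conv_le.
have UD (u : R -> U) : uapprox `[0, T] u -> uapprox D u by exact: uapprox_subset.
have outP u : uapprox `[0, T] u -> is_bochner_int D (conv u) (j (out u)).
  move=> uu.
  have [v uv] : exists v, is_bochner_int D (conv u) v.
    apply: uapprox_bochner => //; apply: uapprox_subset D01 _.
    exact: uapprox_semigroup.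
  have [x _] := range_conv (uapprox_in_L1 mD fD (UD u uu)).
  rewrite (bochner_intE mD fD uv) => xv; rewrite -xv in uv.
  by rewrite (outE _ _ uv).
have outB u w : uapprox `[0, T] u -> uapprox `[0, T] w -> out (u - w) = out u - out w.
  move=> uu ww; apply: outE; rewrite linearB.
  have := is_bochnerB mD (outP u uu) (outP w ww).
  by under eq_fun do rewrite convB.
have P0 : uapprox `[0, T] (0 : R -> U) by exact: uapprox0.
have PN (u : R -> U) : uapprox `[0, T] u -> uapprox `[0, T] (- u) by exact: uapproxN.
have PD (u w : R -> U) : uapprox `[0, T] u -> uapprox `[0, T] w -> uapprox `[0, T] (u + w).
  exact: uapproxD.
have out0 : out 0 = 0 by rewrite -[0 in LHS](subrr 0) outB// subrr.
have outN u : uapprox `[0, T] u -> out (- u) = - out u.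
  by move=> uu; rewrite -sub0r outB// out0 sub0r.
have outD u w : uapprox `[0, T] u -> uapprox `[0, T] w -> out (u + w) = out u + out w.
  by move=> uu ww; have := outB u (- w) uu (PN w ww); rewrite outN// !opprK.
have L0 n : L n 0 = 0 by have := L_additive n 0 0; rewrite !subrr.
have LN n x : L n (- x) = - L n x by rewrite -sub0r L_additive L0 sub0r.
have LD n x y : L n (x + y) = L n x + L n y by rewrite -{1}(opprK y) L_additive LN opprK.
have finL1 (u : R -> U) : uapprox `[0, T] u -> norm_L1 D u \is a fin_num.
  by move=> uu; rewrite ge0_fin_numE ?norm_L1_ge0//; have [] := uapprox_in_L1 mD fD (UD u uu).
have jout (u : R -> U) : uapprox `[0, T] u -> rnorm (j (out u)) <= M * b * fine (norm_L1 D u).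
  move=> uu; rewrite -lee_fin EFinM fineK ?finL1//.
  apply: le_trans (is_bochner_norm mD fD (outP u uu)) _.
  by apply: convL1; apply: uapprox_strongly_measurable; exact: UD.
have [|||||||||r [q [r0 hr]]] := @gliding_hump R (R -> U : zmodType) (uapprox `[0, T])
  (fun u => fine (norm_L1 D u)) nat (fun n u => rnorm (L n (out u)))
  (fun n => c n * (M * b)).
- by [].
- by [].
- by [].
- by rewrite /norm_L1 integral0_eq// => x _; rewrite rnorm0.
- by move=> n; rewrite mulr_ge0.
- by move=> n u w uu ww; rewrite outD// LD ler_rnormD.
- by move=> n u uu; rewrite outN// LN rnormN.
- move=> n u uu; rewrite (le_trans (L_bound n _))// -mulrA ler_wpM2l//.
  exact: jout.
- move=> a ua na.
  have naD k : (norm_L1 D (a k) <= (3^-1 ^+ k)%:E)%E.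
    by rewrite -(fineK (finL1 _ (ua k))) lee_fin.
  have [u [u_L1 u_cvg u_rem]] := L1_series mD fD (fun k => UD _ (ua k)) naD.
  pose s n : R -> U := fun x => \sum_(k < n) a k x.
  have us n : uapprox `[0, T] (s n) by exact: uapprox_sum.
  have sE n : \sum_(k < n) a k = s n by rewrite fct_sumE.
  pose e n : R := M * b * (3 / 2 * 3^-1 ^+ n).
  have e0 : e n @[n --> \oo] --> 0.
    rewrite -(mulr0 (M * b)) -(mulr0 (3 / 2)).
    apply: cvgM; first exact: cvg_cst; apply: cvgM; first exact: cvg_cst.
    by apply: cvg_expr; rewrite ger0_norm ?invr_ge0// invf_lt1// ltr1n.
  have mconv : strongly_measurable D (conv u).
    apply: (@strongly_measurable_limit _ _ _ _ (fun n => conv (s n))).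
      by move=> n; apply: uapprox_subset D01 _; exact: uapprox_semigroup.
    apply: ae_impl u_cvg => x ux Dx.
    have cB : {for u x, continuous B} by exact: B_cont.
    have Tx : 0 <= T - x by move: Dx; rewrite /D /= in_itv /= => /andP[_ /ltW]; rewrite subr_ge0.
    have cS : {for B (u x), continuous (Sm (T - x))}.
      by have [h _ _ _] := Sm_C0; exact: h.
    have := cvg_comp _ _ (cvg_comp _ _ (ux Dx) cB) cS.
    by [].
  have rem n : (norm_L1 D (fun x => conv u x - conv (s n) x)%R <= (e n)%:E)%E.
    rewrite /e EFinM; apply: le_trans (lee_wpmul2l _ (u_rem n)); last by rewrite lee_fin.
    apply: norm_L1Z_le => //.
      apply: strongly_measurableB u_L1.1 _.
      by apply: uapprox_strongly_measurable; exact: (UD _ (us n)).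
    by move=> x Dx; rewrite convB conv_le.
  have [v uv sv] := is_bochner_limit mD fD mconv (fun n => outP _ (us n)) rem e0.
  have [x _] := range_conv u_L1; rewrite (bochner_intE mD fD uv) => xv.
  have [m bm] := cvg_rnorm_bounded (@L_cvg x).
  exists (m + 1) => n.
  have c1 : 0 < 1 / (c n + 1) by rewrite divr_gt0// ltr_wpDl.
  have /rcvgP/(_ _ c1)[k0 _ hk] := sv; exists k0 => k /hk.
  rewrite /= -xv -linearB ltr_pdivlMr ?ltr_wpDl// => /ltW sk.
  rewrite sE -(subrK x (out (s k))) LD (le_trans (ler_rnormD _ _))// addrC lerD//.
  apply: le_trans (L_bound _ _) _; apply: le_trans sk.
  by rewrite mulrC ler_wpM2l ?rnorm_ge0// lerDl.
have out_le (u : R -> U) : uapprox `[0, T] u -> fine (norm_L1 D u) <= r -> rnorm (out u) <= q.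
  move=> uu ur; apply: (cvgr_to_le (cvg_rnorm (@L_cvg (out u)))).
  by apply: nearW => n; exact: hr.
exists ((`|q| + 1) / r) => [|u x uu ux]; first by rewrite divr_gt0// ltr_wpDl.
have xE := outE _ _ ux.
rewrite -(fineK (finL1 u uu)) -EFinM lee_fin.
set p := fine (norm_L1 D u).
have p0 : 0 <= p by apply: fine_ge0; exact: norm_L1_ge0.
apply/ler_addgt0Pr => e e0.
pose d := e * r / (`|q| + 1).
have q1 : 0 < `|q| + 1 by rewrite ltr_wpDl.
have d0 : 0 < d by rewrite divr_gt0// mulr_gt0.
have pd0 : 0 < p + d by rewrite ltr_wpDl.
pose l := r / (p + d); have l0 : 0 < l by rewrite divr_gt0.
have uul : uapprox `[0, T] (fun s => rscale l (u s)).
  exact: uapprox_rscale.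
have outl : out (fun s => rscale l (u s)) = rscale l x.
  apply: outE; rewrite linear_rscale.
  have := is_bochner_rscale l mD ux.
  by under eq_fun do rewrite -!linear_rscale.
have := out_le _ uul; rewrite outl rnorm_scale gtr0_norm//.
have -> : fine (norm_L1 D (fun s => rscale l (u s))) <= r.
  rewrite -lee_fin fineK; last exact: finL1.
  apply: le_trans (norm_L1Z_le mD _ (ltW l0) (_ : forall y, D y -> rnorm (rscale l (u y)) <= l * rnorm (u y))) _.
  - by apply: uapprox_strongly_measurable; exact: UD.
  - by move=> y _; rewrite rnorm_scale gtr0_norm.
  rewrite -(fineK (finL1 u uu)) -EFinM lee_fin -/p /l mulrAC ler_pdivrMr//.
  by rewrite ler_pM2l// lerDl ltW.
move=> /(_ isT) lx.
have : rnorm x <= q / l by rewrite ler_pdivlMr// mulrC.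
move=> /le_trans; apply; apply: (@le_trans _ _ ((`|q| + 1) / l)).
  by rewrite ler_pM2r ?invr_gt0// ler_wpDr// ler_norm.
rewrite /l invf_div mulrA le_eqVlt; apply/orP; left; apply/eqP; rewrite /d.
by field; rewrite !gt_eqF.
Qed.

End Admissibility.

(** * Integrals of continuous real functions *)
Section RealIntegrals.
Variable R : realType.
Local Notation mu := (@lebesgue_measure R).
Implicit Types (f g N : R -> R).

Lemma cont_integrable a b f : continuous f -> mu.-integrable `[a, b] (EFin \o f).
Proof.
move=> cf; apply: continuous_compact_integrable; first exact: segment_compact.
exact: continuous_subspaceT.
Qed.

Lemma cont_primitive (a : R) N : continuous N ->
  exists P : R -> R, forall x, a < x -> is_derive x 1 P (N x).
Proof.
move=> cN; exists (fun x => \int[mu]_(t in `[a, x]) N t)%R => x ax.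
have xx : x < x + 1 by rewrite ltrDl.
have [dP PE] := @continuous_FTC1 R N (BLeft a) x (x + 1) xx (cont_integrable _ _ cN) ax (cN x).
by apply: DeriveDef; [exact: dP|rewrite -derive1E; exact: PE].
Qed.

Lemma Rintegral_primitive (a b : R) f F : a < b -> continuous f ->
  (forall x, a <= x <= b -> is_derive x 1 F (f x)) ->
  (\int[mu]_(x in `[a, b]) f x)%R = F b - F a.
Proof.
move=> ab cf dF; rewrite /Rintegral.
have dFx x : a <= x <= b -> derivable F x 1 by move=> /dF[].
have cFx x : a <= x <= b -> {for x, continuous F}.
  by move=> /dFx/derivable1_diffP/differentiable_continuous.
rewrite (@continuous_FTC2 R f F a b)//.
- exact: continuous_subspaceT.
- split.
  + by move=> x; rewrite in_itv /= => /andP[ax xb]; apply: dFx; rewrite !ltW.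
  + by apply: cvg_at_right_filter; apply: cFx; rewrite lexx ltW.
  + by apply: cvg_at_left_filter; apply: cFx; rewrite lexx ltW.
- move=> x; rewrite in_itv /= => /andP[ax xb].
  by rewrite derive1E; have [|_ ->] := dF x; rewrite ?ltW.
Qed.

Lemma norm_L1_cont (cplx : bool) (V : normedModType (scalars R cplx)) (T : R) (u : R -> V) :
  continuous u ->
  norm_L1 `]0, T[ u = ((\int[mu]_(x in `[0%R, T]) rnorm (u x))%R)%:E.
Proof.
move=> cu; have cru : continuous (fun x => rnorm (u x)).
  by move=> x; apply: cvg_rnorm; exact: cu.
have mru E : measurable E -> measurable_fun E (fun x => (rnorm (u x))%:E).
  move=> mE; apply/measurable_EFinP; apply: measurable_funS (continuous_measurable_fun cru) => //.
rewrite /norm_L1 integral_itv_obnd_cbnd; last by apply: mru; exact: measurable_itv.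
rewrite integral_itv_bndo_bndc; last by apply: mru; exact: measurable_itv.
by rewrite /Rintegral fineK//; apply: integrable_fin_num => //; exact: cont_integrable.
Qed.

Lemma upper_int_le (T : R) f g : continuous g ->
  (forall x, 0 <= x <= T -> f x <= g x) ->
  (upper_int `[0%R, T] f <= ((\int[mu]_(x in `[0%R, T]) g x)%R)%:E)%E.
Proof.
move=> cg fg; apply: ereal_inf_lbound; exists g => /=.
  split; first exact: cont_integrable.
  by apply: aeW => x /=; rewrite in_itv /=; exact: fg.
by rewrite /Rintegral fineK//; apply: integrable_fin_num => //; exact: cont_integrable.
Qed.

Lemma le_upper_int (T : R) f f' : continuous f -> (forall x, 0 <= f x) ->
  (forall x, 0 < x < T -> f x <= f' x) ->
  (((\int[mu]_(x in `[0%R, T]) f x)%R)%:E <= upper_int `]0%R, T[ f')%E.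
Proof.
move=> cf f0 ff'; apply: le_ereal_inf_tmp => _ /= [g [ig fg] <-].
have mfE E : measurable E -> measurable_fun E (fun x => (f x)%:E).
  move=> mE; apply/measurable_EFinP; apply: measurable_funS (continuous_measurable_fun cf) => //.
have -> : ((\int[mu]_(x in `[0%R, T]) f x)%R)%:E = (\int[mu]_(x in `]0%R, T[) (f x)%:E)%E.
  rewrite integral_itv_obnd_cbnd; last by apply: mfE; exact: measurable_itv.
  rewrite integral_itv_bndo_bndc; last by apply: mfE; exact: measurable_itv.
  by rewrite /Rintegral fineK//; apply: integrable_fin_num => //; exact: cont_integrable.
have mD : measurable (`]0, T[%classic : set R) by exact: measurable_itv.
have [E [mE E0 hE]] := fg.
rewrite (ge0_integral_setD_null mE E0); last by move=> x _; rewrite lee_fin.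
rewrite (negligible_integral mE mD ig E0).
apply: ge0_le_integral_nomeas => x [Dx Ex]; first by rewrite lee_fin.
have {}ff' : f x <= f' x by apply: ff'; move: Dx; rewrite /= in_itv.
rewrite lee_fin; apply: contrapT => nfg; apply: Ex; apply: hE => /= /(_ Dx) f'g.
by apply: nfg; exact: le_trans f'g.
Qed.

Lemma Rintegral_shift_le (t T : R) f : 0 < t <= T -> continuous f -> (forall x, 0 <= f x) ->
  (\int[mu]_(x in `[T - t, T]) f (x - (T - t)))%R <= (\int[mu]_(x in `[0, T]) f x)%R.
Proof.
move=> /andP[t0 tT] cf f0; set a := T - t.
have a0 : 0 <= a by rewrite subr_ge0.
have aT : a < T by rewrite /a ltrBlDr ltrDl.
have [P dP] := cont_primitive (-1) cf.
have N10 : (-1 : R) < 0 by rewrite oppr_lt0.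
have cfa : continuous (fun x => f (x - a)).
  move=> x; apply: (@continuous_comp _ _ _ (fun x => x - a) f); last exact: cf.
  by apply: cvgB; [exact: cvg_id|exact: cvg_cst].
have dPa x : a <= x <= T -> is_derive x 1 (P \o (fun x => x - a)) (f (x - a)).
  move=> /andP[ax _]; have dsh : is_derive x 1 (fun x => x - a) (1 - 0) by exact: is_deriveB.
  rewrite -[f _]mulr1 -[X in _ * X]subr0.
  apply: is_derive1_comp dsh; apply: dP; apply: lt_le_trans N10 _.
  by rewrite subr_ge0.
rewrite (Rintegral_primitive aT cfa dPa).
have dP0 x : 0 <= x <= t -> is_derive x 1 P (f x).
  by move=> /andP[x0 _]; apply: dP; exact: lt_le_trans x0.
have := Rintegral_primitive t0 cf dP0.
rewrite /= subrr {1}/a subKr => <-.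
rewrite /Rintegral fine_le//.
- by apply: integrable_fin_num => //; exact: cont_integrable.
- by apply: integrable_fin_num => //; exact: cont_integrable.
apply: ge0_subset_integral_nomeas => [|x _]; last by rewrite lee_fin.
by apply: subset_itvl; rewrite bnd_simp.
Qed.

Lemma primitive_increment (P N : R -> R) (a x e : R) : continuous N ->
  (forall t, a < t -> is_derive t 1 P (N t)) -> a < x -> 0 < e ->
  exists2 d : R, 0 < d & forall h, 0 < h < d -> `|P x - P (x - h) - h * N x| <= h * e.
Proof.
move=> cN dP ax e0.
have /cvgrPdist_lt/(_ _ e0)/nbhs_ballP[d /= d0 hd] := cN x.
exists (Num.min d (x - a)) => [|h]; first by rewrite lt_min d0 subr_gt0.
rewrite lt_min => /and3P[h0 hd' hxa].
have xh : x - h < x by rewrite ltrBlDr ltrDl.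
have axh : a < x - h by rewrite ltrBrDr addrC -ltrBrDr.
have [||c] := @MVT R P N (x - h) x xh.
- by move=> t; rewrite in_itv /= => /andP[/(lt_trans axh)/dP].
- apply: derivable_within_continuous => t; rewrite in_itv /= => /andP[xt _].
  by have [] := dP t (lt_le_trans axh xt).
rewrite in_itv /= => /andP[xc cx] ->.
rewrite opprB addrCA subrr addr0 mulrC -mulrBr normrM (gtr0_norm h0) ler_pM2l//.
rewrite distrC ltW// hd// /ball /= gtr0_norm ?subr_gt0//.
by rewrite ltrBlDr -ltrBlDl; apply: lt_trans xc; rewrite ltrD2l ltrN2.
Qed.

End RealIntegrals.

(** * The energy estimate *)
Section EnergyEstimate.
Variables (R : realType) (cplx : bool).
Local Notation mu := (@lebesgue_measure R).
Variable V : normedModType (scalars R cplx).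

(** An integrated form of a differential inequality for the squared norm along a
    curve [y] with continuous derivative [v]. The norm is never differentiated:
    [y t - rscale h (v t)] is close to [y (t - h)], and the backward difference
    quotient of the squared norm, with step [h], integrates to boundary terms as
    [h] tends to zero. For fixed [h] this dominates [f] by a continuous function,
    which is all that an upper integral requires of [f]. The curve is followed
    from time -1 on so that the backward steps from time 0 make sense. *)
Lemma energy_estimate (y v : R -> V) (T k : R) (f b : R -> R) : 0 < T -> 0 <= k ->
  continuous y -> continuous v -> (forall t, -1 <= t <= T -> rderiv y t (v t)) ->
  continuous b ->
  (forall t h, 0 <= t <= T -> 0 < h ->
    h * f t <= k * (rnorm (y t) * (rnorm (y t - rscale h (v t)) - rnorm (y t))) + h * b t) ->
  (upper_int `[0%R, T] f <=
   (k * ((rnorm (y 0) ^+ 2 - rnorm (y T) ^+ 2) / 2) + (\int[mu]_(x in `[0%R, T]) b x)%R)%:E)%E.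
Proof.
move=> T0 k0 cy cv dy cb fb.
pose N t := rnorm (y t) ^+ 2.
have cN : continuous N.
  by move=> t; rewrite /N; under eq_fun do rewrite expr2; apply: cvgM; apply: cvg_rnorm; exact: cy.
have N11 : (-1 : R) < 0 by rewrite oppr_lt0.
have [P dP] := cont_primitive (-2) cN.
have [Q dQ] := cont_primitive (-2) cb.
have [C0 C00 hC0] := bounded_segment 0 T cy.
apply/lee_addgt0Pr => eta eta0.
have k10 : 0 < k + 1 by rewrite ltr_wpDl.
pose e := eta / (2 * (k + 1) * C0 * T).
have e0 : 0 < e by rewrite divr_gt0// !mulr_gt0.
pose e' := eta / (2 * (k + 1)); have e'0 : 0 < e' by rewrite divr_gt0// mulr_gt0.
have m20 : (-2 : R) < 0 by rewrite oppr_lt0.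
have [d0 d00 hd0] := primitive_increment cN dP m20 e'0.
have [dT dT0 hdT] := primitive_increment cN dP (lt_trans m20 T0) e'0.
have [d d_gt0 hd] := unif_cont_segment (-1) T cv e0.
pose h := Num.min (Num.min d0 dT) (Num.min d 1) / 2.
have m0 : 0 < Num.min (Num.min d0 dT) (Num.min d 1) by rewrite !lt_min d00 dT0 d_gt0 ltr01.
have h0 : 0 < h by rewrite divr_gt0.
have : h < Num.min (Num.min d0 dT) (Num.min d 1) by rewrite ltr_pdivrMr// ltr_pMr// ltr1n.
rewrite !lt_min => /andP[/andP[hd0' hdT'] /andP[hd' h1]].
pose g t := k / h * ((N (t - h) - N t) / 2 + e * h * C0) + b t.
have cNh : continuous (fun t => N (t - h)).
  move=> t; apply: (@continuous_comp _ _ _ (fun t => t - h) N); last exact: cN.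
  by apply: cvgB; [exact: cvg_id|exact: cvg_cst].
have cg : continuous g.
  move=> t; apply: cvgD; last exact: cb.
  apply: cvgM; first exact: cvg_cst; apply: cvgD; last exact: cvg_cst.
  apply: cvgM; last exact: cvg_cst; apply: cvgB; [exact: cNh|exact: cN].
have fg t : 0 <= t <= T -> f t <= g t.
  move=> /[dup] tT /andP[t0 tT'].
  have back : rnorm (y t - rscale h (v t)) <= rnorm (y (t - h)) + e * h.
    have lin_cont : continuous (fun s => rscale s (v t)).
      by move=> s; apply: cvg_rscale; [exact: cvg_id|exact: cvg_cst].
    have := @mean_value_le _ _ _ (fun s => y s - rscale s (v t)) (t - h) t e.
    rewrite subKr.
    have -> : y t - rscale t (v t) - (y (t - h) - rscale (t - h) (v t)) =
        (y t - rscale h (v t)) - y (t - h).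
      by rewrite rscaleBl [in LHS]opprB addrA subrKA.
    move=> H; rewrite -lerBlDl; apply: le_trans (lerB_rnorm _ _) _; apply: H.
    - by rewrite lerBlDr lerDl ltW.
    - by move=> s; apply: cvgB; [exact: cy|exact: lin_cont].
    move=> s /andP[ths st]; exists (v s - v t).
      apply: rderivB; last exact: rderiv_lin.
      apply: dy; rewrite (ltW (lt_le_trans st tT')) andbT; apply: le_trans ths.
      by rewrite lerBrDr; apply: le_trans t0; rewrite addrC subr_le0 ltW.
    have ths1 : -1 <= s.
      by apply: le_trans ths; rewrite lerBrDr; apply: le_trans t0; rewrite addrC subr_le0 ltW.
    have sT : s <= T by apply: le_trans (ltW st) tT'.
    apply/ltW/hd; rewrite ?ths1 ?sT ?tT' ?andbT//.
      by apply: le_trans t0; rewrite oppr_le0.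
    rewrite distrC gtr0_norm ?subr_gt0//; apply: le_lt_trans hd'.
    by rewrite lerBlDr -lerBlDl.
  have H := fb t h tT h0.
  have nt0 := rnorm_ge0 (y t).
  have ntC := hC0 t tT.
  rewrite -(ler_pM2l h0); apply: le_trans H _.
  have -> : h * g t = k * ((N (t - h) - N t) / 2 + e * h * C0) + h * b t.
    by rewrite /g; field; rewrite gt_eqF.
  rewrite lerD2r ler_wpM2l//.
  apply: (@le_trans _ _ (rnorm (y t) * (rnorm (y (t - h)) + e * h - rnorm (y t)))).
    by rewrite ler_wpM2l// lerB.
  have eh0 : 0 <= e * h by rewrite mulr_ge0// ltW.
  have := ler_wpM2l eh0 ntC.
  have := sqr_ge0 (rnorm (y t) - rnorm (y (t - h))).
  rewrite /N; nra.
apply: le_trans (upper_int_le cg fg) _; rewrite -EFinD lee_fin.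
have cQ : (\int[mu]_(x in `[0%R, T]) b x)%R = Q T - Q 0.
  apply: (@Rintegral_primitive _ _ _ _ _ T0 cb) => x /andP[x0 _].
  by apply: dQ; exact: lt_le_trans x0.
pose sh : R -> R := fun t => t - h.
pose G : R -> R := (k / h) *: (2^-1 *: (P \o sh - P) + (e * h * C0) *: id) + Q.
have GE t : G t = k / h * (2^-1 * (P (t - h) - P t) + e * h * C0 * t) + Q t by [].
have dG x : 0 <= x <= T -> is_derive x 1 G (g x).
  move=> /andP[x0 _].
  have dsh : is_derive x 1 sh (1 - 0) by exact: is_deriveB.
  have h1' : -2 < sh x.
    rewrite /sh ltrBrDr (lt_le_trans _ x0)// (_ : -2 + h = (h - 1) - 1); last by ring.
    by rewrite subr_lt0 (lt_trans _ ltr01)// subr_lt0.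
  have dPs : is_derive x 1 (P \o sh) (N (sh x) * (1 - 0)).
    exact: is_derive1_comp (dP _ h1') dsh.
  have dPx := dP x (lt_le_trans m20 x0).
  have dQx := dQ x (lt_le_trans m20 x0).
  have dA : is_derive x 1 (P \o sh - P) (N (sh x) * (1 - 0) - N x) by exact: is_deriveB.
  have dI : is_derive x (1 : R) (id : R -> R) 1 by exact: is_derive_id.
  have dZ1 : is_derive x 1 (2^-1 *: (P \o sh - P)) (2^-1 * (N (sh x) * (1 - 0) - N x)).
    exact: is_deriveZ.
  have dZ2 : is_derive x 1 ((e * h * C0) *: (id : R -> R)) (e * h * C0 * 1).
    exact: is_deriveZ.
  have dD := is_deriveD dZ1 dZ2.
  have dZ3 : is_derive x 1 ((k / h) *: (2^-1 *: (P \o sh - P) + (e * h * C0) *: (id : R -> R)))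
      (k / h * (2^-1 * (N (sh x) * (1 - 0) - N x) + e * h * C0 * 1)).
    exact: is_deriveZ.
  have -> : g x = k / h * (2^-1 * (N (sh x) * (1 - 0) - N x) + e * h * C0 * 1) + b x.
    by rewrite /g /sh subr0 !mulr1 (mulrC 2^-1).
  exact: is_deriveD dZ3 dQx.
rewrite (Rintegral_primitive T0 cg dG).
have {}hd0 := hd0 h; have {}hdT := hdT h.
rewrite h0 hd0' in hd0; rewrite h0 hdT' in hdT.
have := hd0 isT; have := hdT isT.
rewrite !ler_norml => /andP[BT _] /andP[_ B0].
rewrite cQ !GE mulr0 addr0.
have ek : e * C0 * T = e'.
  by rewrite /e /e'; field; rewrite !gt_eqF.
have kee : k * (e' + e') <= eta.
  have -> : k * (e' + e') = k / (k + 1) * eta by rewrite /e'; field; rewrite gt_eqF.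
  by rewrite ler_piMl ?(ltW eta0)// ler_pdivrMr// mul1r lerDl.
have main : 2^-1 * (P (T - h) - P T) + e * h * C0 * T - 2^-1 * (P (0 - h) - P 0) <=
    h * ((N 0 - N T) / 2 + (e' + e')).
  have -> : e * h * C0 * T = h * e' by rewrite -ek; ring.
  by move: BT B0; lra.
have kh0 : 0 <= k / h by rewrite divr_ge0// ltW.
have := ler_wpM2l kh0 main.
rewrite (mulrA (k / h) h) divfK ?gt_eqF// -/(N 0) -/(N T).
by move: kee; lra.
Qed.

End EnergyEstimate.

(** * The duality map and dissipativity *)
Section DualityMap.
Variables (R : realType) (cplx : bool).
Local Notation K := (scalars R cplx).
Variable V : normedModType K.
Implicit Types (x y : V) (phi : {linear V -> K^o}).

Lemma rnorm_dual phi x : continuous phi -> rnorm (phi x) <= dual_norm phi * rnorm x.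
Proof.
move=> cphi; have [c c0 hc] := linear_cont_bound cphi.
have ub : has_ubound [set rnorm (phi x) | x in [set x : V | rnorm x <= 1]].
  exists c => _ [z /= z1 <-]; apply: (le_trans (hc z)).
  by rewrite -[leRHS]mulr1 ler_pM2l.
have [/rnorm_eq0->|x0] := eqVneq (rnorm x) 0.
  by rewrite linear0 !rnorm0 mulr0.
have {}x0 : 0 < rnorm x by rewrite lt_neqAle eq_sym x0 rnorm_ge0.
have : rnorm (phi (rscale (rnorm x)^-1 x)) <= dual_norm phi.
  apply: ub_le_sup => //; exists (rscale (rnorm x)^-1 x) => //=.
  by rewrite rnorm_scale gtr0_norm ?invr_gt0// mulVf// gt_eqF.
by rewrite linear_rscale rnorm_scale gtr0_norm ?invr_gt0// mulrC ler_pdivrMr.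
Qed.

Lemma dual_norm_ge0 phi : continuous phi -> 0 <= dual_norm phi.
Proof.
move=> cphi; have [c c0 hc] := linear_cont_bound cphi.
apply: ub_le_sup; last by exists 0 => /=; rewrite ?linear0 ?rnorm0.
exists c => _ [z /= z1 <-]; apply: (le_trans (hc z)).
by rewrite -[leRHS]mulr1 ler_pM2l.
Qed.

Lemma duality_map_le y phi x : duality_map y phi ->
  sre (phi x) <= rnorm y * rnorm x.
Proof.
move=> [cphi _ nphi].
have -> : rnorm y = dual_norm phi.
  apply/eqP; rewrite -(eqrXn2 (n := 2))// ?rnorm_ge0 ?dual_norm_ge0//.
  by rewrite nphi.
apply: le_trans (rnorm_dual x cphi); exact: ler_sre_norm.
Qed.

Lemma duality_map_self y phi : duality_map y phi -> sre (phi y) = rnorm y ^+ 2.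
Proof. by move=> [_ -> _]; rewrite sofrK. Qed.

Lemma sre_dualB phi x y : sre (phi (x - y) : K) = sre (phi x) - sre (phi y).
Proof. by rewrite linearB sreB. Qed.

Lemma sre_dual_rscale phi a x : sre (phi (rscale a x) : K) = a * sre (phi x).
Proof. by rewrite linear_rscale /rscale -sre_sofrM. Qed.

Lemma sre_dual_cvg phi {T : Type} {F : set_system T} {FF : Filter F} (f : T -> V) x :
  continuous phi -> f t @[t --> F] --> x ->
  (sre (phi (f t) : K)) @[t --> F] --> sre (phi x : K).
Proof.
move=> cphi fx; have [c c0 hc] := linear_cont_bound cphi.
apply/cvgrPdist_lt => e e0.
have ec : 0 < e / c by rewrite divr_gt0.
have /rcvgP/(_ _ ec) := fx; apply: filterS => t.
rewrite ltr_pdivlMr// mulrC => h; apply: le_lt_trans h.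
rewrite distrC -sre_dualB; apply: le_trans (hc _).
rewrite ler_norml lerNl -sreN /rnorm; apply/andP; split; last exact: ler_sre_norm.
by rewrite -normrN; exact: ler_sre_norm.
Qed.

End DualityMap.

Section Generators.
Variables (R : realType) (cplx : bool).
Local Notation K := (scalars R cplx).
Variable V : completeNormedModType K.
Variables (D : set V) (A : V -> V) (S : R -> {linear V -> V}).
Hypothesis gen : generates D A S.

(** The real part of [phi (S h y - y)] is at most
    [rnorm y * rnorm (S h y) - rnorm y ^+ 2], which is nonpositive. *)
Lemma dissipative y (phi : {linear V -> K^o}) : contractive S -> D y -> duality_map y phi ->
  sre (phi (A y)) <= 0.
Proof.
move=> Sc Dy yphi; have cphi : continuous phi by have [] := yphi.
apply: (cvgr_to_le (sre_dual_cvg cphi (generator_cvg gen Dy))).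
near=> h; have h0 : 0 < h by near: h; exact: nbhs_right_gt.
rewrite sre_dual_rscale pmulr_rle0 ?invr_gt0// sre_dualB (duality_map_self yphi) subr_le0.
by rewrite (le_trans (duality_map_le _ yphi))// expr2 ler_wpM2l ?rnorm_ge0// Sc// ltW.
Unshelve. all: by end_near. Qed.

Lemma cvg_invS_right : (fun n : nat => n.+1%:R^-1 : R) n @[n --> \oo] --> 0^'+.
Proof.
move=> /= E /nbhs_ballP[d /= d0 hd].
apply: filterS (cvgr_lt _ (@cvg_invS R) _ d0) => n /= nd.
by apply: hd => //=; rewrite /ball /= sub0r normrN gtr0_norm.
Qed.

Lemma generator_seq x : D x ->
  rscale n.+1%:R (S n.+1%:R^-1 x - x) @[n --> \oo] --> A x.
Proof.
move=> Dx; have := cvg_comp _ _ cvg_invS_right (generator_cvg gen Dx).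
by apply: cvg_trans; apply: near_eq_cvg; near=> n; rewrite /= invrK.
Unshelve. all: by end_near. Qed.

(** If [Phi] is a bounded operator into the domain, [A Phi] is everywhere defined
    and a pointwise limit of bounded operators, hence bounded. *)
Lemma generator_comp_bounded (Phi : V -> V) :
  (forall x, D (Phi x)) -> (forall x y, Phi (x - y) = Phi x - Phi y) ->
  (forall a x, Phi (rscale a x) = rscale a (Phi x)) ->
  (exists c : R, forall x, rnorm (Phi x) <= c * rnorm x) ->
  exists2 c : R, 0 < c & forall x, rnorm (A (Phi x)) <= c * rnorm x.
Proof.
move=> DPhi PhiB PhiZ [c hc].
have S_C0 := gen.1; have [M M0 hM] := semigroup_bound S_C0 1.
have n1 (n : nat) : 0 <= (n.+1%:R^-1 : R) <= 1 by rewrite invr_ge0 ler0n invf_le1 ?ler1n ?ltr0n.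
pose f (n : nat) x := rscale n.+1%:R (S n.+1%:R^-1 (Phi x) - Phi x).
have fcvg x : f n x @[n --> \oo] --> A (Phi x) by exact: generator_seq.
have [||||k k0 hk] := @banach_steinhaus R cplx V V nat f.
- move=> n x y; rewrite /f PhiB linearB -rscaleBr; congr (rscale _ _).
  by rewrite opprD addrACA -opprD.
- move=> n a x; rewrite /f PhiZ linear_rscale -rscaleBr !rscaleA.
  by rewrite mulrC.
- move=> n; exists (n.+1%:R * (M * c + c)) => x; rewrite /f rnorm_scale.
  rewrite ger0_norm// -mulrA ler_wpM2l// mulrDl (le_trans (ler_rnormB _ _))// lerD//.
  by rewrite -mulrA (le_trans (hM _ _ (n1 n)))// ler_pM2l.
- by move=> x; exact: cvg_rnorm_bounded (fcvg x).
exists k => // x; apply: (cvgr_to_le (cvg_rnorm (fcvg x))).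
by apply: nearW => n; exact: hk.
Qed.

(** Since [A (Q x) - eta *: Q x = x], the quotients that define [A (Q x)] give
    approximations of [x] which depend on [x] through [Q x] only. They are
    therefore bounded for the norm of the extrapolation space. *)
Lemma resolvent_approx (eta : K) (Q : {linear V -> V}) : is_resolvent D A eta Q ->
  exists (L : nat -> V -> V) (c : nat -> R),
    [/\ forall n x y, L n (x - y) = L n x - L n y, forall n, 0 <= c n,
        forall n x, rnorm (L n x) <= c n * rnorm (Q x) &
        forall x, L n x @[n --> \oo] --> x].
Proof.
move=> [cQ hQ _].
have S_C0 := gen.1; have [M M0 hM] := semigroup_bound S_C0 1.
have n1 (n : nat) : 0 <= (n.+1%:R^-1 : R) <= 1 by rewrite invr_ge0 ler0n invf_le1 ?ler1n ?ltr0n.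
exists (fun n x => rscale n.+1%:R (S n.+1%:R^-1 (Q x) - Q x) - eta *: Q x).
exists (fun n => n.+1%:R * (M + 1) + sre `|eta|); split.
- move=> n x y; rewrite (linearB Q); set t := n.+1%:R^-1.
  have -> : S t (Q x - Q y) - (Q x - Q y) = (S t (Q x) - Q x) - (S t (Q y) - Q y).
    by rewrite linearB opprD addrACA -opprD.
  by rewrite rscaleBr scalerBr opprD addrACA -opprD.
- move=> n; rewrite addr_ge0 ?mulr_ge0 ?addr_ge0 ?(ltW M0)//.
  by rewrite -(@sre0 R cplx); apply: ler_sre.
- move=> n x; rewrite (le_trans (ler_rnormB _ _))// mulrDl lerD//; last by rewrite rnormZ.
  rewrite rnorm_scale ger0_norm// -mulrA ler_wpM2l// mulrDl mul1r.
  by rewrite (le_trans (ler_rnormB _ _))// lerD// hM.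
- move=> x; have [DQ AQ] := hQ x.
  rewrite -[X in _ --> X]AQ; apply: cvgB; last exact: cvg_cst.
  exact: generator_seq.
Qed.

End Generators.

(** * Exponential stability from a contraction at one time *)
Section ExponentialStability.
Variables (R : realType) (cplx : bool).
Local Notation K := (scalars R cplx).
Variable V : completeNormedModType K.
Variable S : R -> {linear V -> V}.

(** The contraction is iterated over whole multiples of [T], and the remaining
    time is absorbed by the local bound of the semigroup; the decay rate is
    [- ln q / T]. *)
Lemma exp_stable_of_contraction (T q : R) : C0_semigroup S -> 0 < T -> 0 < q < 1 ->
  (forall x, rnorm (S T x) <= q * rnorm x) -> exp_stable S.
Proof.
move=> S_C0 T0 /andP[q0 q1] Sq; have [_ S0 SD _] := S_C0.
have [M M0 hM] := semigroup_bound S_C0 T.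
pose s := - ln q / T.
have s0 : 0 < s by rewrite divr_gt0// oppr_gt0 ln_lt0// q0.
have lnq : ln q = - s * T by rewrite /s mulNr divfK ?opprK// gt_eqF.
clearbody s; exists (M * expR (s * T)), s; split => //; first by rewrite mulr_gt0// expR_gt0.
move=> t x t0.
pose n := Num.truncn (t / T).
have tT : 0 <= t / T by rewrite divr_ge0// ltW.
have nt : n%:R * T <= t by rewrite -ler_pdivlMr// truncn_le.
have tn : t <= (n.+1)%:R * T by rewrite -ler_pdivrMr// ltW// truncnS_gt.
have nT0 k : 0 <= k%:R * T by rewrite mulr_ge0// ltW.
have Sn k z : rnorm (S (k%:R * T) z) <= q ^+ k * rnorm z.
  elim: k => [|k IH]; first by rewrite mul0r S0 expr0 mul1r.
  rewrite -natr1 mulrDl mul1r addrC SD ?(ltW T0)//.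
  by rewrite exprS -mulrA (le_trans (Sq _))// ler_pM2l.
rewrite -(subrK (n%:R * T) t) SD ?subr_ge0//.
have r0 : 0 <= t - n%:R * T <= T.
  by rewrite subr_ge0 nt /= lerBlDr -[X in X + _]mul1r -mulrDl addrC natr1.
apply: (le_trans (hM _ _ r0)); rewrite subrK -!mulrA ler_pM2l//.
apply: (le_trans (Sn n x)); rewrite mulrA ler_wpM2r ?rnorm_ge0//.
rewrite -{1}(@lnK _ q) ?posrE// -expRM_natl -expRD ler_expR.
rewrite lnq.
have := ler_wpM2l (ltW s0) tn; rewrite -natr1. lra.
Qed.

End ExponentialStability.

(** * The extrapolation space and observations *)
Section Structure.
Variables (R : realType) (cplx : bool).
Local Notation K := (scalars R cplx).
Variables (X U Xm W : completeNormedModType K).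
Variables (DA : set X) (A : X -> X) (j : {linear X -> Xm}).

Lemma extrapolation_inj_cont : extrapolation_space DA A j ->
  injective j /\ continuous j.
Proof.
move=> [eta [Q [[cQ hQ _] jQ _]]].
split.
  have Q0 z : Q z = 0 -> z = 0.
    move=> Qz; have [_ Az] := hQ z; have [_ A0] := hQ 0.
    by rewrite Qz in Az; rewrite linear0 in A0; rewrite -Az A0.
  move=> x y jxy; apply/eqP; rewrite -subr_eq0; apply/eqP/Q0/rnorm_eq0.
  by rewrite -jQ linearB jxy subrr rnorm0.
have [c c0 hc] := linear_cont_bound cQ.
by apply: (@linear_bound_cont _ _ _ _ _ c) => x; rewrite jQ.
Qed.

Lemma emb_invK (V1 : pointedType) (V2 : Type) (f : V1 -> V2) x : injective f ->
  emb_inv f (f x) = x.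
Proof.
by move=> f_inj; rewrite /emb_inv; case: xgetP => [y _ /= /f_inj ->//|/(_ x) nx]; case: nx.
Qed.

Variables (i : {linear W -> X}) (C : {linear W -> U}).
Hypothesis W_inter : between_domain_and_space DA A i.
Hypothesis C_cont : continuous C.

Let i_inj : injective i. Proof. by have [] := W_inter. Qed.

Lemma C_onE w : C_on i C (i w) = C w.
Proof. by rewrite /C_on (emb_invK _ i_inj). Qed.

Lemma domain_range y : DA y -> exists w, y = i w.
Proof. by case: W_inter => _ _ DW _ /DW[w _ <-]; exists w. Qed.

Lemma C_onB y z : DA y -> DA z -> C_on i C (y - z) = C_on i C y - C_on i C z.
Proof.
move=> /domain_range[w ->] /domain_range[w' ->].
by rewrite -linearB !C_onE linearB.
Qed.

Lemma C_on_bound : exists2 c : R, 0 < c & forall y, DA y ->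
  rnorm (C_on i C y) <= c * (rnorm y + rnorm (A y)).
Proof.
have [c c0 hc] := linear_cont_bound C_cont.
have [_ _ _ [b hb]] := W_inter.
exists (c * (`|b| + 1)) => [|y Dy]; first by rewrite mulr_gt0// ltr_wpDl.
have [w yw] := domain_range Dy; rewrite yw in Dy *.
rewrite C_onE (le_trans (hc w))// -mulrA ler_pM2l// (le_trans (hb w Dy))//.
rewrite ler_wpM2r ?addr_ge0 ?rnorm_ge0//.
by rewrite (le_trans (ler_norm _))// lerDl.
Qed.

(** Continuity in the graph norm of [A] is inherited by observations. *)
Lemma C_on_cont (S : R -> {linear X -> X}) (y : R -> X) : generates DA A S ->
  (forall t, DA (y t)) ->
  continuous y -> continuous (fun t => A (y t)) -> continuous (fun t => C_on i C (y t)).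
Proof.
move=> genS Dy cy cAy t; have [c c0 hc] := C_on_bound.
apply/rcvgP => e e0; have e2 : 0 < e / (2 * c) by rewrite divr_gt0// mulr_gt0.
have /rcvgP/(_ _ e2) h1 := cy t; have /rcvgP/(_ _ e2) h2 := cAy t.
near=> s.
have hs1 : rnorm (y s - y t) < e / (2 * c) by near: s.
have hs2 : rnorm (A (y s) - A (y t)) < e / (2 * c) by near: s.
have [Dst Ast] := generatorB genS (Dy s) (Dy t).
rewrite -C_onB//; apply: le_lt_trans (hc _ Dst) _; rewrite Ast mulrC -ltr_pdivlMr//.
apply: lt_le_trans (ltrD hs1 hs2) _; rewrite le_eqVlt; apply/orP; left; apply/eqP.
by field; rewrite gt_eqF.
Unshelve. all: by end_near. Qed.

Variables (B : {linear U -> Xm}) (Am : Xm -> Xm).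
Hypothesis j_inj : injective j.
Hypothesis Am_ext : forall x, DA x -> Am (j x) = j (A x).
Variables (F G : set Xm).
Hypotheses (F_sub : linear_subspace F) (G_sub : linear_subspace G).
Hypotheses (FX : F `<=` range j) (XG : range j `&` G = [set 0]).
Hypothesis BC_range : forall w : W, exists p q, [/\ F p, G q & B (C w) = p + q].

Let subspaceB (H : set Xm) p q : linear_subspace H -> H p -> H q -> H (p - q).
Proof.
move=> [_ lin] Hp Hq; have := lin (-1) q p Hq Hp.
by rewrite scaleN1r addrC.
Qed.

(** When BC y lies in the state space, its component along the second subspace
    vanishes, and the projected operator agrees with BC at y. *)
Lemma XBC_E y b : (exists w, y = i w) -> B (C_on i C y) = j b -> XBC j i B C F G y = b.
Proof.
move=> [w ->] Bb; have [p [q [Fp Gq pq]]] := BC_range w.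
rewrite C_onE in Bb.
have proj_eq z p' : F p' -> G (z - p') -> proj_along F G z = p'.
  move=> Fp' Gp'; rewrite /proj_along; case: xgetP => [p'' _ [Fp'' Gp'']|/(_ p') np].
    have FB : F (p'' - p') by exact: subspaceB.
    have GB : G (p'' - p').
      have -> : p'' - p' = (z - p') - (z - p'').
        by rewrite opprB [RHS]addrC subrKA.
      exact: subspaceB.
    have : (range j `&` G) (p'' - p') by split => //; exact: FX.
    by rewrite XG => /= /eqP; rewrite subr_eq0 => /eqP.
  by case: np.
have q0 : q = 0.
  have [x _ jx] := FX Fp.
  suff : (range j `&` G) q by rewrite XG.
  by split => //; exists (b - x) => //; rewrite linearB jx -Bb pq addrAC subrr add0r.
have pb : p = j b by rewrite -Bb pq q0 addr0.
rewrite /XBC C_onE (proj_eq _ p)//; last by rewrite pq q0 addr0 subrr -q0.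
by rewrite pb (emb_invK _ j_inj).
Qed.

Lemma dom_ABC_E (m : R) y : dom_ABC j i B C DA y ->
  [/\ DA y, j (XBC j i B C F G y) = B (C_on i C y) &
      ABC j i B C Am m y = A y - rscale m (XBC j i B C F G y)].
Proof.
move=> [Dy [w [b _ jb] iw]].
have yw : exists w, y = i w by exists w.
have Bb : B (C_on i C y) = j b by rewrite -iw C_onE.
have Xb := XBC_E yw Bb.
split; rewrite ?Xb//.
by rewrite /ABC Am_ext// Bb -linear_rscale -linearB (emb_invK _ j_inj).
Qed.

End Structure.

(** * Variation of constants for the closed loop *)
Section RightDerivativeLocal.
Variables (R : realType) (cplx : bool).
Variable V : completeNormedModType (scalars R cplx).

Lemma eq_rderiv (f g : R -> V) t v : (forall h, 0 <= h -> f (t + h) = g (t + h)) ->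
  rderiv f t v -> rderiv g t v.
Proof.
move=> fg /rderivP fv; apply/rderivP => e /fv[d d0 hd]; exists d => // h /[dup] hd' /andP[h0 _].
have := fg 0 (lexx 0); rewrite addr0 => <-.
by rewrite -fg ?(ltW h0)//; exact: hd.
Qed.

Lemma rcont_indic (f : R -> V) (a t : R) : continuous f ->
  rcont (fun s => rscale (\1_(`[a, +oo[%classic) s) (f s)) t.
Proof.
move=> cf e e0; have [ta|at_] := ltP t a.
  exists (a - t) => [|s /andP[ts sta]]; first by rewrite subr_gt0.
  have sa : s < a by rewrite subrKC in sta.
  rewrite !indicE !memNset /= ?in_itv /= ?andbT; last 2 first.
  - by rewrite leNgt ?sa ?ta.
  - by rewrite leNgt ?sa ?ta.
  by rewrite !rscale0r subrr rnorm0 ltW.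
have [d d0 hd] := cont_rcont cf t e0.
exists d => // s /[dup] std /andP[ts _].
rewrite !indicE !mem_set /= ?in_itv /= ?andbT ?(le_trans at_)//.
by rewrite !rscale1r; exact: hd.
Qed.

End RightDerivativeLocal.

Section PerturbedOrbit.
Variables (R : realType) (cplx : bool).
Local Notation K := (scalars R cplx).
Local Notation mu := (@lebesgue_measure R).
Variables (X U Xm : completeNormedModType K).
Variables (DA : set X) (A : X -> X) (S : R -> {linear X -> X}).
Hypothesis A_gen : generates DA A S.
Variables (j : {linear X -> Xm}) (Sm : R -> {linear Xm -> Xm}).
Hypothesis j_cont : continuous j.
Hypothesis Sm_ext : forall (t : R) (x : X), 0 <= t -> Sm t (j x) = j (S t x).
Variable B : {linear U -> Xm}.

Variables (m : R) (y b : R -> X) (u : R -> U).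
Hypothesis m_gt0 : 0 < m.
Hypothesis y_cont : continuous y.
Hypothesis b_cont : continuous b.
Hypothesis u_cont : continuous u.
Hypothesis y_dom : forall t, 0 <= t -> DA (y t).
Hypothesis y_sol : forall t, 0 <= t -> rderiv y t (A (y t) - rscale m (b t)).
Hypothesis jb : forall t, 0 <= t -> j (b t) = B (u t).

Let S_C0 := A_gen.1.

Let S0 x : S 0 x = x. Proof. by have [_ h _ _] := S_C0; exact: h. Qed.

Let scale_conv (t s : R) : 0 <= t -> 0 <= s ->
  rscale (- m^-1) (j (S t (- rscale m (b s)))) = Sm t (B (u s)).
Proof.
move=> t0 s0; rewrite -jb// Sm_ext// -(linear_rscale j) -(linear_rscale (S t)) rscaleNr rscaleNl opprK.
by rewrite rscaleVK// gt_eqF.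
Qed.

Let conv_rderiv (t s a : R) : 0 <= a -> a <= s < t ->
  rderiv (fun r => S (pos (t - r)) (y (r - a))) s
    (S (pos (t - s)) (- rscale m (b (s - a)))).
Proof.
move=> a0 /andP[as_ st]; have sa0 : 0 <= s - a by rewrite subr_ge0.
pose z r := y (r - a).
have zs : rderiv z s (A (z s) - rscale m (b (s - a))).
  exact: (rderiv_shift (y_sol sa0)).
have s0t : 0 <= s < t by rewrite (le_trans a0).
have := duhamel_rderiv A_gen s0t (y_dom sa0 : DA (z s)) zs.
by rewrite addrAC subrr add0r.
Qed.

Let shift_cont (V : completeNormedModType K) (f : R -> V) (a : R) : continuous f ->
  continuous (fun s => f (s - a)).
Proof.
move=> cf s; apply: (@continuous_comp _ _ _ (fun s => s - a) f); last exact: cf.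
by apply: cvgB; [exact: cvg_id|exact: cvg_cst].
Qed.

Let conv_cont (t a : R) (f : R -> X) : continuous f ->
  continuous (fun s => S (pos (t - s)) (f (s - a))).
Proof.
move=> cf; apply: (semigroup_cont S_C0); last exact: shift_cont.
by move=> s; apply: cvgB; [exact: cvg_cst|exact: cvg_id].
Qed.

Let comp_j_cont (f : R -> X) : continuous f -> continuous (fun s => j (f s)).
Proof.
by move=> cf s; apply: (@continuous_comp _ _ _ f j); [exact: cf|exact: j_cont].
Qed.

Let neg_cont : continuous (fun s => - rscale m (b s)).
Proof.
by move=> s; apply: cvgN; apply: cvg_rscale; [exact: cvg_cst|exact: b_cont].
Qed.

(** The convolution over [0, T] of the control [u] delayed by [T - t]: it is the
    convolution over [0, t] of [u], so that a bound at the single time [T]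
    controls all earlier times. *)
Lemma delayed_variation_of_constants (t T : R) : 0 <= t <= T ->
  is_bochner_int `]0, T[
    (fun s => Sm (T - s) (B (rscale (\1_(`[T - t, +oo[%classic) s) (u (s - (T - t))))))
    (j (rscale (- m^-1) (y t - S t (y 0)))).
Proof.
move=> /andP[t0 tT]; set a := T - t; have a0 : 0 <= a by rewrite subr_ge0.
have T0 : 0 <= T by exact: le_trans tT.
have aT : a <= T by rewrite lerBlDr lerDl.
pose H s := S (pos (T - s)) (y (s - a)).
pose g s := j (S (pos (T - s)) (- rscale m (b (s - a)))).
pose f s := rscale (\1_(`[a, +oo[%classic) s) (g s).
pose F s := j (H (Num.max s a)).
have cg : continuous g by apply: comp_j_cont; exact: (conv_cont neg_cont).
have cH : continuous H by exact: conv_cont.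
have cF : continuous F.
  apply: comp_j_cont => s; apply: (@continuous_comp _ _ _ (fun s => Num.max s a) H); last exact: cH.
  by apply: continuous_max; [exact: cvg_id|exact: cvg_cst].
have uf : uapprox `[0, T] f.
  by apply: uapprox_indic; [exact: measurable_itv|exact: uapprox_cont].
have dF s : 0 <= s < T -> rderiv F s (f s).
  move=> /andP[s0 sT]; have [sa|as_] := ltP s a.
    rewrite /f indicE memNset /= ?in_itv /= ?andbT; last by rewrite leNgt sa.
    rewrite rscale0r; apply/rderivP => e e0; exists (a - s) => [|h /andP[h0 hsa]].
      by rewrite subr_gt0.
    rewrite /F !max_r ?(ltW sa)//; last by rewrite addrC -lerBrDr ltW.
    by rewrite subrr rscaler0 subrr rnorm0 mulr_ge0// ltW.
  rewrite /f indicE mem_set /= ?in_itv /= ?andbT// rscale1r.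
  apply: (@eq_rderiv _ _ _ (j \o H)) => [h h0|].
    by rewrite /F /= max_l// ler_wpDr.
  by apply: rderiv_linear => //; apply: conv_rderiv; rewrite ?as_.
have FT : F T = j (y t).
  by rewrite /F max_l// /H subrr posE// S0 /a subKr.
have F0 : F 0 = j (S t (y 0)).
  by rewrite /F max_r// /H subrr /a subKr posE.
have := bochner_ftc T0 uf (fun s _ => rcont_indic a s cg) cF dF.
rewrite FT F0 -linearB => /(is_bochner_rscale (- m^-1) (measurable_itv _)).
rewrite -linear_rscale; apply: eq_is_bochner => s.
rewrite /= in_itv /= => /andP[s0 sT]; rewrite /f /g !indicE.
have [as_|sa] := boolP (s \in `[a, +oo[%classic); last first.
  by rewrite !rscale0r rscaler0 !linear0.
have {}as_ : a <= s by move: as_; rewrite inE /= in_itv /= andbT.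
by rewrite !rscale1r posE ?subr_ge0 ?(ltW sT)// scale_conv ?subr_ge0// ltW.
Qed.

Lemma variation_of_constants (t : R) : 0 <= t ->
  is_bochner_int `]0, t[ (fun s => Sm (t - s) (B (u s)))
    (j (rscale (- m^-1) (y t - S t (y 0)))).
Proof.
move=> t0; have := @delayed_variation_of_constants t t; rewrite t0 lexx => /(_ isT).
apply: eq_is_bochner => s; rewrite /= in_itv /= => /andP[s0 st].
rewrite subrr subr0 indicE mem_set ?rscale1r//= in_itv /= andbT.
exact: ltW.
Qed.

(** By variation of constants the difference of the two orbits is [- m] times the
    state reached under the control [u], delayed so that it is reached at time
    [T]; there the admissibility bound applies. *)
Lemma perturbed_orbit_dist (T k : R) : 0 < T -> 0 < k ->
  (forall (w : R -> U) (x : X), uapprox `[0, T] w ->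
    is_bochner_int `]0, T[ (fun s => Sm (T - s) (B (w s))) (j x) ->
    ((rnorm x)%:E <= k%:E * norm_L1 `]0%R, T[ w)%E) ->
  forall t, 0 <= t <= T ->
    rnorm (y t - S t (y 0)) <= m * k * (\int[mu]_(s in `[0, T]) rnorm (u s))%R.
Proof.
move=> T0 k0 adm t /andP[t0 tT].
have [->|tN0] := eqVneq t 0.
  rewrite S0 subrr rnorm0 mulr_ge0 ?mulr_ge0 ?(ltW m_gt0) ?(ltW k0)//.
  by apply: Rintegral_ge0 => x _; exact: rnorm_ge0.
have {}t0 : 0 < t by rewrite lt_neqAle eq_sym tN0.
have tT' : 0 <= t <= T by rewrite ltW.
set a := T - t.
pose w s := rscale (\1_(`[a, +oo[%classic) s) (u (s - a)).
have uw : uapprox `[0, T] w.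
  by apply: uapprox_indic; [exact: measurable_itv|apply: uapprox_cont; exact: shift_cont].
have := adm w _ uw (delayed_variation_of_constants tT').
have cru : continuous (fun s => rnorm (u s)).
  by move=> s; apply: cvg_rnorm; exact: u_cont.
have cru' : continuous (fun s => rnorm (u (s - a))).
  by move=> s; apply: cvg_rnorm; exact: shift_cont.
have wL1 : (norm_L1 `]0%R, T[ w <= ((\int[mu]_(s in `[0%R, T]) rnorm (u s))%R)%:E)%E.
  have t0T : 0 < t <= T by rewrite t0.
  have := Rintegral_shift_le t0T cru (fun s => rnorm_ge0 _).
  rewrite -lee_fin => /(le_trans _); apply.
  rewrite [leRHS]fineK; last first.
    by apply: integrable_fin_num => //; exact: (cont_integrable _ _ cru').
  pose ru s := (rnorm (u (s - a)))%:E.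
  have -> : norm_L1 `]0%R, T[ w = (\int[mu]_(s in `]0%R, T[) (ru \_ `[a, +oo[) s)%E.
    apply: eq_integral => s _; rewrite patchE /w indicE /ru.
    by have [_|_] := boolP (s \in `[a, +oo[%classic); rewrite ?rscale1r// rscale0r rnorm0.
  rewrite -integral_mkcondr; apply: ge0_subset_integral_nomeas.
    by move=> s []; rewrite /= !in_itv /= andbT => /andP[_ /ltW sT] ->.
  by move=> s _; rewrite lee_fin rnorm_ge0.
move=> h; have := le_trans h (lee_wpmul2l _ wL1).
rewrite lee_fin (ltW k0) -EFinM lee_fin => /(_ isT).
rewrite rnorm_scale normrN gtr0_norm ?invr_gt0// mulrC ler_pdivrMr//.
by rewrite mulrC mulrA.
Qed.

End PerturbedOrbit.

(** * Elementary estimates *)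
Section Estimates.
Variable R : realType.
Local Notation mu := (@lebesgue_measure R).

(** [n], [p], [q] stand for the norms of the initial state and of the free and the
    closed-loop orbit at time [T]. As [q] exceeds [p] by a quantity of order [m],
    the dissipation [d * p ^+ 2] is a dissipation in terms of [q], up to an error
    of order [m ^+ 2]. *)
Lemma contraction_arith (n p q r m k c d : R) : 0 <= n -> 0 <= p -> 0 <= q -> 0 < m <= 1 ->
  0 <= k -> 0 <= d ->
  d * p ^+ 2 <= m^-1 * ((n ^+ 2 - q ^+ 2) / 2) + r -> r <= m * n ^+ 2 * c ->
  q <= p + m * k * n ->
  q ^+ 2 * (1 + m * d) <= n ^+ 2 * (1 + m ^+ 2 * (2 * c + 2 * d * k ^+ 2)).
Proof.
move=> n0 p0 q0 /andP[m0 m1] k0 d0 H1 H2 H3.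
have q2 : q ^+ 2 <= 2 * p ^+ 2 + 2 * (m * k * n) ^+ 2.
  have e0 : 0 <= m * k * n by rewrite !mulr_ge0// ltW.
  apply: (@le_trans _ _ ((p + m * k * n) ^+ 2)).
    by rewrite ler_pXn2r// nnegrE addr_ge0.
  have := sqr_ge0 (p - m * k * n); rewrite sqrrB sqrrD; lra.
have H4 : 2 * m * (d * p ^+ 2) <= (n ^+ 2 - q ^+ 2) + 2 * m * (m * n ^+ 2 * c).
  have m20 : 0 <= 2 * m by rewrite mulr_ge0// ltW.
  apply: le_trans (ler_wpM2l m20 (le_trans H1 (lerD (lexx _) H2))) _.
  rewrite mulrDr lerD2r le_eqVlt; apply/orP; left; apply/eqP.
  by field; rewrite gt_eqF.
have md0 : 0 <= m * d by rewrite mulr_ge0// ltW.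
have H5 := ler_wpM2l md0 q2.
have H6 : m * (m ^+ 2 * (d * k ^+ 2 * n ^+ 2)) <= m ^+ 2 * (d * k ^+ 2 * n ^+ 2).
  have y0 : 0 <= m ^+ 2 * (d * k ^+ 2 * n ^+ 2).
    by do 2![apply: mulr_ge0; rewrite ?sqr_ge0//]; apply: mulr_ge0; rewrite ?sqr_ge0.
  by rewrite ler_piMl.
have E1 : m * d * (2 * p ^+ 2 + 2 * (m * k * n) ^+ 2) =
    2 * m * (d * p ^+ 2) + 2 * (m * (m ^+ 2 * (d * k ^+ 2 * n ^+ 2))) by ring.
rewrite E1 in H5.
have -> : q ^+ 2 * (1 + m * d) = q ^+ 2 + m * d * q ^+ 2 by ring.
have -> : n ^+ 2 * (1 + m ^+ 2 * (2 * c + 2 * d * k ^+ 2)) =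
  n ^+ 2 + 2 * m * (m * n ^+ 2 * c) + 2 * (m ^+ 2 * (d * k ^+ 2 * n ^+ 2)) by ring.
lra.
Qed.

Lemma le_Rintegral_cont (T : R) (f g : R -> R) : continuous f -> continuous g ->
  (forall x, 0 <= x <= T -> f x <= g x) ->
  (\int[mu]_(x in `[0, T]) f x)%R <= (\int[mu]_(x in `[0, T]) g x)%R.
Proof.
by move=> cf cg fg; apply: le_Rintegral => //; exact: cont_integrable.
Qed.

Lemma RintegralD_cont (T : R) (f g : R -> R) : continuous f -> continuous g ->
  (\int[mu]_(x in `[0, T]) (f x + g x))%R =
  (\int[mu]_(x in `[0, T]) f x)%R + (\int[mu]_(x in `[0, T]) g x)%R.
Proof. by move=> cf cg; apply: RintegralD => //; exact: cont_integrable. Qed.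

Lemma RintegralZ_cont (T a : R) (f : R -> R) : continuous f ->
  (\int[mu]_(x in `[0, T]) (a * f x))%R = a * (\int[mu]_(x in `[0, T]) f x)%R.
Proof. by move=> cf; apply: RintegralZl => //; exact: cont_integrable. Qed.

Lemma Rintegral_cst_itv (T a : R) : 0 <= T -> (\int[mu]_(_ in `[0%R, T]) a)%R = a * T.
Proof.
move=> T0; have E : mu `[0, T] = T%:E.
  rewrite lebesgue_measure_itv /= lte_fin; case: ltP => [_|T0'] /=; first by rewrite oppr0 adde0.
  by congr EFin; apply/eqP; rewrite eq_le T0 T0'.
by rewrite Rintegral_cst//; congr (_ * _); rewrite -[RHS]/(fine T%:E) -E.
Qed.

End Estimates.

(** * The closed loop over one period *)
Section ClosedLoop.
Variables (R : realType) (cplx : bool).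
Local Notation K := (scalars R cplx).
Local Notation mu := (@lebesgue_measure R).
Variables (X U Xm W : completeNormedModType K).
Variables (DA : set X) (A : X -> X) (S : R -> {linear X -> X}).
Hypothesis A_gen : generates DA A S.
Hypothesis S_contr : contractive S.
Variables (j : {linear X -> Xm}) (Am : Xm -> Xm) (Sm : R -> {linear Xm -> Xm}).
Hypothesis Xm_extr : extrapolation_space DA A j.
Hypothesis Sm_ext : forall (t : R) (x : X), 0 <= t -> Sm t (j x) = j (S t x).
Hypothesis Am_ext : forall x, DA x -> Am (j x) = j (A x).
Variable i : {linear W -> X}.
Hypothesis W_inter : between_domain_and_space DA A i.
Variables (B : {linear U -> Xm}) (C : {linear W -> U}).
Hypothesis C_cont : continuous C.
Variables (F G : set Xm).
Hypotheses (F_sub : linear_subspace F) (G_sub : linear_subspace G).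
Hypotheses (FX : F `<=` range j) (XG : range j `&` G = [set 0]).
Hypothesis BC_range : forall w : W, exists p q, [/\ F p, G q & B (C w) = p + q].
Variables (T M : R).
Hypotheses (T_gt0 : 0 < T) (M_gt0 : 0 < M).

Local Notation Cy := (C_on i C).
Local Notation P := (XBC j i B C F G).

Hypothesis h3 : forall y, DA y ->
  (norm_L1 `]0%R, T[ (fun t => Cy (S t y)) <= (M * rnorm y)%:E)%E.
Hypothesis h4 : forall u : R -> U, in_L1 `]0, T[ u ->
  let z r := bochner_int `]0, r[ (fun s => Sm (r - s) (B (u s))) in
  {ae lebesgue_measure, forall r : R, 0 < r < T -> range (j \o i) (z r)} /\
  (upper_int `]0%R, T[ (fun r => rnorm (C (emb_inv (j \o i) (z r))))
    <= M%:E * norm_L1 `]0%R, T[ u)%E.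
Variable d : R.
Hypothesis d_gt0 : 0 < d.
Hypothesis h5 : forall y (phi : R -> {linear X -> K^o}), DA y ->
  (forall t : R, 0 <= t <= T -> duality_map (S t y) (phi t)) ->
  ((d * rnorm (S T y) ^+ 2)%:E
    <= upper_int `[0%R, T] (fun t => sre (phi t (P (S t y)))))%E.
Variables k1 k2 : R.
Hypotheses (k1_ge0 : 0 <= k1) (k2_ge0 : 0 <= k2).
Hypothesis h6 : forall y z, DA y -> DA z ->
  exists phi psi, [/\ duality_map y phi, duality_map z psi &
    rnorm (phi (P y) - psi (P z)) <=
      k1 * (norm_DC i C y + norm_DC i C z) * rnorm (y - z) +
      k2 * (rnorm y + rnorm z) * rnorm (Cy (y - z))].
Variable k : R.
Hypothesis k_gt0 : 0 < k.
Hypothesis adm : forall (w : R -> U) (x : X), uapprox `[0, T] w ->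
  is_bochner_int `]0, T[ (fun s => Sm (T - s) (B (w s))) (j x) ->
  ((rnorm x)%:E <= k%:E * norm_L1 `]0%R, T[ w)%E.

Let j_inj : injective j := (extrapolation_inj_cont Xm_extr).1.
Let j_cont : continuous j := (extrapolation_inj_cont Xm_extr).2.

Variable m : R.
Hypothesis m_gt0 : 0 < m.
Hypothesis m_le1 : m <= 1.
Hypothesis mM : m * M <= 1 / 2.
Variable Tm : R -> {linear X -> X}.
Local Notation Dm := (dom_ABC j i B C DA).
Local Notation AB := (ABC j i B C Am m).
Hypothesis Tm_gen : generates Dm AB Tm.

Let S_C0 := A_gen.1.
Let Tm_C0 := Tm_gen.1.

Let kap := k * (2 * M).
Let c1 := k1 * kap * ((2 + kap) * T + 3 * M) + k2 * (2 + kap) * (2 * M ^+ 2).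
(** Feedback gains [m * d] and loses [m ^+ 2] times this constant. The number [c1]
    bounds the difference between the two duality pairings, integrated along the
    free and the closed-loop orbits; the other term is the price of replacing the
    first orbit by the second at time [T]. *)
Definition loss_constant := 2 * c1 + 2 * d * kap ^+ 2.

(** The orbit of a smoothed state [Phi x'], with [Phi] as in [smoothing]. Being
    [Phi] applied to an orbit, it stays in the domain, and [A] is bounded after
    [Phi]: hence [A (y t)], the observation [u] and [b] are continuous in time,
    which makes every integral below an integral of a continuous function. *)
Section Orbit.
Variables (Phi : X -> X) (x' : X).
Hypothesis PhiD : forall z, Dm (Phi z).
Hypothesis PhiB : forall y z, Phi (y - z) = Phi y - Phi z.
Hypothesis PhiZ : forall a z, Phi (rscale a z) = rscale a (Phi z).
Hypothesis Phi_bd : exists c : R, forall z, rnorm (Phi z) <= c * rnorm z.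
Hypothesis PhiT : forall (t : R) z, 0 <= t -> Tm t (Phi z) = Phi (Tm t z).

Let y0 := Phi x'.
Let y t := Tm (pos t) y0.
Let v t := Tm (pos t) (AB y0).
Let z t := S (pos t) y0.
Let b t := P (y t).
Let u t := Cy (y t).

Let yPhi t : y t = Phi (Tm (pos t) x').
Proof. by rewrite /y PhiT ?pos_ge0. Qed.

Let y_Dm t : Dm (y t). Proof. by rewrite yPhi. Qed.

Let domE t := dom_ABC_E W_inter j_inj Am_ext F_sub G_sub FX XG BC_range m (y_Dm t).

Let y_DA t : DA (y t). Proof. by have [] := domE t. Qed.

Let z_DA t : DA (z t) /\ A (z t) = S (pos t) (A y0).
Proof.
apply: (generator_semigroup A_gen); first exact: pos_ge0.
by have [] := PhiD x'.
Qed.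

Let v_eq t : v t = A (y t) - rscale m (b t).
Proof.
have [_ E] := generator_semigroup Tm_gen (pos_ge0 t) (PhiD x').
have [_ _ H] := domE t; exact: etrans (esym E) H.
Qed.

Let y_cont : continuous y. Proof. exact: orbit_cont. Qed.
Let z_cont : continuous z. Proof. exact: orbit_cont. Qed.
Let v_cont : continuous v. Proof. exact: orbit_cont. Qed.

Let Ay_cont : continuous (fun t => A (y t)).
Proof.
have PhiDA w : DA (Phi w) by have [] := PhiD w.
have [c c0 hc] := generator_comp_bounded A_gen PhiDA PhiB PhiZ Phi_bd.
have cT := orbit_cont Tm_C0 (x := x').
move=> t; apply/rcvgP => e e0; have ec : 0 < e / c by rewrite divr_gt0.
have /rcvgP/(_ _ ec) := cT t; apply: filterS => s st.
have [_ <-] := generatorB A_gen (y_DA s) (y_DA t).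
rewrite !yPhi -PhiB (le_lt_trans (hc _))//.
by rewrite mulrC -ltr_pdivlMr.
Qed.

Let u_cont : continuous u.
Proof. exact: (C_on_cont W_inter C_cont A_gen). Qed.

Let Cz_cont : continuous (fun t => Cy (z t)).
Proof.
apply: (C_on_cont W_inter C_cont A_gen) => //; first by move=> t; have [] := z_DA t.
move=> t; under eq_fun do rewrite (z_DA _).2.
exact: (orbit_cont S_C0).
Qed.

Let b_cont : continuous b.
Proof.
have bE t : b t = rscale m^-1 (A (y t) - v t).
  by rewrite v_eq subKr rscaleVK// gt_eqF.
have -> : b = fun t => rscale m^-1 (A (y t) - v t) by apply/funext.
move=> t.
by apply: cvg_rscale; [exact: cvg_cst|apply: cvgB; [exact: Ay_cont|exact: v_cont]].
Qed.

Let y_at0 : y 0 = y0.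
Proof. by rewrite /y posE//; have [_ h _ _] := Tm_C0; exact: h. Qed.

Let y_rderiv t : 0 <= t -> rderiv y t (v t).
Proof.
move=> t0; rewrite /v posE//.
exact: (orbit_rderiv Tm_gen t0 (PhiD x')).
Qed.

Let y_sol t : 0 <= t -> rderiv y t (A (y t) - rscale m (b t)).
Proof. by rewrite -v_eq; exact: y_rderiv. Qed.

Let jb t : 0 <= t -> j (b t) = B (u t).
Proof. by move=> _; have [] := domE t. Qed.

Let zE t : 0 <= t -> z t = S t y0.
Proof. by move=> t0; rewrite /z posE. Qed.

Let n := rnorm y0.
Let Iu := (\int[mu]_(t in `[0, T]) rnorm (u t))%R.
Let ICz := (\int[mu]_(t in `[0, T]) rnorm (Cy (z t)))%R.
Let Id := (\int[mu]_(t in `[0, T]) rnorm (u t - Cy (z t)))%R.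

Let ru_cont : continuous (fun t => rnorm (u t)).
Proof. by move=> t; apply: cvg_rnorm; exact: u_cont. Qed.
Let rCz_cont : continuous (fun t => rnorm (Cy (z t))).
Proof. by move=> t; apply: cvg_rnorm; exact: Cz_cont. Qed.
Let rd_cont : continuous (fun t => rnorm (u t - Cy (z t))).
Proof. by move=> t; apply: cvg_rnorm; apply: cvgB; [exact: u_cont|exact: Cz_cont]. Qed.

Let CyB t : Cy (y t - z t) = u t - Cy (z t).
Proof. by rewrite (C_onB _ W_inter)//; have [] := z_DA t. Qed.

(** With [closed_observation], the two orbits stay within a distance of order [m]
    of each other, uniformly on the period. *)
Let orbit_dist t : 0 <= t <= T -> rnorm (y t - z t) <= m * k * Iu.
Proof.
move=> /[dup] tT /andP[t0 _]; rewrite zE// -y_at0.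
exact: (perturbed_orbit_dist A_gen j_cont Sm_ext m_gt0 y_cont b_cont u_cont
  (fun t _ => y_DA t) y_sol jb T_gt0 k_gt0 adm).
Qed.

(** The difference of the orbits is [m] times a convolution of the observation
    [u] itself, and [h4] bounds the observation of such a convolution by [u]. *)
Let observed_dist : Id <= m * M * Iu.
Proof.
have mD : measurable (`]0, T[%classic : set R) by exact: measurable_itv.
have fin_itv r : (mu `]0%R, r[ < +oo)%E.
  by rewrite lebesgue_measure_itv /=; case: ifP => _; rewrite ?ltry// -EFinB ltry.
have uT : uapprox `]0, T[ u.
  by apply: uapprox_subset (uapprox_cont 0 T u_cont); exact: subset_itv_oo_cc.
have [_] := h4 (uapprox_in_L1 mD (fin_itv T) uT).
rewrite norm_L1_cont// -/Iu -EFinM => hI.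
have cf : continuous (fun r => m^-1 * rnorm (u r - Cy (z r))).
  by move=> r; apply: cvgM; [exact: cvg_cst|exact: rd_cont].
have := le_trans (le_upper_int cf _ _) hI.
rewrite lee_fin RintegralZ_cont//.
set J := (\int[mu]_(t in _) _)%R; have -> : J = Id by [].
move=> H; have : m^-1 * Id <= M * Iu.
  apply: H => [r|r /andP[r0 rT]]; first by rewrite mulr_ge0 ?invr_ge0 ?(ltW m_gt0) ?rnorm_ge0.
  have voc := variation_of_constants A_gen j_cont Sm_ext m_gt0 y_cont b_cont
    (fun t _ => y_DA t) y_sol jb (ltW r0).
  rewrite (bochner_intE (measurable_itv _) (fin_itv r) voc) y_at0 -zE ?(ltW r0)//.
  have zDA : DA (z r) by have [] := z_DA r.
  have [Dw _] := generatorB A_gen (y_DA r) zDA.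
  have [w' iw] := domain_range W_inter Dw.
  rewrite iw -linear_rscale -[j _]/((j \o i) _) emb_invK; last first.
    by apply: inj_comp => //; case: W_inter.
  rewrite linear_rscale rnorm_scale normrN gtr0_norm ?invr_gt0//.
  by rewrite -CyB iw (C_onE C W_inter).
rewrite mulrC ler_pdivrMr// => /le_trans; apply.
by rewrite mulrC mulrA.
Qed.

Let free_observation : ICz <= M * n.
Proof.
have y0D : DA y0 by have [] := PhiD x'.
have := h3 y0D; rewrite -lee_fin; apply: le_trans.
rewrite -norm_L1_cont// /norm_L1 le_eqVlt; apply/orP; left; apply/eqP.
apply: eq_integral => t; rewrite inE /= in_itv /= => /andP[t0 _].
by rewrite zE// ltW.
Qed.

(** As [m * M <= 1 / 2], the difference of the observations can be absorbed into
    the left-hand side. *)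
Let closed_observation : Iu <= 2 * M * n.
Proof.
have : Iu <= ICz + Id.
  rewrite /Iu /ICz /Id -RintegralD_cont//.
  apply: le_Rintegral_cont => // [|t _].
    by move=> t; apply: cvgD; [exact: rCz_cont|exact: rd_cont].
  by rewrite -{1}(subrK (Cy (z t)) (u t)) addrC [leRHS]addrC addrC; exact: ler_rnormD.
have := observed_dist; have := free_observation.
have Iu0 : 0 <= Iu by apply: Rintegral_ge0 => t _; exact: rnorm_ge0.
have := ler_wpM2r Iu0 mM; lra.
Qed.

Let rho t := k1 * (norm_DC i C (y t) + norm_DC i C (z t)) * rnorm (y t - z t) +
  k2 * (rnorm (y t) + rnorm (z t)) * rnorm (Cy (y t - z t)).

Let ry_cont : continuous (fun t => rnorm (y t)).
Proof. by move=> t; apply: cvg_rnorm; exact: y_cont. Qed.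
Let rz_cont : continuous (fun t => rnorm (z t)).
Proof. by move=> t; apply: cvg_rnorm; exact: z_cont. Qed.
Let ryz_cont : continuous (fun t => rnorm (y t - z t)).
Proof. by move=> t; apply: cvg_rnorm; apply: cvgB; [exact: y_cont|exact: z_cont]. Qed.

Let rho_cont : continuous rho.
Proof.
have -> : rho = fun t => k1 * ((rnorm (y t) + rnorm (u t)) + (rnorm (z t) + rnorm (Cy (z t)))) *
    rnorm (y t - z t) + k2 * (rnorm (y t) + rnorm (z t)) * rnorm (u t - Cy (z t)).
  by apply/funext => t; rewrite /rho CyB.
move=> t; apply: cvgD.
  apply: cvgM; last exact: ryz_cont.
  apply: cvgM; first exact: cvg_cst.
  by apply: cvgD; apply: cvgD; [exact: ry_cont|exact: ru_cont|exact: rz_cont|exact: rCz_cont].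
apply: cvgM; last exact: rd_cont.
apply: cvgM; first exact: cvg_cst.
by apply: cvgD; [exact: ry_cont|exact: rz_cont].
Qed.

(** Dissipativity of [A] bounds the pairing of the closed-loop orbit with its
    projected feedback by the decrease of the squared norm divided by [2 * m].
    By [h6] this pairing is, up to [rho], that of the free orbit, whose integral
    [h5] bounds below. The functionals are chosen by [h6] at each time, without
    any measurability, which the upper integral in [h5] and [energy_estimate]
    permit. *)
Let energy_balance : d * rnorm (S T y0) ^+ 2 <=
  m^-1 * ((n ^+ 2 - rnorm (y T) ^+ 2) / 2) + (\int[mu]_(t in `[0, T]) rho t)%R.
Proof.
have zDA t : DA (z t) by have [] := z_DA t.
have /choice[pp hpp] t : exists pq : {linear X -> K^o} * {linear X -> K^o},
    [/\ duality_map (y t) pq.1, duality_map (z t) pq.2 &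
      rnorm (pq.1 (P (y t)) - pq.2 (P (z t))) <= rho t].
  by have [phi [psi h]] := h6 (y_DA t) (zDA t); exists (phi, psi).
pose psi t := (pp t).2.
have y0D : DA y0 by have [] := PhiD x'.
rewrite -lee_fin.
have psi_dual t : 0 <= t <= T -> duality_map (S t y0) (psi t).
  by move=> /andP[t0 _]; rewrite -zE//; have [] := hpp t.
apply: le_trans (h5 y0D psi_dual) _.
(* The curve is continued by its tangent line to negative times. *)
pose ye t := y t + rscale (Num.min t 0) (AB y0).
have min_cont : continuous (fun t : R => Num.min t 0).
  by move=> t; apply: continuous_min; [exact: cvg_id|exact: cvg_cst].
have ye_cont : continuous ye.
  move=> t; apply: cvgD; first exact: y_cont.
  by apply: cvg_rscale; [exact: min_cont|exact: cvg_cst].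
have yeE t : 0 <= t -> ye t = y t.
  by move=> t0; rewrite /ye min_r// rscale0r addr0.
have ye_rderiv t : -1 <= t <= T -> rderiv ye t (v t).
  move=> _; have [t0|t0] := leP 0 t.
    apply: (@eq_rderiv _ _ _ y); last exact: y_rderiv.
    by move=> h h0; rewrite yeE// addr_ge0.
  apply/rderivP => e e0; exists (- t) => [|h /andP[h0 ht]]; first by rewrite oppr_gt0.
  have th : t + h < 0 by rewrite -ltrBrDl sub0r.
  have neg s : s < 0 -> ye s = y0 + rscale s (AB y0).
    move=> s0; rewrite /ye min_l ?(ltW s0)//; congr (_ + _).
    by rewrite -y_at0 /y /pos !max_r ?(ltW s0).
  have -> : v t = AB y0.
    by rewrite /v /pos max_r ?(ltW t0)//; have [_ h1 _ _] := Tm_C0; exact: h1.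
  rewrite !neg// rscaleDl addrA (addrAC (y0 + _)) subrr add0r subrr rnorm0.
  by rewrite mulr_ge0// ltW.
have m0 : 0 <= m^-1 by rewrite invr_ge0 ltW.
have := @energy_estimate _ _ X ye v T m^-1 (fun t => sre (psi t (P (S t y0)))) rho
  T_gt0 m0 ye_cont v_cont ye_rderiv rho_cont.
rewrite !yeE ?(ltW T_gt0)// y_at0; apply => t h tT h0.
have /andP[t0 _] := tT.
rewrite yeE// -zE// mulrC.
have [yphi zpsi prho] := hpp t; set phi := (pp t).1 in yphi prho; rewrite -/(psi t) in zpsi prho.
have sre_rho : sre (psi t (P (z t)) : K) <= sre (phi (P (y t)) : K) + rho t.
  rewrite -lerBlDl -sreB; apply: le_trans (le_trans (ler_sre_norm _) _) prho.
  by rewrite -[X in sre X]normrN opprB.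
have mb : m * sre (phi (P (y t)) : K) = sre (phi (A (y t)) : K) - sre (phi (v t) : K).
  rewrite -sre_dual_rscale -sre_dualB; congr (sre (phi _)).
  by rewrite v_eq subKr.
have diss := dissipative A_gen S_contr (y_DA t) yphi.
have back := duality_map_le (y t - rscale h (v t)) yphi.
rewrite sre_dualB sre_dual_rscale (duality_map_self yphi) in back.
have -> : rnorm (y t) * (rnorm (y t - rscale h (v t)) - rnorm (y t)) =
  rnorm (y t) * rnorm (y t - rscale h (v t)) - rnorm (y t) ^+ 2 by ring.
have h1 : - (h * sre (phi (v t) : K)) <=
  rnorm (y t) * rnorm (y t - rscale h (v t)) - rnorm (y t) ^+ 2 by lra.
have h2 : sre (phi (P (y t)) : K) <= m^-1 * (- sre (phi (v t) : K)).
  by rewrite -(ler_pM2l m_gt0) mulrA divff ?gt_eqF// mul1r mb; lra.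
have h3' := ler_wpM2l m0 h1.
have h4' := ler_wpM2l (ltW h0) h2.
have h5' := ler_wpM2l (ltW h0) sre_rho.
rewrite mulrC; apply: (le_trans h5'); rewrite mulrDr lerD2r.
apply: (le_trans h4'); apply: le_trans h3'.
by rewrite mulrCA mulrN.
Qed.

Let z_le t : 0 <= t -> rnorm (z t) <= n.
Proof. by move=> t0; rewrite zE//; exact: S_contr. Qed.

Let rho_int : (\int[mu]_(t in `[0, T]) rho t)%R <= m * n ^+ 2 * c1.
Proof.
have n0 : 0 <= n by exact: rnorm_ge0.
have kap0 : 0 <= kap by rewrite !mulr_ge0// ltW.
have Iu0 : 0 <= Iu by apply: Rintegral_ge0 => t _; exact: rnorm_ge0.
have e_le : m * k * Iu <= m * kap * n.
  rewrite /kap -!mulrA ler_pM2l// ler_pM2l//.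
  by rewrite mulrA; exact: closed_observation.
pose a0 := (2 + kap) * n; pose e := m * kap * n.
have e0 : 0 <= e by rewrite !mulr_ge0// ltW.
have yz t : 0 <= t <= T -> rnorm (y t - z t) <= e.
  by move=> tT; apply: le_trans (orbit_dist tT) e_le.
have yz_le t : 0 <= t <= T -> rnorm (y t) + rnorm (z t) <= a0.
  move=> /[dup] tT /andP[t0 _]; have h1 := z_le t0; have h2 := yz t tT.
  have h3' : rnorm (y t) <= rnorm (y t - z t) + rnorm (z t).
    by rewrite -{1}(subrK (z t) (y t)); exact: ler_rnormD.
  have h4' : e <= kap * n by rewrite /e -mulrA ler_piMl// mulr_ge0.
  by rewrite /a0; lra.
pose g t := k1 * e * ((a0 + rnorm (u t)) + rnorm (Cy (z t))) + k2 * a0 * rnorm (u t - Cy (z t)).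
have a00 : 0 <= a0 by rewrite mulr_ge0// addr_ge0.
have cau : continuous (fun t => a0 + rnorm (u t)).
  by move=> t; apply: cvgD; [exact: cvg_cst|exact: ru_cont].
have cauz : continuous (fun t => (a0 + rnorm (u t)) + rnorm (Cy (z t))).
  by move=> t; apply: cvgD; [exact: cau|exact: rCz_cont].
have cg1 : continuous (fun t => k1 * e * ((a0 + rnorm (u t)) + rnorm (Cy (z t)))).
  by move=> t; apply: cvgM; [exact: cvg_cst|exact: cauz].
have cg2 : continuous (fun t => k2 * a0 * rnorm (u t - Cy (z t))).
  by move=> t; apply: cvgM; [exact: cvg_cst|exact: rd_cont].
have cg : continuous g by move=> t; apply: cvgD; [exact: cg1|exact: cg2].
have rho_g t : 0 <= t <= T -> rho t <= g t.
  move=> tT; rewrite /rho /g CyB /norm_DC lerD//.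
    rewrite -mulrA -[leRHS]mulrA ler_wpM2l// mulrC ler_pM ?rnorm_ge0 ?addr_ge0 ?rnorm_ge0 ?yz//.
    by have := yz_le t tT; rewrite -/(u t); lra.
  by rewrite ler_wpM2r ?rnorm_ge0// ler_wpM2l// yz_le.
apply: le_trans (le_Rintegral_cont rho_cont cg rho_g) _.
rewrite (RintegralD_cont _ cg1 cg2) !RintegralZ_cont// (RintegralD_cont _ cau rCz_cont).
rewrite (RintegralD_cont _ (fun t => cvg_cst a0) ru_cont) Rintegral_cst_itv ?(ltW T_gt0)//.
rewrite -/Iu -/ICz -/Id.
have Id_le : Id <= m * M * (2 * M * n).
  apply: le_trans observed_dist _; rewrite ler_wpM2l ?closed_observation//.
  by rewrite mulr_ge0// ltW.
have s1 : a0 * T + Iu + ICz <= (2 + kap) * n * T + 3 * M * n.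
  by have := closed_observation; have := free_observation; rewrite /a0; lra.
have k1e : 0 <= k1 * e by rewrite mulr_ge0.
have k2a : 0 <= k2 * a0 by rewrite mulr_ge0.
apply: le_trans (lerD (ler_wpM2l k1e s1) (ler_wpM2l k2a Id_le)) _.
rewrite le_eqVlt; apply/orP; left; apply/eqP; rewrite /e /a0 /c1; ring.
Qed.

Lemma smooth_orbit_estimate :
  rnorm (Tm T y0) ^+ 2 * (1 + m * d) <= n ^+ 2 * (1 + m ^+ 2 * loss_constant).
Proof.
have kap0 : 0 <= kap by rewrite !mulr_ge0// ltW.
have TT : 0 <= T <= T by rewrite lexx ltW.
have -> : Tm T y0 = y T by rewrite /y posE// ltW.
apply: contraction_arith energy_balance rho_int _ => //.
- exact: rnorm_ge0.
- exact: rnorm_ge0.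
- exact: rnorm_ge0.
- by rewrite m_gt0.
- exact: ltW.
rewrite -(zE (ltW T_gt0)) -{1}(subrK (z T) (y T)) addrC.
apply: le_trans (ler_rnormD _ _) _; rewrite lerD2l.
apply: le_trans (orbit_dist TT) _.
rewrite /kap -!mulrA ler_pM2l// ler_pM2l// mulrA; exact: closed_observation.
Qed.

End Orbit.

(** Both sides are continuous in [x], and smoothed states are dense. *)
Lemma closed_loop_estimate x :
  rnorm (Tm T x) ^+ 2 * (1 + m * d) <= rnorm x ^+ 2 * (1 + m ^+ 2 * loss_constant).
Proof.
have [h _ _ _] := Tm_C0; have cT : continuous (Tm T) by apply: h; exact: ltW.
have /choice[Px hP] (l : nat) : exists p : X, rnorm (p - x) < l.+1%:R^-1 /\
    rnorm (Tm T p) ^+ 2 * (1 + m * d) <= rnorm p ^+ 2 * (1 + m ^+ 2 * loss_constant).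
  have l0 : 0 < l.+1%:R^-1 :> R by rewrite invr_gt0.
  have [Phi [x' [hx PhiD [PhiB PhiZ] Phi_bd PhiT]]] := smoothing Tm_gen x l0.
  by exists (Phi x'); split => //; exact: smooth_orbit_estimate.
have Pcv : Px l @[l --> \oo] --> x.
  apply/rcvgP => e e0; apply: filterS (cvgr_lt _ (@cvg_invS R) _ e0) => l.
  by apply: lt_trans; exact: (hP l).1.
have c1' : rnorm (Tm T (Px l)) ^+ 2 * (1 + m * d) @[l --> \oo] -->
    rnorm (Tm T x) ^+ 2 * (1 + m * d).
  apply: cvgM; last exact: cvg_cst.
  rewrite expr2; under eq_fun do rewrite expr2.
  have h1 : rnorm (Tm T (Px l)) @[l --> \oo] --> rnorm (Tm T x).
    by apply: cvg_rnorm; apply: (@cvg_comp _ _ _ Px (Tm T) _ (nbhs x) _ Pcv); exact: cT.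
  exact: (cvgM h1 h1).
have c2' : rnorm (Px l) ^+ 2 * (1 + m ^+ 2 * loss_constant) @[l --> \oo] -->
    rnorm x ^+ 2 * (1 + m ^+ 2 * loss_constant).
  apply: cvgM; last exact: cvg_cst.
  rewrite expr2; under eq_fun do rewrite expr2.
  exact: (cvgM (cvg_rnorm Pcv) (cvg_rnorm Pcv)).
apply: (ler_cvg_to c1' c2'); apply: nearW => l; exact: (hP l).2.
Qed.

End ClosedLoop.

(** * Exponential stability *)
Section Thresholds.
Variable R : realType.

(** The gain is of first order in [m] and the loss of second order, so the ratio
    [(1 + m ^+ 2 * c) / (1 + m * d)] is less than 1 when [m] is small; [q] is its
    square root. *)
Lemma small_gain (m c d : R) : 0 < m -> 0 <= c -> m * (c + 1) < d ->
  exists2 q : R, 0 < q < 1 & forall a b : R, 0 <= a -> 0 <= b ->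
    a ^+ 2 * (1 + m * d) <= b ^+ 2 * (1 + m ^+ 2 * c) -> a <= q * b.
Proof.
move=> m0 c0 mcd; have d0 : 0 < d by apply: le_lt_trans mcd; rewrite mulr_ge0 ?addr_ge0// ltW.
have md0 : 0 < 1 + m * d by rewrite addr_gt0// mulr_gt0.
have mc0 : 0 < 1 + m ^+ 2 * c by rewrite ltr_pwDl// mulr_ge0 ?sqr_ge0.
pose r := (1 + m ^+ 2 * c) / (1 + m * d).
have r0 : 0 < r by rewrite divr_gt0.
have r1 : r < 1.
  rewrite ltr_pdivrMr// mul1r ltrD2l expr2 -mulrA ltr_pM2l//.
  by apply: le_lt_trans mcd; rewrite ler_pM2l// lerDl.
exists (Num.sqrt r).
  by rewrite sqrtr_gt0 r0 /= -sqrtr1 ltr_sqrt.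
move=> a b a0 b0 H.
rewrite -(ler_pXn2r (n := 2))// ?nnegrE ?mulr_ge0 ?sqrtr_ge0//.
rewrite exprMn sqr_sqrtr ?(ltW r0)// /r mulrAC ler_pdivlMr//.
by rewrite [leRHS]mulrC.
Qed.

End Thresholds.

Theorem theorem1 (R : realType) (cplx : bool)
  (X U : completeNormedModType (scalars R cplx))
  (* the contraction semigroup S and its generator A *)
  (DA : set X) (A : X -> X) (S : R -> {linear X -> X})
  (A_gen : generates DA A S) (S_contr : contractive S)
  (* X_{-1}, S_{-1} and A_{-1} *)
  (Xm : completeNormedModType (scalars R cplx)) (j : {linear X -> Xm})
  (Xm_extr : extrapolation_space DA A j)
  (Am : Xm -> Xm) (Sm : R -> {linear Xm -> Xm})
  (Am_gen : generates (range j) Am Sm)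
  (Sm_ext : forall (t : R) (x : X), 0 <= t -> Sm t (j x) = j (S t x))
  (Am_ext : forall x, DA x -> Am (j x) = j (A x))
  (* the intermediate space W *)
  (W : completeNormedModType (scalars R cplx)) (i : {linear W -> X})
  (W_inter : between_domain_and_space DA A i)
  (B : {linear U -> Xm}) (B_cont : continuous B)
  (C : {linear W -> U}) (C_cont : continuous C)
  (* the subspaces defining _X(BC) *)
  (F G : set Xm) (F_sub : linear_subspace F) (G_sub : linear_subspace G)
  (FX : F `<=` range j) (XG : range j `&` G = [set 0])
  (BC_range : forall w : W, exists p q, [/\ F p, G q & B (C w) = p + q])
  (T M : R) (T_gt0 : 0 < T) (M_gt0 : 0 < M)
  (h1 : exists2 alpha1 : R, 0 < alpha1 &
     forall m : R, 0 < m < alpha1 ->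
       exists Tm : R -> {linear X -> X},
         generates (dom_ABC j i B C DA) (ABC j i B C Am m) Tm)
  (h2 : forall u : R -> U, in_L1 `]0, T[ u ->
     range j (bochner_int `]0, T[ (fun s => Sm (T - s) (B (u s)))))
  (h3 : forall y, DA y ->
     (norm_L1 `]0%R, T[ (fun t => C_on i C (S t y)) <= (M * rnorm y)%:E)%E)
  (h4 : forall u : R -> U, in_L1 `]0, T[ u ->
     let z r := bochner_int `]0, r[ (fun s => Sm (r - s) (B (u s))) in
     {ae lebesgue_measure, forall r : R, 0 < r < T -> range (j \o i) (z r)} /\
     (upper_int `]0%R, T[ (fun r => rnorm (C (emb_inv (j \o i) (z r))))
       <= M%:E * norm_L1 `]0%R, T[ u)%E)
  (h5 : exists2 delta : R, 0 < delta &
     forall y (phi : R -> {linear X -> (scalars R cplx)^o}), DA y ->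
       (forall t : R, 0 <= t <= T -> duality_map (S t y) (phi t)) ->
       ((delta * rnorm (S T y) ^+ 2)%:E
         <= upper_int `[0%R, T]
              (fun t => sre (phi t (XBC j i B C F G (S t y)))))%E)
  (h6 : exists k1 k2 : R, [/\ 0 <= k1, 0 <= k2 &
     forall y z, DA y -> DA z ->
       exists phi psi, [/\ duality_map y phi, duality_map z psi &
         rnorm (phi (XBC j i B C F G y) - psi (XBC j i B C F G z)) <=
           k1 * (norm_DC i C y + norm_DC i C z) * rnorm (y - z) +
           k2 * (rnorm y + rnorm z) * rnorm (C_on i C (y - z))]]) :
  exists2 alpha : R, 0 < alpha &
    forall m : R, 0 < m < alpha ->
      exists Tm : R -> {linear X -> X},
        generates (dom_ABC j i B C DA) (ABC j i B C Am m) Tm /\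
        exp_stable Tm.
Proof.
have [alpha1 alpha1_gt0 Tm_ex] := h1.
have [d d_gt0 h5'] := h5.
have [k1 [k2 [k1_ge0 k2_ge0 h6']]] := h6.
have [j_inj j_cont] := extrapolation_inj_cont Xm_extr.
have [eta [Q [Q_res jQ _]]] := Xm_extr.
have [L [c [LB c_ge0 L_le L_cvg]]] := resolvent_approx A_gen Q_res.
have L_bound l x : rnorm (L l x) <= c l * rnorm (j x) by rewrite jQ.
have [k k_gt0 adm] := admissible_bound Am_gen.1 B_cont j_inj LB c_ge0 L_bound L_cvg h2.
pose c2 := loss_constant T M d k1 k2 k.
have kM : 0 <= k * (2 * M) by rewrite !mulr_ge0// ltW.
have c2_ge0 : 0 <= c2.
  rewrite /c2 /loss_constant; do ?[apply: addr_ge0|apply: mulr_ge0|exact: ltW|exact: sqr_ge0] => //.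
have c21 : 0 < c2 + 1 by rewrite ltr_wpDl.
(* Below 1 / (2 M) the closed-loop observation is controlled by the free one;
   below d / (c2 + 1) the gain d of the feedback outweighs its loss c2. *)
exists (Num.min (Num.min alpha1 1) (Num.min (1 / 2 / M) (d / (c2 + 1)))).
  by rewrite !lt_min alpha1_gt0 ltr01 !divr_gt0.
move=> m /andP[m_gt0]; rewrite !lt_min => /andP[/andP[m1 m_lt1] /andP[mM mc]].
have [|Tm Tm_gen] := Tm_ex m; first by rewrite m_gt0.
exists Tm; split => //.
have mM' : m * M <= 1 / 2 by rewrite -ler_pdivlMr// ltW.
have mcd : m * (c2 + 1) < d by rewrite -ltr_pdivlMr.
have [q q01 hq] := small_gain m_gt0 c2_ge0 mcd.
apply: (exp_stable_of_contraction Tm_gen.1 T_gt0 q01) => x.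
apply: hq; [exact: rnorm_ge0|exact: rnorm_ge0|].
exact: (closed_loop_estimate A_gen S_contr Xm_extr Sm_ext Am_ext W_inter C_cont
  F_sub G_sub FX XG BC_range T_gt0 M_gt0 h3 h4 d_gt0 h5' k1_ge0 k2_ge0 h6' k_gt0 adm
  m_gt0 (ltW m_lt1) mM' Tm_gen).
Qed.
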